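(* There exists an absolute constant $K>0$ such that the following holds. Let $C_0>0$, let $W:\mathbb{R}\to\mathbb{C}$ satisfy $$\|\partial_x^jW\|_{L^\infty(\mathbb{R})}\le C_0^j,\qquad\forall j\in\mathbb{N}_0,$$ and let $u\in L^2(\mathbb{R})$ with $\|u\|_{L^2(\mathbb{R})}=1$ be a solution of $|D|u=W(x)u$ on $\mathbb{R}$. Then for any $\kappa>1$, $$\|\partial_x^nu\|_{L^2(\mathbb{R})}\le\left(\kappa C_0+K\left(\frac1{\log\kappa}+1\right)\right)^n\frac{n!}{\log^n(n+e)},\qquad\forall n\in\mathbb{N}_0 .$$
   Context: $|D|$ is the Fourier multiplier operator on $\mathbb{R}$ with symbol $|\xi|$. $\mathbb{N}_0=\{0,1,2,\dots\}$; $\log$ is the natural logarithm and $\log^n(y)=(\log y)^n$. *)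

(* Defs.v *)
From HB Require Import structures.
From mathcomp Require Import all_boot all_order all_algebra.
From mathcomp Require Import complex.
From mathcomp Require Import all_classical all_reals all_analysis.

Set Implicit Arguments.
Unset Strict Implicit.
Unset Printing Implicit Defensive.

Import Order.TTheory GRing.Theory Num.Theory.
Import numFieldNormedType.Exports.

Local Open Scope classical_set_scope.
Local Open Scope ring_scope.
Local Open Scope complex_scope.

Section Defs.
Variable R : realType.
Local Notation mu := (@lebesgue_measure R).
Implicit Types (f g u : R -> R[i]) (phi : R -> R).

Definition cmodulus (z : R[i]) : R := ComplexField.Normc.normc z.

Definition cmeasurable f : Prop :=
  measurable_fun [set: R] (@complex.Re R \o f) /\
  measurable_fun [set: R] (@complex.Im R \o f).

Definition clocally_integrable f : Prop :=
  locally_integrable [set: R] (@complex.Re R \o f) /\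
  locally_integrable [set: R] (@complex.Im R \o f).

(* Meaningful when the real and imaginary parts of f are integrable on D. *)
Definition cintegral (D : set R) f : R[i] :=
  Rintegral mu D (@complex.Re R \o f) +i* Rintegral mu D (@complex.Im R \o f).

Definition cLnorm (p : \bar R) f : \bar R :=
  Lnorm mu p (fun x => (cmodulus (f x))%:E).

Definition square_integrable f : Prop :=
  cmeasurable f /\ (cLnorm 2%:E f < +oo)%E.

Definition test_function phi : Prop :=
  (forall n x, derivable (derive1n n phi) x 1) /\
  (exists M : R, forall x, M < `|x| -> phi x = 0).

(* g is the n-th derivative of f in the sense of distributions. Real-valued
   test functions suffice, as the identity is linear in phi. *)
Definition weak_derivative (n : nat) f g : Prop :=
  [/\ clocally_integrable f, clocally_integrable g &
      forall phi, test_function phi ->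
        cintegral [set: R] (fun x => f x * (derive1n n phi x)%:C) =
        (-1) ^+ n * cintegral [set: R] (fun x => g x * (phi x)%:C)].

Definition truncated_fourier (A : R) f (xi : R) : R[i] :=
  cintegral `[- A, A]
    (fun x => f x * (cos (x * xi) -i* sin (x * xi))).

(* g is the Fourier-Plancherel transform of f: the limit in L^2 of the
   integrals of f(x) exp(- i x xi) over [- A, A] as A tends to +oo. The
   normalization is immaterial for Fourier multipliers. *)
Definition fourier_transform f g : Prop :=
  [/\ square_integrable f, square_integrable g &
      cLnorm 2%:E (fun xi => truncated_fourier A f xi - g xi)
        @[A --> +oo] --> 0%E].

(* m(D) u = g for u and g in L^2. *)
Definition fourier_multiplier (m : R -> R[i]) u g : Prop :=
  exists uh gh, [/\ fourier_transform u uh, fourier_transform g gh &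
    {ae mu, forall xi, m xi * uh xi = gh xi}].

Definition absD u g : Prop := fourier_multiplier (fun xi => `|xi|%:C) u g.

End Defs.

(* Main.v *)
Require Import Defs.
From mathcomp Require Import all_boot all_order all_algebra.
From mathcomp Require Import complex.
From mathcomp Require Import all_classical all_reals all_analysis.
From mathcomp Require Import measurable_realfun.
From mathcomp Require Import ring lra.
From mathcomp Require Import ess_sup_inf.

Set Implicit Arguments.
Unset Strict Implicit.
Unset Printing Implicit Defensive.
Import Order.TTheory GRing.Theory Num.Theory.
Import numFieldNormedType.Exports.

Local Open Scope classical_set_scope.
Local Open Scope ring_scope.
Local Open Scope complex_scope.

(** The equation |D| u = W u reads |xi| uh(xi) = gh(xi) for the transforms uh of u and gh of
    W u. Formally, the n-th derivative of u has the L2 norm of the moment |xi|^n uh, and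
    |xi|^(n+1) uh = |xi|^n gh is the transform of the n-th derivative of W u up to unimodular
    factors. With b_n the norm of the n-th derivative, Leibniz' formula gives
      b_(n+1) <= sum_(j <= n) C(n, j) C0^(n-j) b_j,   b_0 <= 1.
    Both the regularity of u and the bounds come from this recurrence ([moment_sequence]).

    To make the recurrence rigorous without assuming any regularity of u, derivatives are
    replaced by finite differences. The bounds on the weak derivatives of W imply that its
    k-th differences of step h are at most (C0 h)^k almost everywhere
    ([fdiff_bound_of_weak]). If the first n moments of uh are finite, Fourier inversion and
    Bessel's inequality bound the differences of u ([nrm_iter_fdiff_moment]); the discrete
    Leibniz rule bounds those of W u ([nrm_iter_fdiffM]); and Bessel's inequality and Fatou's
    lemma as h tends to 0 bound the n-th moment of gh, that is, the next moment of uh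
    ([nrm_moment_product]). Inversion is available because uh is integrable as soon as uh and
    |xi| uh are square integrable ([cL1_of_moment]). The finiteness of all moments gives the
    weak derivatives, as inverse transforms of (i xi)^n uh ([weak_derivative_of_moments]).

    The Fourier analysis rests on Abel summation: the weight exp(- eps |xi|) has the Poisson
    kernel as its transform, which is positive with integral 2 pi. Schur's test then yields
    Bessel's inequality ([bessel]), and the limit eps -> 0 yields Parseval's identity against
    the indicator of an interval ([parseval_ind]), from which the inversion formula follows by
    Lebesgue differentiation ([fourier_inversion]).

    The recurrence is solved by comparison with the exponential series: for every t >= 0,
    b_n t^n / n! <= exp(D) with D = t exp(C0 t) ([sequence_exp_bound]), because the weighted
    terms a_n = b_n t^n / n! satisfy a_(n+1) <= D / (n+1) max_(j <= n) a_j. With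
    M = kappa' C0 + O(1/log kappa + 1) and 1 < kappa' < kappa, the choice t = log(n + e) / M
    makes exp(D) at most (A / M)^n, where A is the constant that is raised to the power n in
    the theorem ([factorial_bound]). *)

(** * Complex numbers and their modulus *)

Section Modulus.
Variable R : realType.
Implicit Types (z w : R[i]) (a b t : R).

Lemma cReD z w : complex.Re (z + w) = complex.Re z + complex.Re w.
Proof. by case: z; case: w. Qed.

Lemma cImD z w : complex.Im (z + w) = complex.Im z + complex.Im w.
Proof. by case: z; case: w. Qed.

Lemma cReN z : complex.Re (- z) = - complex.Re z.
Proof. by case: z. Qed.

Lemma cImN z : complex.Im (- z) = - complex.Im z.
Proof. by case: z. Qed.

Lemma cReM z w : complex.Re (z * w) =
  complex.Re z * complex.Re w - complex.Im z * complex.Im w.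
Proof. by case: z; case: w. Qed.

Lemma cImM z w : complex.Im (z * w) =
  complex.Re z * complex.Im w + complex.Im z * complex.Re w.
Proof. by case: z; case: w. Qed.

Lemma cReZ a z : complex.Re (a%:C * z) = a * complex.Re z.
Proof. by rewrite cReM /= mul0r subr0. Qed.

Lemma cImZ a z : complex.Im (a%:C * z) = a * complex.Im z.
Proof. by rewrite cImM /= mul0r addr0. Qed.

Lemma complexP z w : complex.Re z = complex.Re w -> complex.Im z = complex.Im w -> z = w.
Proof. by case: z => a b; case: w => c d /= -> ->. Qed.

Lemma cmodulus_def z :
  cmodulus z = Num.sqrt (complex.Re z ^+ 2 + complex.Im z ^+ 2).
Proof. by case: z. Qed.

Lemma sqr_cmodulus z : cmodulus z ^+ 2 = complex.Re z ^+ 2 + complex.Im z ^+ 2.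
Proof. by rewrite cmodulus_def sqr_sqrtr// addr_ge0// sqr_ge0. Qed.

Lemma cmodulus_ge0 z : 0 <= cmodulus z.
Proof. by rewrite cmodulus_def sqrtr_ge0. Qed.

Lemma cmodulusM z w : cmodulus (z * w) = cmodulus z * cmodulus w.
Proof. exact: ComplexField.Normc.normcM. Qed.

Lemma cmodulusD z w : cmodulus (z + w) <= cmodulus z + cmodulus w.
Proof. exact: le_normcD. Qed.

Lemma cmodulusN z : cmodulus (- z) = cmodulus z.
Proof. exact: normcN. Qed.

Lemma cmodulusJ z : cmodulus (conjc z) = cmodulus z.
Proof. by rewrite !cmodulus_def; case: z => a b /=; rewrite sqrrN. Qed.

Lemma cmodulusR a : cmodulus a%:C = `|a|.
Proof. by rewrite cmodulus_def /= expr0n addr0 sqrtr_sqr. Qed.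

Lemma cmodulus0 : cmodulus (0 : R[i]) = 0.
Proof. by rewrite (cmodulusR 0) normr0. Qed.

Lemma cmodulus1 : cmodulus (1 : R[i]) = 1.
Proof. by rewrite (cmodulusR 1) normr1. Qed.

Lemma cmodulusX z n : cmodulus (z ^+ n) = cmodulus z ^+ n.
Proof.
elim: n => [|n ih]; first by rewrite !expr0 cmodulus1.
by rewrite !exprS cmodulusM ih.
Qed.

Lemma cmodulus_eq0 z : cmodulus z = 0 -> z = 0.
Proof. exact: ComplexField.Normc.eq0_normc. Qed.

Lemma Re_le_cmodulus z : `|complex.Re z| <= cmodulus z.
Proof.
by rewrite cmodulus_def -sqrtr_sqr ler_wsqrtr// lerDl sqr_ge0.
Qed.

Lemma Im_le_cmodulus z : `|complex.Im z| <= cmodulus z.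
Proof.
by rewrite cmodulus_def -sqrtr_sqr ler_wsqrtr// lerDr sqr_ge0.
Qed.

Lemma cmodulus_le z : cmodulus z <= `|complex.Re z| + `|complex.Im z|.
Proof.
rewrite -(@ler_pXn2r _ 2)// ?nnegrE ?cmodulus_ge0 ?addr_ge0//.
rewrite sqr_cmodulus sqrrD !real_normK ?num_real// -addrA lerD2l lerDr.
by rewrite mulrn_wge0// mulr_ge0.
Qed.

Definition expi t : R[i] := cos t +i* sin t.

Lemma conjM z w : (conjc (z * w)) = (conjc z) * (conjc w).
Proof. exact: rmorphM. Qed.

Lemma mul_conjc z : z * conjc z = (cmodulus z ^+ 2)%:C.
Proof.
rewrite sqr_cmodulus; case: z => a b; apply: complexP => /=; ring.
Qed.

Lemma cmodulus_expi t : cmodulus (expi t) = 1.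
Proof. by rewrite cmodulus_def /= cos2Dsin2 sqrtr1. Qed.

Lemma expiD s t : expi (s + t) = expi s * expi t.
Proof.
apply: complexP; first by rewrite cReM /= cosD.
by rewrite cImM /= sinD addrC; congr (_ + _); exact: mulrC.
Qed.

Lemma expiN t : expi (- t) = (conjc (expi t)).
Proof. by rewrite /expi cosN sinN. Qed.

(** By the mean value theorem, since the cosine is bounded by one. *)
Lemma normr_sin_le t : `|sin t| <= `|t|.
Proof.
wlog t0 : t / 0 <= t.
  move=> h; have [/h//|/ltW t0] := leP 0 t.
  by rewrite -normrN -sinN -(normrN t) h// oppr_ge0.
have [c _] := @MVT_segment R sin cos 0 t t0 (fun x _ => is_derive_sin x)
  (continuous_subspaceT (@continuous_sin R)).
rewrite sin0 !subr0 => ->; rewrite normrM ler_piMl//.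
by rewrite ler_norml cos_geN1 cos_le1.
Qed.

Lemma cmodulus_expiB1_sin t : cmodulus (expi t - 1) = 2 * `|sin (t / 2)|.
Proof.
apply/eqP; rewrite -(@eqrXn2 _ 2)// ?mulr_ge0 ?cmodulus_ge0// sqr_cmodulus /=; apply/eqP.
have tE : t = t / 2 + t / 2 by field.
rewrite exprMn real_normK ?num_real// {1 2}tE cosD sinD.
have := cos2Dsin2 (t / 2); set c := cos _; set s := sin _ => cs.
have -> : c * c = 1 - s ^+ 2 by rewrite -cs -expr2 addrK.
rewrite oppr0 addr0 [c * s]mulrC -mulrDr.
have c2 : c ^+ 2 = 1 - s ^+ 2 by rewrite -cs addrK.
have -> : (s * (c + c)) ^+ 2 = 4 * s ^+ 2 * c ^+ 2 by ring.
by rewrite c2; ring.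
Qed.

(** The chord is shorter than the arc. *)
Lemma cmodulus_expiB1 t : cmodulus (expi t - 1) <= `|t|.
Proof.
rewrite cmodulus_expiB1_sin.
have := normr_sin_le (t / 2); rewrite normrM (ger0_norm (_ : 0 <= 2^-1))// => h.
lra.
Qed.

End Modulus.

Arguments expi : simpl never.
Arguments cmodulus : simpl never.

Section ComplexMeasurable.
Variable R : realType.

(** On the line this is convertible to [cmeasurable]; other domains are needed for
    Fubini's theorem on the plane. *)
Definition cmeas d (T : measurableType d) (f : T -> R[i]) : Prop :=
  measurable_fun [set: T] (@complex.Re R \o f) /\
  measurable_fun [set: T] (@complex.Im R \o f).

Section Closure.
Context d (T : measurableType d).
Implicit Types (f g : T -> R[i]) (phi : T -> R).

Lemma cmeasD f g : cmeas f -> cmeas g -> cmeas (fun x => f x + g x).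
Proof.
move=> [rf jf] [rg jg]; split.
- rewrite /comp; under eq_fun do rewrite cReD; exact: measurable_funD.
- rewrite /comp; under eq_fun do rewrite cImD; exact: measurable_funD.
Qed.

Lemma cmeasN f : cmeas f -> cmeas (fun x => - f x).
Proof.
move=> [rf jf]; split.
- rewrite /comp; under eq_fun do rewrite cReN; exact: measurableT_comp.
- rewrite /comp; under eq_fun do rewrite cImN; exact: measurableT_comp.
Qed.

Lemma cmeasB f g : cmeas f -> cmeas g -> cmeas (fun x => f x - g x).
Proof. by move=> mf mg; apply: cmeasD => //; exact: cmeasN. Qed.

Lemma cmeasM f g : cmeas f -> cmeas g -> cmeas (fun x => f x * g x).
Proof.
move=> [rf jf] [rg jg]; split.
- rewrite /comp; under eq_fun do rewrite cReM.
  by apply: measurable_funB; exact: measurable_funM.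
- rewrite /comp; under eq_fun do rewrite cImM.
  by apply: measurable_funD; exact: measurable_funM.
Qed.

Lemma cmeas_cst (z : R[i]) : cmeas (fun _ : T => z).
Proof. by split; exact: measurable_cst. Qed.

Lemma cmeasX f n : cmeas f -> cmeas (fun x => f x ^+ n).
Proof.
move=> mf; elim: n => [|n ih].
  by under eq_fun do rewrite expr0; exact: cmeas_cst.
by under eq_fun do rewrite exprS; exact: cmeasM.
Qed.

Lemma cmeasR phi : measurable_fun [set: T] phi -> cmeas (fun x => (phi x)%:C).
Proof. by move=> mphi; split => //; exact: measurable_cst. Qed.

Lemma cmeasJ f : cmeas f -> cmeas (fun x => (conjc (f x))).
Proof.
move=> [rf jf]; split.
- rewrite (_ : _ \o _ = @complex.Re R \o f)//.
  by apply/funext => x /=; case: (f x).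
- rewrite (_ : _ \o _ = (fun x => - complex.Im (f x))).
    exact: measurableT_comp.
  by apply/funext => x /=; case: (f x).
Qed.

Lemma cmeas_expi phi : measurable_fun [set: T] phi ->
  cmeas (fun x => expi (phi x)).
Proof.
move=> mphi; split; rewrite /comp /=.
- apply: (measurableT_comp (f := @cos R)) => //.
  by apply: continuous_measurable_fun; exact: continuous_cos.
- apply: (measurableT_comp (f := @sin R)) => //.
  by apply: continuous_measurable_fun; exact: continuous_sin.
Qed.

Lemma measurable_cmodulus f : cmeas f ->
  measurable_fun [set: T] (fun x => cmodulus (f x)).
Proof.
move=> [rf jf]; under eq_fun do rewrite cmodulus_def.
apply: (measurableT_comp (f := @Num.sqrt R)).
  by apply: continuous_measurable_fun; exact: sqrt_continuous.
by apply: measurable_funD; apply: measurable_funX.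
Qed.

Lemma cmeas_comp d' (T' : measurableType d') (g : T' -> R[i]) (h : T -> T') :
  cmeas g -> measurable_fun [set: T] h -> cmeas (fun x => g (h x)).
Proof.
move=> [rg jg] mh; split.
- exact: (measurableT_comp rg mh).
- exact: (measurableT_comp jg mh).
Qed.

End Closure.
End ComplexMeasurable.

(** * Integration of complex functions *)

Section ChangeOfVariable.
Variable R : realType.
Local Notation mu := (@lebesgue_measure R).

Lemma lebesgue_measure_shift (h : R) (A : set R) : measurable A ->
  pushforward mu (fun x => x + h : measurableTypeR R) A = mu A.
Proof.
have mh : measurable_fun [set: R] (fun x => x + h : measurableTypeR R).
  exact: measurable_funD.
move=> mA; apply/esym/lebesgue_measure_unique => //= _ [[a b]] _ <-.
rewrite /pushforward /=.
have -> : (fun x : R => x + h) @^-1` `]a, b]%classic = `]a - h, b - h]%classic.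
  by apply/seteqP; split=> x /=; rewrite !in_itv/= ltrBlDr lerBrDr.
rewrite !lebesgue_measure_itv/= !lte_fin ltrD2r; case: ifP => // _.
by rewrite -!EFinD; congr EFin; ring.
Qed.

Section Invariant.
Variable phi : R -> R.
Hypothesis mphi : measurable_fun [set: R] (phi : R -> measurableTypeR R).
Hypothesis phimu : forall A : set R, measurable A ->
  pushforward mu (phi : R -> measurableTypeR R) A = mu A.

Lemma ge0_integral_comp (f : R -> \bar R) : measurable_fun [set: R] f ->
  (forall x, 0 <= f x)%E -> (\int[mu]_x f (phi x) = \int[mu]_x f x)%E.
Proof.
move=> mf f0.
transitivity (\int[pushforward mu (phi : R -> measurableTypeR R)]_x f x)%E.
  by rewrite ge0_integral_pushforward.
by apply: eq_measure_integral => A mA _; exact: phimu.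
Qed.

Lemma integral_comp (f : R -> \bar R) : measurable_fun [set: R] f ->
  (\int[mu]_x f (phi x) = \int[mu]_x f x)%E.
Proof.
move=> mf; rewrite integralE [in RHS]integralE; congr (_ - _)%E.
- transitivity (\int[mu]_x f^\+%E (phi x))%E.
    by apply: eq_integral => x _; rewrite !funeposE.
  by apply: ge0_integral_comp => //; exact: measurable_funepos.
- transitivity (\int[mu]_x f^\-%E (phi x))%E.
    by apply: eq_integral => x _; rewrite !funenegE.
  by apply: ge0_integral_comp => //; exact: measurable_funeneg.
Qed.

End Invariant.

Lemma integral_shift (h : R) (f : R -> \bar R) : measurable_fun [set: R] f ->
  (\int[mu]_x f (x + h)%R = \int[mu]_x f x)%E.
Proof.
apply: integral_comp; first exact: measurable_funD.
exact: lebesgue_measure_shift.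
Qed.

Lemma integral_opp (f : R -> \bar R) : measurable_fun [set: R] f ->
  (\int[mu]_x f (- x)%R = \int[mu]_x f x)%E.
Proof.
by apply: integral_comp => //; exact: lebesgue_measureN.
Qed.

Lemma ae_shift (h : R) (P : set R) : {ae mu, forall x, P x} ->
  {ae mu, forall x, P (x + h)}.
Proof.
move=> [N [mN N0 PN]].
have mh : measurable_fun [set: R] (fun x => x + h : measurableTypeR R).
  exact: measurable_funD.
exists ((fun x => x + h : measurableTypeR R) @^-1` N); split.
- by rewrite -[X in measurable X]setTI; exact: mh.
- by rewrite -N0 -(lebesgue_measure_shift h mN).
- by move=> x /= Px; apply: PN.
Qed.

End ChangeOfVariable.

Section AlmostEverywhere.
Variable R : realType.
Local Notation mu := (@lebesgue_measure R).
Implicit Types (P Q : R -> Prop).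

Lemma aeS P Q : (forall x, P x -> Q x) ->
  {ae mu, forall x, P x} -> {ae mu, forall x, Q x}.
Proof.
move=> PQ h; have F : Filter (almost_everywhere mu).
  exact: ae_filter_ringOfSetsType.
by apply: filterS h; exact: PQ.
Qed.

Lemma aeI P Q : {ae mu, forall x, P x} -> {ae mu, forall x, Q x} ->
  {ae mu, forall x, P x /\ Q x}.
Proof.
by have F := ae_filter_ringOfSetsType mu; move=> p q; exact: filterI.
Qed.

Lemma aeT P : (forall x, P x) -> {ae mu, forall x, P x}.
Proof.
by have F := ae_filter_ringOfSetsType mu; move=> Px; exact: nearW.
Qed.

Lemma ae_neq (c : R) : {ae mu, forall x, x != c}.
Proof.
exists [set c]; split => //; first exact: lebesgue_measure_set1.
by move=> x /= /negP; rewrite negbK => /eqP.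
Qed.

End AlmostEverywhere.

Section ComplexIntegral.
Variable R : realType.
Local Notation mu := (@lebesgue_measure R).
Implicit Types (f g : R -> R[i]).

Definition Cint f : R[i] := cintegral [set: R] f.

Definition cL1 f : Prop :=
  cmeasurable f /\ mu.-integrable [set: R] (fun x => (cmodulus (f x))%:E).

Lemma cL1_meas f : cL1 f -> cmeasurable f. Proof. by case. Qed.

Lemma cL1_Re f : cL1 f -> mu.-integrable [set: R] (EFin \o (@complex.Re R \o f)).
Proof.
move=> [[rf jf] fi]; apply: le_integrable fi => //; first exact/measurable_EFinP.
move=> x _ /=; rewrite lee_fin [leRHS]ger0_norm ?cmodulus_ge0//.
exact: Re_le_cmodulus.
Qed.

Lemma cL1_Im f : cL1 f -> mu.-integrable [set: R] (EFin \o (@complex.Im R \o f)).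
Proof.
move=> [[rf jf] fi]; apply: le_integrable fi => //; first exact/measurable_EFinP.
move=> x _ /=; rewrite lee_fin [leRHS]ger0_norm ?cmodulus_ge0//.
exact: Im_le_cmodulus.
Qed.

Lemma cL1_le f (g : R -> R) : cmeasurable f ->
  mu.-integrable [set: R] (EFin \o g) ->
  (forall x, cmodulus (f x) <= g x) -> cL1 f.
Proof.
move=> mf gi fg; split => //; apply: le_integrable gi => //.
  by apply/measurable_EFinP; exact: measurable_cmodulus.
move=> x _ /=; rewrite lee_fin ger0_norm ?cmodulus_ge0//.
by rewrite (le_trans (fg x))// ler_norm.
Qed.

Lemma cL1I f : mu.-integrable [set: R] (EFin \o (@complex.Re R \o f)) ->
  mu.-integrable [set: R] (EFin \o (@complex.Im R \o f)) -> cL1 f.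
Proof.
move=> rf jf.
apply: (@cL1_le _ (fun x => `|complex.Re (f x)| + `|complex.Im (f x)|)).
- by split; apply/measurable_EFinP; [exact: (measurable_int mu rf)|exact: (measurable_int mu jf)].
- exact: (integrableD measurableT (integrable_norm rf) (integrable_norm jf)).
- by move=> x; exact: cmodulus_le.
Qed.

Lemma cL1D f g : cL1 f -> cL1 g -> cL1 (fun x => f x + g x).
Proof.
move=> [mf fi] [mg gi].
apply: (@cL1_le _ (fun x => cmodulus (f x) + cmodulus (g x))).
- exact: cmeasD.
- exact: (integrableD measurableT fi gi).
- by move=> x; exact: cmodulusD.
Qed.

Lemma cL1M_bounded f (b : R -> R[i]) (M : R) : cL1 f -> cmeasurable b ->
  (forall x, cmodulus (b x) <= M) -> cL1 (fun x => b x * f x).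
Proof.
move=> [mf fi] mb bM; apply: (@cL1_le _ (fun x => M * cmodulus (f x))).
- exact: cmeasM.
- by under [X in integrable _ _ X]eq_fun do rewrite /= EFinM; exact: integrableZl.
- by move=> x; rewrite cmodulusM ler_wpM2r// cmodulus_ge0.
Qed.

Lemma cL1Z f c : cL1 f -> cL1 (fun x => c * f x).
Proof. by move=> fi; apply: (@cL1M_bounded _ (fun=> c) (cmodulus c)) => //; exact: cmeas_cst. Qed.

Lemma cL1N f : cL1 f -> cL1 (fun x => - f x).
Proof. by move=> /(cL1Z (-1)); under eq_fun do rewrite mulN1r. Qed.

Lemma cL1B f g : cL1 f -> cL1 g -> cL1 (fun x => f x - g x).
Proof. by move=> fi gi; apply: cL1D => //; exact: cL1N. Qed.

Lemma cL1J f : cL1 f -> cL1 (fun x => (conjc (f x))).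
Proof.
move=> [mf fi]; split; first exact: cmeasJ.
by under [X in integrable _ _ X]eq_fun do rewrite cmodulusJ.
Qed.

Lemma CintD f g : cL1 f -> cL1 g ->
  Cint (fun x => f x + g x) = Cint f + Cint g.
Proof.
move=> fi gi; apply: complexP; rewrite ?cReD ?cImD /= /comp.
- under eq_Rintegral do rewrite cReD.
  by rewrite RintegralD//; exact: cL1_Re.
- under eq_Rintegral do rewrite cImD.
  by rewrite RintegralD//; exact: cL1_Im.
Qed.

Lemma CintZ f c : cL1 f -> Cint (fun x => c * f x) = c * Cint f.
Proof.
move=> fi; have [rf jf] := (cL1_Re fi, cL1_Im fi).
have iZ (a : R) (h : R -> R) : mu.-integrable [set: R] (EFin \o h) ->
    mu.-integrable [set: R] (EFin \o (fun x => a * h x)).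
  by move=> hi; under [X in integrable _ _ X]eq_fun do rewrite /= EFinM; exact: integrableZl.
apply: complexP; rewrite ?cReM ?cImM /= /comp.
- under eq_Rintegral do rewrite cReM.
  by rewrite RintegralB ?RintegralZl//; exact: iZ.
- under eq_Rintegral do rewrite cImM.
  by rewrite RintegralD ?RintegralZl//; exact: iZ.
Qed.

Lemma CintN f : cL1 f -> Cint (fun x => - f x) = - Cint f.
Proof.
by move=> fi; rewrite -mulN1r -CintZ//; congr Cint; apply/funext => x; rewrite mulN1r.
Qed.

Lemma CintB f g : cL1 f -> cL1 g ->
  Cint (fun x => f x - g x) = Cint f - Cint g.
Proof. by move=> fi gi; rewrite CintD ?CintN//; exact: cL1N. Qed.

Lemma CintJ f : cL1 f -> Cint (fun x => (conjc (f x))) = (conjc (Cint f)).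
Proof.
move=> fi; apply: complexP => /=.
  by apply: eq_Rintegral => x _ /=; case: (f x).
rewrite /comp -mulN1r -RintegralZl//; last exact: cL1_Im.
by apply: eq_Rintegral => x _ /=; case: (f x) => a b /=; rewrite mulN1r.
Qed.

(** Multiplying by the conjugate of the integral makes the integral real and nonnegative,
    which reduces the inequality to the monotonicity of real integrals. *)
Lemma le_cmodulus_Cint f : cL1 f ->
  ((cmodulus (Cint f))%:E <= \int[mu]_x (cmodulus (f x))%:E)%E.
Proof.
move=> fi; set I := Cint f.
have fin : (\int[mu]_x (cmodulus (f x))%:E)%E \is a fin_num.
  by apply: integrable_fin_num => //; case: fi.
rewrite -(fineK fin) lee_fin.
have [I0|I0] := eqVneq (cmodulus I) 0.
  by rewrite I0 fine_ge0// integral_ge0// => x _; rewrite lee_fin cmodulus_ge0.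
have Ipos : 0 < cmodulus I by rewrite lt_neqAle eq_sym I0 cmodulus_ge0.
rewrite -(ler_pM2l Ipos).
have -> : cmodulus I * cmodulus I = complex.Re (Cint (fun x => (conjc I) * f x)).
  rewrite CintZ// -/I -expr2 sqr_cmodulus cReM.
  by case: (I) => a b /=; ring.
have fi' := cL1Z (conjc I) fi.
rewrite -[X in _ * X]/(Rintegral mu setT (fun x => cmodulus (f x))).
rewrite -RintegralZl//; last by case: fi.
apply: le_Rintegral => //; first exact: cL1_Re.
  under [X in integrable _ _ X]eq_fun do rewrite /= EFinM.
  by apply: integrableZl => //; case: fi.
move=> x _; apply: (le_trans (ler_norm _)); apply: (le_trans (Re_le_cmodulus _)).
by rewrite cmodulusM cmodulusJ.
Qed.

Lemma ae_eq_Cint f g : cmeasurable f -> cmeasurable g ->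
  {ae mu, forall x, f x = g x} -> Cint f = Cint g.
Proof.
move=> [rf jf] [rg jg] fg; apply: complexP => /=; congr fine.
- apply: ae_eq_integral => //; [exact/measurable_EFinP|exact/measurable_EFinP|].
  by apply: aeS fg => x /= ->.
- apply: ae_eq_integral => //; [exact/measurable_EFinP|exact/measurable_EFinP|].
  by apply: aeS fg => x /= ->.
Qed.

Lemma Cint_shift h f : cmeasurable f -> Cint (fun x => f (x + h)) = Cint f.
Proof.
move=> [rf jf]; apply: complexP => /=; congr fine.
- by apply: (integral_shift h (f := EFin \o (@complex.Re R \o f))); exact/measurable_EFinP.
- by apply: (integral_shift h (f := EFin \o (@complex.Im R \o f))); exact/measurable_EFinP.
Qed.

Lemma Cint_opp f : cmeasurable f -> Cint (fun x => f (- x)) = Cint f.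
Proof.
move=> [rf jf]; apply: complexP => /=; congr fine.
- by apply: (integral_opp (f := EFin \o (@complex.Re R \o f))); exact/measurable_EFinP.
- by apply: (integral_opp (f := EFin \o (@complex.Im R \o f))); exact/measurable_EFinP.
Qed.

Lemma cmeasurable_shift h f : cmeasurable f -> cmeasurable (fun x => f (x + h)).
Proof.
move=> mf; apply: (cmeas_comp (h := fun x : R => x + h : R) mf).
exact: measurable_funD.
Qed.

Lemma cmeasurable_opp f : cmeasurable f -> cmeasurable (fun x => f (- x)).
Proof.
by move=> mf; apply: (cmeas_comp (h := fun x : R => - x : R) mf); exact: oppr_measurable.
Qed.

Lemma cL1_shift h f : cL1 f -> cL1 (fun x => f (x + h)).
Proof.
move=> [mf fi]; split; first exact: cmeasurable_shift.
have mm := measurable_cmodulus mf.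
apply/integrableP; split.
  by apply/measurable_EFinP; apply: measurable_cmodulus; exact: cmeasurable_shift.
move/integrableP: fi => [_]; apply: le_lt_trans.
rewrite (integral_shift h (f := fun x => `|(cmodulus (f x))%:E|%E))//.
by apply/measurable_EFinP; exact: measurableT_comp.
Qed.

Lemma cL1_opp f : cL1 f -> cL1 (fun x => f (- x)).
Proof.
move=> [mf fi]; split; first exact: cmeasurable_opp.
have mm := measurable_cmodulus mf.
apply/integrableP; split.
  by apply/measurable_EFinP; apply: measurable_cmodulus; exact: cmeasurable_opp.
move/integrableP: fi => [_]; apply: le_lt_trans.
rewrite (integral_opp (f := fun x => `|(cmodulus (f x))%:E|%E))//.
by apply/measurable_EFinP; exact: measurableT_comp.
Qed.

Definition ccvg (z : nat -> R[i]) (w : R[i]) : Prop :=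
  cmodulus (z n - w) @[n --> \oo] --> 0.

(** Dominated convergence is applied to the modulus of the difference, so that real and
    imaginary parts need no separate treatment. *)
Lemma ccvg_dominated (F : nat -> R -> R[i]) f (g : R -> R) :
  (forall n, cL1 (F n)) -> cL1 f -> mu.-integrable [set: R] (EFin \o g) ->
  (forall n x, cmodulus (F n x - f x) <= g x) ->
  {ae mu, forall x, ccvg (F ^~ x) (f x)} ->
  ccvg (fun n => Cint (F n)) (Cint f).
Proof.
move=> Fi fi gi Fg Ff.
have mB n : measurable_fun [set: R] (fun x => (cmodulus (F n x - f x))%:E).
  apply/measurable_EFinP; apply: measurable_cmodulus; apply: cmeasB.
    by case: (Fi n).
  by case: fi.
have iB n : cL1 (fun x => F n x - f x) by exact: cL1B.
have [] := @dominated_convergence _ _ R mu setT measurableT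
  (fun n x => (cmodulus (F n x - f x))%:E) (cst 0%E) (EFin \o g) mB _ _ gi _.
- exact: measurable_cst.
- apply: aeS Ff => x Fx _.
  by apply/fine_cvgP; split; [exact: nearW|exact: Fx].
- apply: aeT => x n _ /=.
  by rewrite lee_fin ger0_norm ?cmodulus_ge0//; exact: Fg.
move=> _ _; rewrite integral0_eq// => h.
have : (fine (\int[mu]_x (cmodulus (F n x - f x))%:E)%E) @[n --> \oo] --> (0 : R).
  exact: (fine_cvg h).
move=> {}h; rewrite /ccvg.
apply: (@squeeze_cvgr _ _ _ _ (fun=> 0)
  (fun n => fine (\int[mu]_x (cmodulus (F n x - f x))%:E)%E)) => //.
- apply: nearW => n; rewrite cmodulus_ge0 -CintB//=.
  rewrite -lee_fin fineK; first exact: le_cmodulus_Cint.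
  by apply: integrable_fin_num => //; case: (iB n).
- exact: cvg_cst.
Qed.

Lemma ccvg_unique z w1 w2 : ccvg z w1 -> ccvg z w2 -> w1 = w2.
Proof.
move=> h1 h2; apply/eqP; rewrite -subr_eq0; apply/eqP/cmodulus_eq0.
have h : cmodulus (z n - w2) + cmodulus (z n - w1) @[n --> \oo] --> (0 : R).
  by rewrite -[X in _ --> X]addr0; exact: cvgD.
have h0 : (fun _ : nat => cmodulus (w1 - w2)) @ \oo --> (0 : R).
  apply: (@squeeze_cvgr _ _ _ _ (fun=> 0)
    (fun n => cmodulus (z n - w2) + cmodulus (z n - w1))) => //.
    apply: nearW => n; rewrite cmodulus_ge0 /=.
    have -> : w1 - w2 = (z n - w2) - (z n - w1) by ring.
    by rewrite (le_trans (cmodulusD _ _))// cmodulusN.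
  exact: cvg_cst.
have hc : (fun _ : nat => cmodulus (w1 - w2)) @ \oo --> cmodulus (w1 - w2).
  exact: cvg_cst.
exact: (cvg_unique (@Rhausdorff R) hc h0).
Qed.

End ComplexIntegral.

(** * Fubini's theorem and the L2 norm *)

Section Fubini.
Variable R : realType.
Local Notation mu := (@lebesgue_measure R).

Section RealFubini.
Variables (h : R * R -> R) (A B : R -> R).
Hypothesis mh : measurable_fun [set: R * R] h.
Hypothesis A0 : forall x, 0 <= A x.
Hypothesis B0 : forall x, 0 <= B x.
Hypothesis Ai : mu.-integrable [set: R] (EFin \o A).
Hypothesis Bi : mu.-integrable [set: R] (EFin \o B).
Hypothesis hAB : forall x y, `|h (x, y)| <= A x * B y.

Lemma integrable_sectionl x : mu.-integrable [set: R] (fun y => (h (x, y))%:E).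
Proof.
have gi : mu.-integrable [set: R] (EFin \o (fun y => A x * B y)).
  by under [X in integrable _ _ X]eq_fun do rewrite /= EFinM; exact: integrableZl.
apply: le_integrable gi => //.
  apply/measurable_EFinP; apply: (measurableT_comp mh).
  exact: pair1_measurable.
by move=> y _ /=; rewrite lee_fin (le_trans (hAB x y))// ler_norm.
Qed.

Lemma integrable_sectionr y : mu.-integrable [set: R] (fun x => (h (x, y))%:E).
Proof.
have gi : mu.-integrable [set: R] (EFin \o (fun x => B y * A x)).
  by under [X in integrable _ _ X]eq_fun do rewrite /= EFinM; exact: integrableZl.
apply: le_integrable gi => //.
  apply/measurable_EFinP; apply: (measurableT_comp mh).
  exact: pair2_measurable.
by move=> x _ /=; rewrite lee_fin (le_trans (hAB x y))// mulrC ler_norm.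
Qed.

(** A product majorant is integrable on the plane by Tonelli's theorem. *)
Lemma integrable_prod : (mu \x mu)%E.-integrable [set: R * R] (EFin \o h).
Proof.
apply/integrable12ltyP; first exact/measurable_EFinP.
apply: (@le_lt_trans _ _ (\int[mu]_x ((A x)%:E * \int[mu]_y (B y)%:E))%E).
  apply: ge0_le_integral => //.
  - by move=> x _; exact: integral_ge0.
  - have mn : measurable_fun [set: R * R] (fun z => `|(h z)%:E|%E).
      by apply/measurable_EFinP; exact: measurableT_comp.
    have := @measurable_fun_fubini_tonelli_F _ _ _ _ _ mu _ mn.
    by apply.
  - apply: emeasurable_funM; last exact: measurable_cst.
    exact: (measurable_int mu Ai).
  - move=> x _; rewrite -ge0_integralZl//.
    + apply: ge0_le_integral => //.
      * apply: measurableT_comp => //.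
        exact: (measurable_int mu (integrable_sectionl x)).
      * under eq_fun do rewrite -EFinM.
        apply/measurable_EFinP; apply: measurable_funM => //.
        by apply/measurable_EFinP; exact: (measurable_int mu Bi).
      * by move=> y _; rewrite /= -EFinM lee_fin.
    + exact: (measurable_int mu Bi).
    + by move=> y _; rewrite lee_fin.
    + by rewrite lee_fin.
have Bf : (\int[mu]_y (B y)%:E)%E \is a fin_num by exact: integrable_fin_num.
rewrite -(fineK Bf) ge0_integralZr//; last 3 first.
- exact: (measurable_int mu Ai).
- by move=> x _; rewrite lee_fin.
- by rewrite fineK// integral_ge0// => x _; rewrite lee_fin.
have Af : (\int[mu]_y (A y)%:E)%E \is a fin_num by exact: integrable_fin_num.
by rewrite -(fineK Af) -EFinM ltry.
Qed.

Lemma integrable_Rintegral_section :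
  mu.-integrable [set: R] (EFin \o (fun x => Rintegral mu setT (fun y => h (x, y)))).
Proof.
apply: eq_integrable (integrable_fubini_F integrable_prod) => //.
move=> x _ /=; rewrite /fubini_F /Rintegral fineK//.
exact: integrable_fin_num (integrable_sectionl x).
Qed.

Lemma Rfubini :
  Rintegral mu setT (fun x => Rintegral mu setT (fun y => h (x, y))) =
  Rintegral mu setT (fun y => Rintegral mu setT (fun x => h (x, y))).
Proof.
rewrite /Rintegral; congr fine.
transitivity (\int[mu]_x \int[mu]_y (h (x, y))%:E)%E.
  apply: eq_integral => x _; rewrite fineK//.
  exact: integrable_fin_num (integrable_sectionl x).
rewrite (Fubini integrable_prod); apply: eq_integral => x _; rewrite fineK//.
exact: integrable_fin_num (integrable_sectionr x).
Qed.

End RealFubini.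

Section ComplexFubini.
Variables (H : R * R -> R[i]) (A B : R -> R).
Hypothesis mH : cmeas H.
Hypothesis A0 : forall x, 0 <= A x.
Hypothesis B0 : forall x, 0 <= B x.
Hypothesis Ai : mu.-integrable [set: R] (EFin \o A).
Hypothesis Bi : mu.-integrable [set: R] (EFin \o B).
Hypothesis HAB : forall x y, cmodulus (H (x, y)) <= A x * B y.

Let mRe : measurable_fun [set: R * R] (@complex.Re R \o H). Proof. by case: mH. Qed.
Let mIm : measurable_fun [set: R * R] (@complex.Im R \o H). Proof. by case: mH. Qed.
Let ReAB x y : `|complex.Re (H (x, y))| <= A x * B y.
Proof. exact: (le_trans (Re_le_cmodulus _)). Qed.
Let ImAB x y : `|complex.Im (H (x, y))| <= A x * B y.
Proof. exact: (le_trans (Im_le_cmodulus _)). Qed.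

Lemma Cfubini : Cint (fun x => Cint (fun y => H (x, y))) =
                Cint (fun y => Cint (fun x => H (x, y))).
Proof.
apply: complexP => /=.
- exact: (Rfubini mRe A0 B0 Ai Bi ReAB).
- exact: (Rfubini mIm A0 B0 Ai Bi ImAB).
Qed.

Lemma cL1_Cint_section : cL1 (fun x => Cint (fun y => H (x, y))).
Proof.
apply: cL1I.
- exact: (integrable_Rintegral_section mRe A0 B0 Ai Bi ReAB).
- exact: (integrable_Rintegral_section mIm A0 B0 Ai Bi ImAB).
Qed.

End ComplexFubini.
End Fubini.

Section L2.
Variable R : realType.
Local Notation mu := (@lebesgue_measure R).
Implicit Types (f g : R -> R[i]).

Local Notation nrm f := (cLnorm 2%:E f).

(** The square of the norm, in the form to which limit theorems for integrals apply. *)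
Definition sqint f : \bar R := (\int[mu]_x (cmodulus (f x) ^+ 2)%:E)%E.

Lemma sqint_ge0 f : (0 <= sqint f)%E.
Proof. by apply: integral_ge0 => x _; rewrite lee_fin sqr_ge0. Qed.

Lemma cLnorm2E f : nrm f = (sqint f `^ 2^-1)%E.
Proof.
rewrite /cLnorm unlock; congr (_ `^ _)%E; apply: eq_integral => x _ /=.
by rewrite ger0_norm ?cmodulus_ge0// powR_mulrn ?cmodulus_ge0.
Qed.

Lemma nrm_ge0 f : (0 <= nrm f)%E. Proof. exact: Lnorm_ge0. Qed.

Lemma sqintE f : sqint f = (nrm f * nrm f)%E.
Proof.
rewrite cLnorm2E; case: (sqint f) (sqint_ge0 f) => [r||]//.
- have e : 2^-1 + 2^-1 = 1 :> R by field.
  rewrite lee_fin => r0; rewrite /= -EFinM -powRD ?e ?oner_eq0//.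
  by rewrite powRr1.
- by rewrite poweRyr ?mulyy// invr_eq0.
Qed.

Lemma nrm_leP f (r : R) : 0 <= r -> ((nrm f <= r%:E) <-> (sqint f <= (r ^+ 2)%:E))%E.
Proof.
move=> r0; rewrite sqintE expr2 EFinM.
have r0' : (0 <= r%:E)%E by rewrite lee_fin.
split=> h; first by apply: lee_pmul => //; exact: nrm_ge0.
rewrite leNgt; apply/negP => lt.
move: h; apply/negP; rewrite -ltNge.
case: (nrm f) lt => [s||]//; last first.
  by rewrite mulyy -EFinM => _; exact: ltry.
by rewrite lte_fin => rs; rewrite -!EFinM lte_fin; nra.
Qed.

Lemma square_integrableP f : cmeasurable f ->
  (nrm f < +oo)%E <-> (sqint f < +oo)%E.
Proof.
move=> mf; rewrite sqintE; have := nrm_ge0 f.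
by case: (nrm f) => [r||]// _; rewrite ?mulyy// -EFinM !ltry.
Qed.

Lemma measurable_sqmod f : cmeasurable f ->
  measurable_fun [set: R] (fun x => (cmodulus (f x) ^+ 2)%:E).
Proof.
move=> mf; apply/measurable_EFinP; apply: measurable_funX.
exact: measurable_cmodulus.
Qed.

Lemma square_integrable_sq f : square_integrable f ->
  mu.-integrable [set: R] (EFin \o (fun x => cmodulus (f x) ^+ 2)).
Proof.
move=> [mf /(square_integrableP mf) fi]; apply/integrableP; split.
  exact: measurable_sqmod.
by under eq_integral do rewrite /= ger0_norm ?sqr_ge0//.
Qed.

Lemma le_nrm (c : R) f g : 0 <= c -> cmeasurable f -> cmeasurable g ->
  {ae mu, forall x, cmodulus (f x) <= c * cmodulus (g x)} ->
  (nrm f <= c%:E * nrm g)%E.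
Proof.
move=> c0 mf mg fg.
have [c00|cn0] := eqVneq c 0.
  rewrite c00 mul0e; apply/(nrm_leP _ (lexx 0)).
  rewrite expr0n /sqint (ae_eq_integral (cst 0%E))//=; first by rewrite integral0.
  - exact: measurable_sqmod.
  - apply: aeS fg => x; rewrite c00 mul0r => h _ /=.
    have -> : cmodulus (f x) = 0 by apply/eqP; rewrite eq_le h cmodulus_ge0.
    by rewrite expr0n.
have cpos : 0 < c by rewrite lt_neqAle eq_sym cn0.
have := nrm_ge0 g.
case E : (nrm g) => [r||]// => [|_]; last by rewrite gt0_muley ?leey// lte_fin.
rewrite lee_fin -EFinM => r0; apply/nrm_leP; first exact: mulr_ge0.
have -> : ((c * r) ^+ 2)%:E = ((c ^+ 2)%:E * sqint g)%E.
  by rewrite sqintE E -!EFinM; congr EFin; ring.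
rewrite /sqint -ge0_integralZl//; last 3 first.
- exact: measurable_sqmod.
- by move=> x _; rewrite lee_fin sqr_ge0.
- by rewrite lee_fin sqr_ge0.
apply: ae_ge0_le_integral => //.
- by move=> x _; rewrite lee_fin sqr_ge0.
- exact: measurable_sqmod.
- by move=> x _; rewrite -EFinM lee_fin mulr_ge0// sqr_ge0.
- by apply: measurable_funeM; exact: measurable_sqmod.
- apply: aeS fg => x h _; rewrite -EFinM lee_fin -exprMn.
  by rewrite ler_pXn2r// nnegrE ?cmodulus_ge0// mulr_ge0// cmodulus_ge0.
Qed.

Lemma le_nrm1 f g : cmeasurable f -> cmeasurable g ->
  {ae mu, forall x, cmodulus (f x) <= cmodulus (g x)} -> (nrm f <= nrm g)%E.
Proof.
move=> mf mg h; rewrite -[leRHS]mul1e; apply: le_nrm => //.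
by apply: aeS h => x; rewrite mul1r.
Qed.

Lemma eq_nrm f g : (forall x, cmodulus (f x) = cmodulus (g x)) -> nrm f = nrm g.
Proof. by move=> fg; apply: eq_Lnorm => x; rewrite /= fg. Qed.

Lemma nrmD f g : cmeasurable f -> cmeasurable g ->
  (nrm (fun x => f x + g x)%R <= nrm f + nrm g)%E.
Proof.
move=> mf mg.
have /= := @minkowski_EFin _ _ R mu (fun x => cmodulus (f x))
  (fun x => cmodulus (g x)) 2 (measurable_cmodulus mf) (measurable_cmodulus mg).
have h12 : 1 <= 2 :> R by lra.
move=> /(_ h12); apply: le_trans.
set S := fun x => (cmodulus (f x) + cmodulus (g x))%:C.
have -> : ('N[mu]_2%:E[EFin \o ((fun x => cmodulus (f x)) \+ (fun x => cmodulus (g x)))%R])%E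
    = nrm S.
  apply: eq_Lnorm => x; congr EFin; rewrite /S cmodulusR ger0_norm//.
  by rewrite addr_ge0// cmodulus_ge0.
apply: le_nrm1.
- exact: cmeasD.
- by apply: cmeasR; apply: measurable_funD; exact: measurable_cmodulus.
- apply: aeT => x; rewrite cmodulusR ger0_norm ?cmodulusD//.
  by rewrite addr_ge0// cmodulus_ge0.
Qed.

Lemma nrmN f : nrm (fun x => - f x) = nrm f.
Proof. by apply: eq_nrm => x; rewrite cmodulusN. Qed.

Lemma nrmB f g : cmeasurable f -> cmeasurable g ->
  (nrm (fun x => f x - g x)%R <= nrm f + nrm g)%E.
Proof.
move=> mf mg; apply: (le_trans (nrmD mf (cmeasN mg))).
by rewrite nrmN.
Qed.

Lemma nrm_shift h f : cmeasurable f -> nrm (fun x => f (x + h)) = nrm f.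
Proof.
move=> mf; rewrite !cLnorm2E; congr (_ `^ _)%E.
by apply: (integral_shift h (f := fun x => (cmodulus (f x) ^+ 2)%:E)); exact: measurable_sqmod.
Qed.

Lemma nrm_opp f : cmeasurable f -> nrm (fun x => f (- x)) = nrm f.
Proof.
move=> mf; rewrite !cLnorm2E; congr (_ `^ _)%E.
by apply: (integral_opp (f := fun x => (cmodulus (f x) ^+ 2)%:E)); exact: measurable_sqmod.
Qed.

Lemma cauchy_schwarz f g : cmeasurable f -> cmeasurable g ->
  (\int[mu]_x (cmodulus (f x * g x)%R)%:E <= nrm f * nrm g)%E.
Proof.
move=> mf mg.
have h2 : 0 < 2 :> R by lra.
have e : 2^-1 + 2^-1 = 1 :> R by field.
have := hoelder mu (measurable_cmodulus mf) (measurable_cmodulus mg) h2 h2 e.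
rewrite Lnorm1; apply: le_trans; apply: ge0_le_integral => //.
- by move=> x _; rewrite lee_fin cmodulus_ge0.
- by apply/measurable_EFinP; apply: measurable_cmodulus; exact: cmeasM.
- by apply/measurable_EFinP; apply: measurableT_comp => //; apply: measurable_funM;
    exact: measurable_cmodulus.
- by move=> x _; rewrite /= lee_fin cmodulusM ler_norm.
Qed.

Lemma cL1M f g : square_integrable f -> square_integrable g ->
  cL1 (fun x => f x * g x).
Proof.
move=> [mf fi] [mg gi]; split; first exact: cmeasM.
apply/integrableP; split.
  by apply/measurable_EFinP; apply: measurable_cmodulus; exact: cmeasM.
under eq_integral do rewrite /= ger0_norm ?cmodulus_ge0//.
apply: (le_lt_trans (cauchy_schwarz mf mg)).
move: fi gi (nrm_ge0 f) (nrm_ge0 g).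
by case: (nrm f) => [a||]//; case: (nrm g) => [b||]// _ _ _ _; rewrite -EFinM ltry.
Qed.

Lemma square_integrableD f g : square_integrable f -> square_integrable g ->
  square_integrable (fun x => f x + g x).
Proof.
move=> [mf fi] [mg gi]; split; first exact: cmeasD.
by apply: (le_lt_trans (nrmD mf mg)); rewrite lte_add_pinfty.
Qed.

Lemma square_integrableN f : square_integrable f -> square_integrable (fun x => - f x).
Proof. by move=> [mf fi]; split; [exact: cmeasN|rewrite nrmN]. Qed.

Lemma square_integrableB f g : square_integrable f -> square_integrable g ->
  square_integrable (fun x => f x - g x).
Proof. by move=> fi gi; apply: square_integrableD => //; exact: square_integrableN. Qed.

Lemma square_integrable_le (c : R) f g : 0 <= c -> cmeasurable f -> square_integrable g ->
  {ae mu, forall x, cmodulus (f x) <= c * cmodulus (g x)} -> square_integrable f.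
Proof.
move=> c0 mf [mg gi] fg; split => //.
apply: (le_lt_trans (le_nrm c0 mf mg fg)).
by move: gi (nrm_ge0 g); case: (nrm g) => [a||]// _ _; rewrite -EFinM ltry.
Qed.

Lemma square_integrable_shift h f : square_integrable f ->
  square_integrable (fun x => f (x + h)).
Proof.
by move=> [mf fi]; split; [exact: cmeasurable_shift|rewrite nrm_shift].
Qed.

(** Fatou's lemma for the squared moduli. *)
Lemma sqint_fatou (F : nat -> R -> R[i]) f (M : \bar R) :
  (forall n, cmeasurable (F n)) ->
  (forall x, cmodulus (F n x) @[n --> \oo] --> cmodulus (f x)) ->
  (forall n, sqint (F n) <= M)%E -> (sqint f <= M)%E.
Proof.
move=> mF Ff FM.
have F0 n x : setT x -> (0 <= (cmodulus (F n x) ^+ 2)%:E)%E.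
  by move=> _; rewrite lee_fin sqr_ge0.
have := fatou mu measurableT (fun n => measurable_sqmod (mF n)) F0.
have -> : (\int[mu]_x limn_einf (fun n => (cmodulus (F n x) ^+ 2)%:E))%E = sqint f.
  apply: eq_integral => x _.
  have c2 : (cmodulus (F n x) ^+ 2)%:E @[n --> \oo] --> (cmodulus (f x) ^+ 2)%:E.
    apply/fine_cvgP; split; first exact: nearW.
    by rewrite expr2; apply: cvgM; exact: Ff.
  by have [-> _] := cvg_limn_einf_sup c2.
move=> /le_trans; apply; rewrite limn_einf_lim.
apply: lime_le; first exact: is_cvg_einfs.
apply: nearW => n; apply: (le_trans _ (FM n)); apply: ereal_inf_lbound.
by exists n => //=.
Qed.

End L2.

(** * The Poisson kernel *)

Section PoissonKernel.
Variable R : realType.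
Local Notation mu := (@lebesgue_measure R).

(** The derivative of [F] has to agree with [f] on the positive half-line only: for an
    integrand with [`|x|] a closed-form primitive without absolute value is enough. *)
Lemma ge0_integral_even_primitive (f F df : R -> R) (l : R) :
  (forall x, 0 <= f x) -> continuous f -> (forall x, f (- x) = f x) ->
  (forall x : R, is_derive x 1 F (df x)) -> (forall x, 0 < x -> df x = f x) ->
  F x @[x --> +oo] --> l ->
  (\int[mu]_x (f x)%:E = (2 * (l - F 0))%:E)%E.
Proof.
move=> f0 cf fe dF dff Fl.
rewrite ge0_symfun_integralT//; last by move=> x; rewrite /= fe.
have -> : [set x : R | 0 <= x] = `[0, +oo[%classic by rewrite set_itvcy.
rewrite (ge0_continuous_FTC2y (F := F) (l := l)) ?EFinM ?EFinB//.
- exact: continuous_subspaceT.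
- by apply: cvg_at_right_filter; apply: differentiable_continuous; apply/derivable1_diffP; apply: ex_derive.
- by move=> x; rewrite in_itv/= andbT => x0; rewrite derive1E derive_val dff.
Qed.

(** Abel's summation weight. Its Fourier transform is the Poisson kernel below, which is
    positive: this is what makes it preferable to a sharp truncation. *)
Definition abel_weight (eps xi : R) : R := expR (- (eps * `|xi|)).
Definition poisson (eps x : R) : R := 2 * eps / (eps ^+ 2 + x ^+ 2).

Lemma abel_weight_gt0 eps xi : 0 < abel_weight eps xi.
Proof. exact: expR_gt0. Qed.

Lemma abel_weight_le1 eps xi : 0 <= eps -> abel_weight eps xi <= 1.
Proof. by move=> e0; rewrite -expR0 ler_expR oppr_le0 mulr_ge0. Qed.

Lemma continuous_abel_weight eps : continuous (abel_weight eps).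
Proof.
move=> x; rewrite /abel_weight; apply: (@continuous_comp _ _ _ (fun x => - (eps * `|x|)) (@expR R)).
  apply: continuousN; apply: continuousM; first exact: cst_continuous.
  exact: norm_continuous.
exact: continuous_expR.
Qed.

Variable eps : R.
Hypothesis eps0 : 0 < eps.

Let den x : eps ^+ 2 + x ^+ 2 != 0.
Proof. by rewrite gt_eqF// ltr_pwDl ?exprn_gt0// sqr_ge0. Qed.

(** Adding one to the cosine makes the integrand nonnegative, so that a primitive gives the
    value of the integral before integrability is known. *)
Lemma integral_abel_weight_1cos (x : R) :
  (\int[mu]_xi (abel_weight eps xi * (1 + cos (x * xi)))%:E =
   (2 * (eps^-1 + eps / (eps ^+ 2 + x ^+ 2)))%:E)%E.
Proof.
have en : eps != 0 by rewrite gt_eqF.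
have dn := den x.
pose F (xi : R) : R := expR (- (eps * xi)) *
  ((x * sin (x * xi) - eps * cos (x * xi)) / (eps ^+ 2 + x ^+ 2) - eps^-1).
pose df (xi : R) : R := expR (- (eps * xi)) * (1 + cos (x * xi)).
have dF (xi : R) : is_derive xi (1 : R) F (df xi).
  rewrite /F /df; apply: is_derive_eq.
  rewrite /GRing.scale /=; field.
  by rewrite en dn.
rewrite (ge0_integral_even_primitive (F := F) (df := df) (l := 0)).
- congr EFin; rewrite /F !mulr0 oppr0 expR0 cos0 sin0; field.
  by rewrite en dn.
- move=> xi; rewrite mulr_ge0 ?expR_ge0// -lerBlDl sub0r; exact: cos_geN1.
- move=> xi; apply: continuousM; first exact: continuous_abel_weight.
  apply: continuousD; first exact: cst_continuous.
  apply: (@continuous_comp _ _ _ (fun xi => x * xi) (@cos R)).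
    by apply: continuousM; [exact: cst_continuous|exact: cvg_id].
  exact: continuous_cos.
- by move=> xi; rewrite /abel_weight normrN mulrN cosN.
- by move=> xi xi0; rewrite /df /abel_weight gtr0_norm.
- pose C := (`|x| + eps) / (eps ^+ 2 + x ^+ 2) + eps^-1.
  have e0 : expR (- (eps * xi)) @[xi --> +oo] --> (0 : R).
    apply: (@cvg_comp _ _ _ (fun xi => eps * xi) (fun y => expR (- y)) _ (pinfty_nbhs R)); last exact: cvgr_expR.
    exact: gt0_cvgMry.
  have eC : C * expR (- (eps * xi)) @[xi --> +oo] --> (0 : R).
    by rewrite -[X in _ --> X](mulr0 C); apply: cvgM; [exact: cvg_cst|].
  apply/norm_cvg0P; apply: squeeze_cvgr (cvg_cst _) eC.
  apply: nearW => xi; rewrite normr_ge0 /= /F normrM [X in _ <= X]mulrC.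
  rewrite ger0_norm ?expR_ge0// ler_wpM2l ?expR_ge0//.
  rewrite (le_trans (ler_normB _ _))// /C.
  have ip : 0 < (eps ^+ 2 + x ^+ 2)^-1.
    by rewrite invr_gt0 ltr_pwDl ?exprn_gt0// sqr_ge0.
  rewrite (@gtr0_norm _ eps^-1) ?invr_gt0// lerD2r normrM (gtr0_norm ip).
  rewrite ler_pM2r// (le_trans (ler_normB _ _))// lerD// normrM.
    by rewrite ler_piMr// sin_max.
  by rewrite gtr0_norm//; apply: ler_piMr; [exact: ltW|exact: cos_max].
Qed.

Lemma integral_abel_weight :
  (\int[mu]_xi (abel_weight eps xi)%:E = (2 / eps)%:E)%E.
Proof.
have en : eps != 0 by rewrite gt_eqF.
have := integral_abel_weight_1cos 0.
under eq_integral do rewrite mul0r cos0 mulrDr mulr1 -mulr2n -mulr_natl EFinM.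
rewrite ge0_integralZl//; last 2 first.
- apply/measurable_EFinP; apply: continuous_measurable_fun.
  exact: continuous_abel_weight.
- by move=> xi _; rewrite lee_fin ltW// abel_weight_gt0.
case: (\int[mu]_x _)%E => [r||]; rewrite ?gt0_muley ?gt0_muleNy// -EFinM => -[] h.
congr EFin; apply: (@mulfI _ 2) => //.
by rewrite h; field.
Qed.

Lemma integrable_abel_weight : mu.-integrable [set: R] (EFin \o abel_weight eps).
Proof.
apply/integrableP; split.
  apply/measurable_EFinP; apply: continuous_measurable_fun.
  exact: continuous_abel_weight.
under eq_integral do rewrite /= ger0_norm ?ltW ?abel_weight_gt0//.
by rewrite integral_abel_weight ltry.
Qed.

Lemma Rintegral_abel_weight_cos x :
  Rintegral mu setT (fun xi => abel_weight eps xi * cos (x * xi)) = poisson eps x.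
Proof.
have en : eps != 0 by rewrite gt_eqF.
have ci : mu.-integrable [set: R] (EFin \o (fun xi => abel_weight eps xi * cos (x * xi))).
  apply: le_integrable integrable_abel_weight => //.
    apply/measurable_EFinP; apply: measurable_funM.
      by apply: continuous_measurable_fun; exact: continuous_abel_weight.
    apply: (measurableT_comp (f := @cos R)).
      by apply: continuous_measurable_fun; exact: continuous_cos.
    exact: measurable_funM.
  move=> xi _ /=; rewrite lee_fin normrM ler_piMr// cos_max//.
have := integral_abel_weight_1cos x.
under eq_integral do rewrite mulrDr mulr1 EFinD.
rewrite integralD//; last exact: integrable_abel_weight.
rewrite integral_abel_weight.
have fc : (\int[mu]_xi (abel_weight eps xi * cos (x * xi))%:E)%E \is a fin_num.
  exact: integrable_fin_num ci.
rewrite -(fineK fc) -EFinD => -[] /(canRL (addKr _)).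
rewrite /Rintegral /poisson => ->; field.
by rewrite en den.
Qed.

Lemma poisson_gt0 x : 0 < poisson eps x.
Proof. by rewrite divr_gt0 ?mulr_gt0// ltr_pwDl ?exprn_gt0// sqr_ge0. Qed.

Lemma poissonN x : poisson eps (- x) = poisson eps x.
Proof. by rewrite /poisson sqrrN. Qed.

Lemma continuous_poisson : continuous (poisson eps).
Proof.
move=> x; apply: (@cvgM _ _ _ _ (fun=> 2 * eps) (fun x => (eps ^+ 2 + x ^+ 2)^-1)).
  exact: cvg_cst.
apply: cvgV; first exact: den.
by apply: cvgD; [exact: cvg_cst|exact: exprn_continuous].
Qed.

Lemma is_derive_poisson (x : R) :
  is_derive x (1 : R) (fun x => 2 * atan (x / eps)) (poisson eps x).
Proof.
have en : eps != 0 by rewrite gt_eqF.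
apply: is_derive_eq; rewrite /GRing.scale /= /poisson.
have d1 : 1 + (x / eps) ^+ 2 != 0 by rewrite gt_eqF// ltr_pwDl// sqr_ge0.
have dn := den x.
by field; rewrite dn en.
Qed.

Lemma integral_poisson : (\int[mu]_x (poisson eps x)%:E = (2 * pi)%:E)%E.
Proof.
have dF := is_derive_poisson.
rewrite (ge0_integral_even_primitive (F := fun x => 2 * atan (x / eps)) (df := poisson eps) (l := pi)).
- by rewrite mul0r atan0 mulr0 subr0.
- by move=> x; rewrite ltW// poisson_gt0.
- exact: continuous_poisson.
- exact: poissonN.
- by [].
- rewrite [X in _ --> X](_ : _ = 2 * (pi / 2)); last by field.
  apply: cvgM; first exact: cvg_cst.
  apply: (@cvg_comp _ _ _ (fun x => x / eps) (@atan R) _ (pinfty_nbhs R)); last exact: cvgy_atan.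
  by apply: gt0_cvgMly => //; rewrite invr_gt0.
Qed.

Lemma integral_poisson_shift (y : R) :
  (\int[mu]_x (poisson eps (x - y))%:E = (2 * pi)%:E)%E.
Proof.
rewrite -integral_poisson (integral_shift (- y) (f := EFin \o poisson eps))//.
apply/measurable_EFinP; apply: continuous_measurable_fun; exact: continuous_poisson.
Qed.

End PoissonKernel.

(** * The Fourier transform of integrable functions *)

Section FourierL1.
Variable R : realType.
Local Notation mu := (@lebesgue_measure R).
Implicit Types (f g : R -> R[i]).

Definition FT f (xi : R) : R[i] := Cint (fun x => f x * expi (- (x * xi))).

Definition L1norm f : R := fine (\int[mu]_x (cmodulus (f x))%:E)%E.

Lemma cmeasurable_expi (phi : R -> R) : measurable_fun [set: R] phi ->
  cmeasurable (fun x => expi (phi x)).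
Proof. exact: cmeas_expi. Qed.

Lemma cL1_expi f (phi : R -> R) : cL1 f -> measurable_fun [set: R] phi ->
  cL1 (fun x => f x * expi (phi x)).
Proof.
move=> fi mphi; under eq_fun do rewrite mulrC.
apply: (@cL1M_bounded _ _ _ 1) => //; first exact: cmeasurable_expi.
by move=> x; rewrite cmodulus_expi.
Qed.

Lemma cL1_FT f xi : cL1 f -> cL1 (fun x => f x * expi (- (x * xi))).
Proof.
move=> fi; apply: cL1_expi => //; apply: measurableT_comp => //.
exact: measurable_funM.
Qed.

Lemma L1norm_fin f : cL1 f -> (\int[mu]_x (cmodulus (f x))%:E)%E = (L1norm f)%:E.
Proof. by move=> [mf fi]; rewrite fineK//; exact: integrable_fin_num. Qed.

Lemma cmodulus_FT f xi : cL1 f -> cmodulus (FT f xi) <= L1norm f.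
Proof.
move=> fi; rewrite -lee_fin -L1norm_fin//.
apply: (le_trans (le_cmodulus_Cint (cL1_FT xi fi))); apply: ge0_le_integral => //.
- by move=> x _; rewrite lee_fin cmodulus_ge0.
- by apply/measurable_EFinP; apply: measurable_cmodulus; case: (cL1_FT xi fi).
- by apply/measurable_EFinP; apply: measurable_cmodulus; case: fi.
- by move=> x _; rewrite cmodulusM cmodulus_expi mulr1.
Qed.

Section Multiplication.
Variables (f g : R -> R[i]).
Hypotheses (fi : cL1 f) (gi : cL1 g).

Let H (z : R * R) : R[i] := g z.1 * (f z.2 * expi (- (z.2 * z.1))).

Let mH : cmeas H.
Proof.
apply: cmeasM; first by apply: (cmeas_comp (h := fst)) => //; case: gi.
apply: cmeasM; first by apply: (cmeas_comp (h := snd)) => //; case: fi.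
apply: cmeas_expi; apply: measurableT_comp => //.
by apply: measurable_funM; [exact: measurable_snd|exact: measurable_fst].
Qed.

Let HAB x y : cmodulus (H (x, y)) <= cmodulus (g x) * cmodulus (f y).
Proof. by rewrite /H !cmodulusM cmodulus_expi mulr1. Qed.

Let Hfub := Cfubini mH (fun x => cmodulus_ge0 (g x)) (fun x => cmodulus_ge0 (f x))
  gi.2 fi.2 HAB.

(** Fubini's theorem: the Fourier kernel is symmetric. *)
Lemma multiplication_formula :
  Cint (fun xi => FT f xi * g xi) = Cint (fun x => f x * FT g x).
Proof.
transitivity (Cint (fun xi => Cint (fun x => H (xi, x)))).
  congr Cint; apply/funext => xi; rewrite mulrC /FT -CintZ; first by [].
  exact: cL1_FT.
rewrite Hfub; congr Cint; apply/funext => x.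
rewrite -CintZ; last exact: cL1_FT.
by congr Cint; apply/funext => xi; rewrite /H /=; rewrite [x * xi]mulrC; ring.
Qed.

Lemma cL1_FT_mul : cL1 (fun xi => FT f xi * g xi).
Proof.
have := cL1_Cint_section mH (fun x => cmodulus_ge0 (g x)) (fun x => cmodulus_ge0 (f x))
  gi.2 fi.2 HAB.
congr (cL1 _); apply/funext => xi; rewrite mulrC /FT -CintZ; first by [].
exact: cL1_FT.
Qed.

End Multiplication.

Definition cweight (eps xi : R) : R[i] := (abel_weight eps xi)%:C.

Lemma cL1_cweight eps : 0 < eps -> cL1 (cweight eps).
Proof.
move=> e0; apply: (cL1_le _ (integrable_abel_weight e0)).
  by apply: cmeasR; apply: continuous_measurable_fun; exact: continuous_abel_weight.
by move=> xi; rewrite cmodulusR gtr0_norm// abel_weight_gt0.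
Qed.

(** Fubini's theorem provides measurability once a weight makes the transform integrable;
    the weight is then divided out. *)
Lemma cmeasurable_FT f : cL1 f -> cmeasurable (FT f).
Proof.
move=> fi; have [mw _] := cL1_FT_mul fi (cL1_cweight (@ltr01 R)).
have : cmeasurable (fun xi => (expR (1 * `|xi|))%:C * (FT f xi * cweight 1 xi)).
  apply: cmeasM => //; apply: cmeasR; apply: measurableT_comp => //.
  by apply: measurable_funM => //; exact: measurableT_comp.
congr (cmeasurable _); apply/funext => xi.
rewrite /cweight /abel_weight mulrC -mulrA -rmorphM /= -expRD.
by rewrite addrC addrN expR0 mulr1.
Qed.

Lemma FTD f g xi : cL1 f -> cL1 g -> FT (fun x => f x + g x) xi = FT f xi + FT g xi.
Proof.
move=> fi gi; rewrite /FT -CintD; [|exact: cL1_FT|exact: cL1_FT].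
by congr Cint; apply/funext => x; rewrite mulrDl.
Qed.

Lemma FTN f xi : cL1 f -> FT (fun x => - f x) xi = - FT f xi.
Proof.
move=> fi; rewrite /FT -CintN; last exact: cL1_FT.
by congr Cint; apply/funext => x; rewrite mulNr.
Qed.

Lemma FTB f g xi : cL1 f -> cL1 g -> FT (fun x => f x - g x) xi = FT f xi - FT g xi.
Proof. by move=> fi gi; rewrite FTD ?FTN//; exact: cL1N. Qed.

Lemma FT_shift f h xi : cL1 f ->
  FT (fun x => f (x + h)) xi = expi (h * xi) * FT f xi.
Proof.
move=> fi; rewrite /FT -CintZ; last exact: cL1_FT.
rewrite -(@Cint_shift _ h (fun x => _ * (f x * _))); last first.
  by have [] := cL1Z (expi (h * xi)) (cL1_FT xi fi).
congr Cint; apply/funext => x; rewrite mulrCA -expiD; congr (_ * expi _); ring.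
Qed.

Lemma FT_opp f xi : cL1 f -> FT (fun x => f (- x)) xi = FT f (- xi).
Proof.
move=> fi; rewrite /FT -[RHS]Cint_opp; last by case: (cL1_FT (- xi) fi).
by congr Cint; apply/funext => x; rewrite mulrNN.
Qed.

Lemma FT_conj f xi : cL1 f -> FT (fun x => (conjc (f x))) xi = (conjc (FT f (- xi))).
Proof.
move=> fi; rewrite /FT -CintJ; last exact: cL1_FT.
by congr Cint; apply/funext => x; rewrite conjM -expiN mulrN opprK.
Qed.

Section Abel.
Variables (eps : R).
Hypothesis eps0 : 0 < eps.

Lemma FT_cweight x : FT (cweight eps) x = (poisson eps x)%:C.
Proof.
apply: complexP.
  rewrite /= -Rintegral_abel_weight_cos//; apply: eq_Rintegral => xi _ /=.
  by rewrite cosN mul0r subr0 mulrC [xi * x]mulrC mulrC.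
have wi := cL1_FT x (cL1_cweight eps0).
have : FT (cweight eps) x = conjc (FT (cweight eps) x).
  rewrite {1}/FT -(Cint_opp wi.1) -CintJ//; congr Cint; apply/funext => xi.
  rewrite conjM /cweight conjc_real /abel_weight normrN -expiN.
  by congr (_ * expi _); ring.
by case: (FT _ _) => a b /= [] bb; lra.
Qed.

Lemma FT_cweight_mod x y :
  FT (fun xi => cweight eps xi * expi (xi * x)) y = (poisson eps (x - y))%:C.
Proof.
rewrite -poissonN opprB -FT_cweight /FT; congr Cint; apply/funext => xi.
by rewrite -mulrA -expiD; congr (_ * expi _); ring.
Qed.

Lemma cL1_cweight_mod x : cL1 (fun xi => cweight eps xi * expi (xi * x)).
Proof. by apply: cL1_expi; [exact: cL1_cweight|exact: measurable_funM]. Qed.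

Lemma cL1_conj_FT_cweight g : cL1 g ->
  cL1 (fun xi => conjc (FT g xi) * cweight eps xi).
Proof.
move=> gi; have wi := cL1_cweight eps0.
have := cL1J (cL1_FT_mul gi wi); congr (cL1 _); apply/funext => xi.
by rewrite conjM /cweight conjc_real.
Qed.

Lemma FT_conj_FT_cweight g x : cL1 g ->
  FT (fun xi => conjc (FT g xi) * cweight eps xi) x =
  conjc (Cint (fun y => g y * (poisson eps (x - y))%:C)).
Proof.
move=> gi; have wi := cL1_cweight eps0.
transitivity (conjc (Cint (fun xi => FT g xi * (cweight eps xi * expi (xi * x))))).
  rewrite /FT -CintJ.
    congr Cint; apply/funext => xi; rewrite !conjM /cweight conjc_real -expiN.
    by rewrite -mulrA; congr (_ * (_ * expi _)); ring.
  by have := cL1_FT_mul gi (cL1_cweight_mod x).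
congr conjc; rewrite multiplication_formula//; last exact: cL1_cweight_mod.
by congr Cint; apply/funext => y; rewrite FT_cweight_mod.
Qed.

(** Parseval's identity with Abel summation: the multiplication formula, applied to the
    weighted conjugate transform of [g], whose transform is a Poisson integral. *)
Lemma abel_parseval f g : cL1 f -> cL1 g ->
  Cint (fun xi => FT f xi * (conjc (FT g xi) * cweight eps xi)) =
  Cint (fun x => f x * conjc (Cint (fun y => g y * (poisson eps (x - y))%:C))).
Proof.
move=> fi gi; rewrite multiplication_formula//; last exact: cL1_conj_FT_cweight.
by congr Cint; apply/funext => x; rewrite FT_conj_FT_cweight.
Qed.

(** Schur's test: |f(x) f(y)| is at most (|f(x)|^2 + |f(y)|^2) / 2, and the Poisson kernel
    has mass 2 pi in each variable. *)
Lemma poisson_schur f : cmeasurable f ->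
  (\int[mu]_x \int[mu]_y (cmodulus (f x) * cmodulus (f y) * poisson eps (x - y))%:E <=
   (2 * pi)%:E * sqint f)%E.
Proof.
move=> mf.
have mm := measurable_cmodulus mf.
have mP : measurable_fun [set: R * R] (fun z => poisson eps (z.1 - z.2)).
  apply: (measurableT_comp (f := poisson eps)).
    by apply: continuous_measurable_fun; exact: continuous_poisson.
  by apply: measurable_funB; [exact: measurable_fst|exact: measurable_snd].
have m1 : measurable_fun [set: R * R] (fun z => cmodulus (f z.1)).
  exact: (measurableT_comp mm (@measurable_fst _ _ _ _)).
have m2 : measurable_fun [set: R * R] (fun z => cmodulus (f z.2)).
  exact: (measurableT_comp mm (@measurable_snd _ _ _ _)).
pose G (z : R * R) := 2^-1 * (cmodulus (f z.1) ^+ 2 * poisson eps (z.1 - z.2)).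
pose G' (z : R * R) := 2^-1 * (cmodulus (f z.2) ^+ 2 * poisson eps (z.1 - z.2)).
have P0 x : 0 <= poisson eps x by rewrite ltW// poisson_gt0.
have G0 z : 0 <= G z by apply: mulr_ge0 => //; apply: mulr_ge0 => //; exact: sqr_ge0.
have G'0 z : 0 <= G' z by apply: mulr_ge0 => //; apply: mulr_ge0 => //; exact: sqr_ge0.
have mG : measurable_fun [set: R * R] G.
  by apply: measurable_funM => //; apply: measurable_funM => //; exact: measurable_funX.
have mG' : measurable_fun [set: R * R] G'.
  by apply: measurable_funM => //; apply: measurable_funM => //; exact: measurable_funX.
have pi20 : 0 <= 2 * pi :> R by rewrite mulr_ge0// pi_ge0.
have half : (\int[mu]_x \int[mu]_y (G (x, y))%:E = pi%:E * sqint f)%E.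
  rewrite /sqint -ge0_integralZl//; last 3 first.
  - exact: measurable_sqmod.
  - by move=> x _; rewrite lee_fin sqr_ge0.
  - by rewrite lee_fin pi_ge0.
  apply: eq_integral => x _.
  under eq_integral do rewrite /G /= mulrA EFinM -opprB poissonN.
  rewrite ge0_integralZl//; last 3 first.
  - apply/measurable_EFinP; apply: (measurableT_comp (f := poisson eps)).
      by apply: continuous_measurable_fun; exact: continuous_poisson.
    exact: measurable_funB.
  - by move=> y _; rewrite lee_fin.
  - by rewrite lee_fin mulr_ge0// sqr_ge0.
  by rewrite integral_poisson_shift// -!EFinM; congr EFin; field.
have half' : (\int[mu]_x \int[mu]_y (G' (x, y))%:E = pi%:E * sqint f)%E.
  transitivity (\int[mu]_y \int[mu]_x (G' (x, y))%:E)%E.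
    have mG'E : measurable_fun [set: R * R] (EFin \o G') by exact/measurable_EFinP.
    have G'E0 z : (0 <= (EFin \o G') z)%E by rewrite lee_fin.
    exact: (@fubini_tonelli _ _ _ _ R mu mu (EFin \o G') mG'E G'E0).
  rewrite -half; apply: eq_integral => x _; apply: eq_integral => y _.
  by rewrite /G /G' /= -opprB poissonN.
apply: (@le_trans _ _ (\int[mu]_x \int[mu]_y ((G (x, y))%:E + (G' (x, y))%:E))%E).
  have mK : measurable_fun [set: R * R] (fun z : R * R =>
      cmodulus (f z.1) * cmodulus (f z.2) * poisson eps (z.1 - z.2)).
    by apply: measurable_funM => //; exact: measurable_funM.
  have K0 z : 0 <= cmodulus (f z.1) * cmodulus (f z.2) * poisson eps (z.1 - z.2).
    by apply: mulr_ge0 => //; apply: mulr_ge0; exact: cmodulus_ge0.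
  apply: ge0_le_integral => //.
  - by move=> x _; apply: integral_ge0 => y _; rewrite lee_fin; exact: (K0 (x, y)).
  - have := @measurable_fun_fubini_tonelli_F _ _ _ _ _ mu (fun z : R * R =>
      (cmodulus (f z.1) * cmodulus (f z.2) * poisson eps (z.1 - z.2))%:E).
    by apply; [exact/measurable_EFinP|move=> z; rewrite lee_fin].
  - have := @measurable_fun_fubini_tonelli_F _ _ _ _ _ mu (fun z : R * R =>
      ((G z)%:E + (G' z)%:E)%E).
    apply; last by move=> z; rewrite adde_ge0// lee_fin.
    by apply: emeasurable_funD; exact/measurable_EFinP.
  - move=> x _; apply: ge0_le_integral => //.
    + by move=> y _; rewrite lee_fin; exact: (K0 (x, y)).
    + apply/measurable_EFinP.
      exact: (measurableT_comp mK (pair1_measurable x)).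
    + apply: emeasurable_funD; apply/measurable_EFinP.
        exact: (measurableT_comp mG (pair1_measurable x)).
      exact: (measurableT_comp mG' (pair1_measurable x)).
    + move=> y _; rewrite -EFinD lee_fin /G /G' /=.
      have := mulr_ge0 (P0 (x - y)) (sqr_ge0 (cmodulus (f x) - cmodulus (f y))).
      by rewrite sqrrB; lra.
have -> : ((2 * pi)%:E * sqint f = pi%:E * sqint f + pi%:E * sqint f)%E.
  rewrite -ge0_muleDl ?lee_fin ?pi_ge0//.
  by rewrite -EFinD; congr (_%:E * _)%E; ring.
have mFt (K : R * R -> R) : measurable_fun [set: R * R] K -> (forall z, 0 <= K z) ->
    measurable_fun [set: R] (fun x => \int[mu]_y (K (x, y))%:E)%E.
  move=> mK K0; have := @measurable_fun_fubini_tonelli_F _ _ _ _ _ mu (EFin \o K).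
  by apply; [exact/measurable_EFinP|move=> z; rewrite lee_fin].
rewrite -{1}half -half' -ge0_integralD//.
- rewrite le_eqVlt; apply/orP; left; apply/eqP; apply: eq_integral => x _.
  rewrite ge0_integralD//.
  + by move=> y _; rewrite lee_fin.
  + apply/measurable_EFinP; exact: (measurableT_comp mG (pair1_measurable x)).
  + by move=> y _; rewrite lee_fin.
  + apply/measurable_EFinP; exact: (measurableT_comp mG' (pair1_measurable x)).
- by move=> x _; apply: integral_ge0 => y _; rewrite lee_fin.
- exact: mFt.
- by move=> x _; apply: integral_ge0 => y _; rewrite lee_fin.
- exact: mFt.
Qed.

Lemma poisson_le x : poisson eps x <= 2 / eps.
Proof.
have en : eps != 0 by rewrite gt_eqF.
have d : 0 < eps ^+ 2 + x ^+ 2 by rewrite ltr_pwDl ?exprn_gt0// sqr_ge0.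
rewrite /poisson ler_pdivrMr// mulrDr.
have -> : 2 / eps * eps ^+ 2 = 2 * eps by field.
by rewrite lerDl mulr_ge0 ?sqr_ge0// divr_ge0// ltW.
Qed.

Lemma cL1_poisson f x : cL1 f -> cL1 (fun y => f y * (poisson eps (x - y))%:C).
Proof.
move=> fi; under eq_fun do rewrite mulrC.
apply: (@cL1M_bounded _ _ _ (2 / eps)) => //.
  apply: cmeasR; apply: (measurableT_comp (f := poisson eps)).
    by apply: continuous_measurable_fun; exact: continuous_poisson.
  exact: measurable_funB.
by move=> y; rewrite cmodulusR gtr0_norm ?poisson_gt0// poisson_le.
Qed.

End Abel.
End FourierL1.

(** * Bessel's inequality *)

Section Bessel.
Variable R : realType.
Local Notation mu := (@lebesgue_measure R).
Local Notation nrm f := (cLnorm 2%:E f).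
Implicit Types (f g : R -> R[i]).

Lemma cmodulus_cweight (eps xi : R) : cmodulus (cweight eps xi) = abel_weight eps xi.
Proof. by rewrite cmodulusR gtr0_norm// abel_weight_gt0. Qed.

(** Abel's form of Parseval's identity with g = f; the weight with parameter 2 eps is the
    square of the weight with parameter eps. *)
Lemma sqint_FT_cweight (eps : R) f : 0 < eps -> cL1 f ->
  (sqint (fun xi => FT f xi * cweight eps xi)%R <= (2 * pi)%:E * sqint f)%E.
Proof.
move=> e0 fi.
have e20 : 0 < 2 * eps by rewrite mulr_gt0.
have mf := cL1_meas fi.
set G := fun xi => FT f xi * (conjc (FT f xi) * cweight (2 * eps) xi).
have Gi := cL1_conj_FT_cweight e20 fi.
have Gi' : cL1 G by exact: cL1_FT_mul.
have GE xi : G xi = (cmodulus (FT f xi * cweight eps xi) ^+ 2)%:C.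
  rewrite /G mulrA cmodulusM cmodulus_cweight exprMn mul_conjc.
  have -> : abel_weight eps xi ^+ 2 = abel_weight (2 * eps) xi.
    by rewrite expr2 /abel_weight -expRD; congr expR; ring.
  by rewrite /cweight; exact/esym/(rmorphM (real_complex R)).
have -> : sqint (fun xi => FT f xi * cweight eps xi) =
    (complex.Re (Cint G))%:E.
  rewrite /= /Rintegral fineK.
    by apply: eq_integral => xi _; rewrite /comp GE.
  by apply: integrable_fin_num => //; exact: (cL1_Re Gi').
set H := fun x => f x * conjc (Cint (fun y => f y * (poisson (2 * eps) (x - y))%:C)).
have HE : H = (fun x => FT (fun xi => conjc (FT f xi) * cweight (2 * eps) xi) x * f x).
  by apply/funext => x; rewrite FT_conj_FT_cweight// mulrC.
have Hi : cL1 H by rewrite HE; exact: cL1_FT_mul.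
apply: (@le_trans _ _ (cmodulus (Cint H))%:E).
  rewrite lee_fin /H -abel_parseval//.
  exact: (le_trans (ler_norm _) (Re_le_cmodulus _)).
apply: (le_trans (le_cmodulus_Cint Hi)).
apply: (le_trans _ (poisson_schur e20 mf)).
have P0 x : 0 <= poisson (2 * eps) x by rewrite ltW// poisson_gt0.
have mP : measurable_fun [set: R * R] (fun z : R * R => poisson (2 * eps) (z.1 - z.2)).
  apply: (measurableT_comp (f := poisson (2 * eps))).
    by apply: continuous_measurable_fun; exact: continuous_poisson.
  by apply: measurable_funB; [exact: measurable_fst|exact: measurable_snd].
have mm := measurable_cmodulus mf.
apply: ge0_le_integral => //.
- by move=> x _; rewrite lee_fin cmodulus_ge0.
- by apply/measurable_EFinP; apply: measurable_cmodulus; case: Hi.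
- have := @measurable_fun_fubini_tonelli_F _ _ _ _ _ mu (fun z : R * R =>
      (cmodulus (f z.1) * cmodulus (f z.2) * poisson (2 * eps) (z.1 - z.2))%:E).
  apply.
    apply/measurable_EFinP; apply: measurable_funM => //; apply: measurable_funM.
      exact: (measurableT_comp mm (@measurable_fst _ _ _ _)).
    exact: (measurableT_comp mm (@measurable_snd _ _ _ _)).
  by move=> z; rewrite lee_fin; apply: mulr_ge0 => //; apply: mulr_ge0; exact: cmodulus_ge0.
- move=> x _; rewrite /H cmodulusM cmodulusJ EFinM.
  have pi' := cL1_poisson e20 x fi.
  apply: (@le_trans _ _ ((cmodulus (f x))%:E *
      \int[mu]_y (cmodulus (f y * (poisson (2 * eps) (x - y))%:C))%:E)%E).
    by apply: lee_wpmul2l; [rewrite lee_fin cmodulus_ge0|exact: le_cmodulus_Cint].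
  rewrite -ge0_integralZl//; last 3 first.
  + by apply/measurable_EFinP; apply: measurable_cmodulus; case: pi'.
  + by move=> y _; rewrite lee_fin cmodulus_ge0.
  + by rewrite lee_fin cmodulus_ge0.
  rewrite le_eqVlt; apply/orP; left; apply/eqP; apply: eq_integral => y _.
  by rewrite -EFinM cmodulusM cmodulusR ger0_norm// mulrA.
Qed.

Lemma cvg_abel_weight (xi : R) : abel_weight n.+1%:R^-1 xi @[n --> \oo] --> (1 : R).
Proof.
rewrite -[X in _ --> X]expR0.
have h : - (n.+1%:R^-1 * `|xi|) @[n --> \oo] --> (0 : R).
  rewrite -[X in _ --> X]oppr0; apply: cvgN; rewrite -[X in _ --> X](mul0r `|xi|).
  by apply: cvgM; [exact: cvg_harmonic|exact: cvg_cst].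
exact: (continuous_cvg _ (@continuous_expR R 0) h).
Qed.

(** The weight is removed by Fatou's lemma. *)
Lemma sqint_FT f : cL1 f -> (sqint (FT f) <= (2 * pi)%:E * sqint f)%E.
Proof.
move=> fi.
apply: (@sqint_fatou _ (fun n xi => FT f xi * cweight n.+1%:R^-1 xi)).
- move=> n; apply: cmeasM; first exact: cmeasurable_FT.
  by have [] := @cL1_cweight R n.+1%:R^-1 (@harmonic_gt0 _ n).
- move=> xi; rewrite (_ : (fun n => _) =
      (fun n => cmodulus (FT f xi) * abel_weight n.+1%:R^-1 xi)); last first.
    by apply/funext => n; rewrite cmodulusM cmodulus_cweight.
  rewrite -[X in _ --> X]mulr1; apply: cvgM; first exact: cvg_cst.
  exact: cvg_abel_weight.
- by move=> n; apply: sqint_FT_cweight => //; exact: harmonic_gt0.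
Qed.

Definition sqrt2pi : R := Num.sqrt (2 * pi).

Lemma sqrt2pi_gt0 : 0 < sqrt2pi.
Proof. by rewrite sqrtr_gt0 mulr_gt0// pi_gt0. Qed.

Lemma sqr_sqrt2pi : sqrt2pi ^+ 2 = 2 * pi.
Proof. by rewrite sqr_sqrtr// mulr_ge0// pi_ge0. Qed.

(** Bessel's inequality. Applied to a function and to its transform, it serves as both
    halves of Plancherel's theorem. *)
Lemma bessel f : cL1 f -> (nrm (FT f) <= sqrt2pi%:E * nrm f)%E.
Proof.
move=> fi; have := nrm_ge0 f; case E : (nrm f) => [r||]// => [|_]; last first.
  by rewrite gt0_muley ?leey// lte_fin sqrt2pi_gt0.
rewrite lee_fin => r0; rewrite -EFinM; apply/nrm_leP.
  by rewrite mulr_ge0// ltW// sqrt2pi_gt0.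
apply: (le_trans (sqint_FT fi)).
by rewrite sqintE E -!EFinM exprMn sqr_sqrt2pi expr2.
Qed.

Lemma square_integrable_FT f : cL1 f -> square_integrable f -> square_integrable (FT f).
Proof.
move=> fi [mf f2]; split; first exact: cmeasurable_FT.
apply: (le_lt_trans (bessel fi)).
by move: f2 (nrm_ge0 f); case: (nrm f) => [r||]// _ _; rewrite -EFinM ltry.
Qed.

End Bessel.

(** * Parseval's identity against an interval *)

Section IntervalParseval.
Variable R : realType.
Local Notation mu := (@lebesgue_measure R).
Local Notation nrm f := (cLnorm 2%:E f).
Implicit Types (f g : R -> R[i]).

Definition cindic (A : set R) (x : R) : R[i] := (\1_A x)%:C.

Lemma cmodulus_cindic A x : cmodulus (cindic A x) = \1_A x.
Proof. by rewrite cmodulusR ger0_norm. Qed.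

Section Interval.
Variables (a b : R).
Hypothesis ab : a <= b.

Local Notation ind := (cindic `[a, b]).

Lemma cmeasurable_ind : cmeasurable ind.
Proof. by apply: cmeasR; exact: measurable_indic. Qed.

Lemma cL1_ind : cL1 ind.
Proof.
apply: (cL1_le cmeasurable_ind (@integrable_indic_itv R a b true false)) => x.
by rewrite cmodulus_cindic.
Qed.

Lemma square_integrable_ind : square_integrable ind.
Proof.
split; first exact: cmeasurable_ind.
apply/(square_integrableP cmeasurable_ind); rewrite /sqint.
have -> : (\int[mu]_x (cmodulus (ind x) ^+ 2)%:E = \int[mu]_x (\1_`[a, b] x)%:E)%E.
  apply: eq_integral => x _; rewrite cmodulus_cindic indicE.
  by case: (_ \in _); rewrite ?expr1n ?expr0n.
rewrite integral_indic// setIT [X in (X < _)%E](lebesgue_measure_itv `[a, b]) /=.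
by case: ifP => _; rewrite -?EFinD ltry.
Qed.

Lemma Rintegral_cindic (h : R -> R) :
  Rintegral mu `[a, b] h = Rintegral mu setT (fun x => h x * \1_`[a, b] x).
Proof.
rewrite Rintegral_mkcond; apply: eq_Rintegral => x _; rewrite patchE indicE.
by case: (_ \in _); rewrite ?mulr1 ?mulr0.
Qed.

Lemma cintegral_cindic f : cintegral `[a, b] f = Cint (fun x => f x * ind x).
Proof.
apply: complexP; rewrite /= Rintegral_cindic; apply: eq_Rintegral => x _ /=.
- by rewrite cReM /= mulr0 subr0.
- by rewrite cImM /= mulr0 add0r.
Qed.

(** The Poisson integral of the indicator of an interval. *)
Definition poisson_ind (eps x : R) : R :=
  2 * atan ((b - x) / eps) - 2 * atan ((a - x) / eps).

Lemma Cint_ind_poisson eps x : 0 < eps ->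
  Cint (fun y => ind y * (poisson eps (x - y))%:C) = (poisson_ind eps x)%:C.
Proof.
move=> e0; under eq_fun do rewrite mulrC.
rewrite -cintegral_cindic; apply: complexP; rewrite /= /comp /=; last first.
  by rewrite /Rintegral integral0_eq.
move: ab; rewrite le_eqVlt => /predU1P[eqab|altb].
  by rewrite /poisson_ind -eqab set_itv1 Rintegral_set1 subrr.
pose F y : R := 2 * atan ((y - x) / eps).
have dF (y : R) : is_derive y (1 : R) F (poisson eps (x - y)).
  have dn : eps ^+ 2 + (x - y) ^+ 2 != 0.
    by rewrite gt_eqF// ltr_pwDl ?exprn_gt0// sqr_ge0.
  have en : eps != 0 by rewrite gt_eqF.
  have dn' : 1 + ((y - x) / eps) ^+ 2 != 0 by rewrite gt_eqF// ltr_pwDl// sqr_ge0.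
  have dn2 : eps ^+ 2 + (y - x) ^+ 2 != 0.
    by rewrite gt_eqF// ltr_pwDl ?exprn_gt0// sqr_ge0.
  rewrite -poissonN opprB.
  apply: is_derive_eq; rewrite /GRing.scale /= /poisson; field.
  by rewrite dn2 en.
have cF : continuous F.
  by move=> y; apply: differentiable_continuous; apply/derivable1_diffP; apply: ex_derive.
rewrite /Rintegral (continuous_FTC2 (F := F))//.
- apply: continuous_subspaceT => y.
  apply: (@continuous_comp _ _ _ (fun y => x - y) (poisson eps)).
    by apply: cvgB; [exact: cvg_cst|exact: cvg_id].
  exact: continuous_poisson.
- split.
  + by move=> y _; apply: ex_derive.
  + by apply: cvg_at_right_filter; exact: cF.
  + by apply: cvg_at_left_filter; exact: cF.
- by move=> y _; rewrite derive1E derive_val.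
Qed.

Lemma poisson_ind_bound eps x : `|poisson_ind eps x| <= 2 * pi.
Proof.
have h1 := atan_gtNpi2 ((b - x) / eps); have h2 := atan_ltpi2 ((b - x) / eps).
have h3 := atan_gtNpi2 ((a - x) / eps); have h4 := atan_ltpi2 ((a - x) / eps).
by rewrite /poisson_ind ler_norml; apply/andP; split; lra.
Qed.

Lemma cvg_atan_pos (c : R) : 0 < c -> atan (c / n.+1%:R^-1) @[n --> \oo] --> pi / 2.
Proof.
move=> c0; rewrite (_ : (fun n => _) = (fun n => atan (c * n.+1%:R))); last first.
  by apply/funext => n; rewrite invrK.
have hn : (n.+1%:R : R) @[n --> \oo] --> +oo%R.
  by have h := @cvgr_idn R; rewrite -(cvg_shiftS (fun n => n%:R : R)) in h.
apply: (@cvg_comp _ _ _ (fun n => n.+1%:R) (fun r : R => atan (c * r)) _ (pinfty_nbhs R)) => //.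
apply: (@cvg_comp _ _ _ (fun r : R => c * r) (@atan R) _ (pinfty_nbhs R));
  last exact: cvgy_atan.
exact: gt0_cvgMry.
Qed.

Lemma cvg_atan_neg (c : R) : c < 0 -> atan (c / n.+1%:R^-1) @[n --> \oo] --> - (pi / 2).
Proof.
move=> c0; rewrite (_ : (fun n => _) = (fun n => - atan ((- c) / n.+1%:R^-1))).
  by apply: cvgN; apply: cvg_atan_pos; rewrite oppr_gt0.
by apply/funext => n; rewrite -atanN mulNr opprK.
Qed.

Lemma cvg_poisson_ind x : x != a -> x != b ->
  poisson_ind n.+1%:R^-1 x @[n --> \oo] --> 2 * pi * \1_`[a, b] x.
Proof.
move=> xa xb; rewrite /poisson_ind indicE.
have [ltxa|ltax|] := ltgtP x a; last by move/eqP; rewrite (negPf xa).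
- have lxb := lt_le_trans ltxa ab.
  rewrite memNset; last by rewrite /= in_itv/= leNgt ltxa.
  have -> : 2 * pi * (false%:R : R) = 2 * (pi / 2) - 2 * (pi / 2) by rewrite /=; ring.
  by apply: cvgB; apply: cvgM; try exact: cvg_cst; apply: cvg_atan_pos; rewrite subr_gt0.
- have [ltxb|ltbx|] := ltgtP x b; last by move/eqP; rewrite (negPf xb).
  + rewrite mem_set; last by rewrite /= in_itv/= !ltW.
    have -> : 2 * pi * (true%:R : R) = 2 * (pi / 2) - 2 * (- (pi / 2)) by rewrite /=; field.
    apply: cvgB; (apply: cvgM; first exact: cvg_cst).
      by apply: cvg_atan_pos; rewrite subr_gt0.
    by apply: cvg_atan_neg; rewrite subr_lt0.
  + rewrite memNset; last by rewrite /= in_itv/= (leNgt x b) ltbx andbF.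
    have -> : 2 * pi * (false%:R : R) = 2 * (- (pi / 2)) - 2 * (- (pi / 2)) by rewrite /=; ring.
    by apply: cvgB; apply: cvgM; try exact: cvg_cst; apply: cvg_atan_neg; rewrite subr_lt0.
Qed.

(** Parseval's identity against an indicator: let the Abel parameter tend to 0. *)
Lemma parseval_ind f : cL1 f -> square_integrable f ->
  Cint (fun xi => FT f xi * conjc (FT ind xi)) =
  (2 * pi)%:C * Cint (fun x => f x * ind x).
Proof.
move=> fi f2; have ii := cL1_ind; have i2 := square_integrable_ind.
have F2 := square_integrable_FT fi f2; have I2 := square_integrable_FT ii i2.
have I2' : square_integrable (fun xi => conjc (FT ind xi)).
  split; first by apply: cmeasJ; case: I2.
  by rewrite (@eq_nrm _ _ (FT ind)); [case: I2|move=> x; rewrite cmodulusJ].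
have Gi := cL1M F2 I2'.
pose e_ n : R := n.+1%:R^-1.
have e0 n : 0 < e_ n by exact: harmonic_gt0.
have wE n xi : cmodulus (FT f xi * (conjc (FT ind xi) * cweight (e_ n) xi) -
      FT f xi * conjc (FT ind xi)) =
    cmodulus (FT f xi * conjc (FT ind xi)) * `|abel_weight (e_ n) xi - 1|.
  have -> : FT f xi * (conjc (FT ind xi) * cweight (e_ n) xi) - FT f xi * conjc (FT ind xi) =
      FT f xi * conjc (FT ind xi) * (cweight (e_ n) xi - 1) by ring.
  rewrite cmodulusM -cmodulusR; congr (_ * cmodulus _).
  exact/esym/(rmorphB (real_complex R)).
apply: (@ccvg_unique _ (fun n => Cint (fun xi =>
    FT f xi * (conjc (FT ind xi) * cweight (e_ n) xi)))).
  apply: (@ccvg_dominated _ _ _ (fun xi => cmodulus (FT f xi * conjc (FT ind xi)))).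
  - move=> n; apply: cL1_FT_mul => //; exact: cL1_conj_FT_cweight.
  - exact: Gi.
  - by case: Gi.
  - move=> n xi; rewrite wE; apply: ler_piMr; first exact: cmodulus_ge0.
    rewrite ler_norml.
    have := abel_weight_gt0 (e_ n) xi; have := abel_weight_le1 xi (ltW (e0 n)).
    by move=> h1 h2; apply/andP; split; lra.
  - apply: aeT => xi; rewrite /ccvg.
    rewrite (_ : (fun n => _) = (fun n => cmodulus (FT f xi * conjc (FT ind xi)) *
        `|abel_weight (e_ n) xi - 1|)); last by apply/funext => n; rewrite wE.
    rewrite -[X in _ --> X](mulr0 (cmodulus (FT f xi * conjc (FT ind xi)))).
    apply: cvgM; first exact: cvg_cst.
    apply/norm_cvg0P; rewrite -(subrr (1 : R)); apply: cvgB; last exact: cvg_cst.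
    exact: cvg_abel_weight.
have -> : (fun n => Cint (fun xi => FT f xi * (conjc (FT ind xi) * cweight (e_ n) xi))) =
    (fun n => Cint (fun x => f x * (poisson_ind (e_ n) x)%:C)).
  apply/funext => n; rewrite abel_parseval//; congr Cint; apply/funext => x.
  by rewrite Cint_ind_poisson// conjc_real.
have pE n x : cmodulus (f x * (poisson_ind (e_ n) x)%:C - (2 * pi)%:C * (f x * ind x)) =
    cmodulus (f x) * `|poisson_ind (e_ n) x - 2 * pi * \1_`[a, b] x|.
  have -> : f x * (poisson_ind (e_ n) x)%:C - (2 * pi)%:C * (f x * ind x) =
      f x * ((poisson_ind (e_ n) x)%:C - (2 * pi)%:C * ind x) by ring.
  rewrite cmodulusM -cmodulusR; congr (_ * cmodulus _).
  by rewrite /cindic; apply: complexP => /=; ring.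
have fi' : cL1 (fun x => f x * ind x) by exact: cL1M.
rewrite -CintZ//.
have iF n : cL1 (fun x => f x * (poisson_ind (e_ n) x)%:C).
  under eq_fun do rewrite mulrC; apply: (@cL1M_bounded _ _ _ (2 * pi)) => //.
    apply: cmeasR; apply: measurable_funB; apply: measurable_funM => //;
      (apply: (measurableT_comp (f := @atan R));
        [apply: continuous_measurable_fun; exact: continuous_atan|]);
      by apply: measurable_funM => //; exact: measurable_funB.
  by move=> x; rewrite cmodulusR poisson_ind_bound.
apply: (@ccvg_dominated _ _ _ (fun x => (4 * pi) * cmodulus (f x))) => //.
- exact: cL1Z.
- under [X in integrable _ _ X]eq_fun do rewrite /= EFinM.
  by apply: integrableZl => //; case: fi.
- move=> n x; rewrite pE mulrC; apply: ler_wpM2r; first exact: cmodulus_ge0.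
  have := poisson_ind_bound (e_ n) x.
  have h1 : 2 * pi * \1_`[a, b] x <= 2 * pi :> R.
    by rewrite ler_piMr ?mulr_ge0 ?pi_ge0// indicE lern1 leq_b1.
  have h2 : 0 <= 2 * pi * \1_`[a, b] x :> R by rewrite !mulr_ge0 ?pi_ge0.
  by rewrite !ler_norml => /andP[h3 h4]; apply/andP; split; lra.
- apply: aeS (aeI (ae_neq a) (ae_neq b)) => x [xa xb]; rewrite /ccvg.
  rewrite (_ : (fun n => _) = (fun n => cmodulus (f x) *
      `|poisson_ind (e_ n) x - 2 * pi * \1_`[a, b] x|)); last by apply/funext => n; rewrite pE.
  rewrite -[X in _ --> X](mulr0 (cmodulus (f x))).
  apply: cvgM; first exact: cvg_cst.
  apply/norm_cvg0P; rewrite -(subrr (2 * pi * \1_`[a, b] x)).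
  by apply: cvgB; [exact: cvg_poisson_ind|exact: cvg_cst].
Qed.

End Interval.
End IntervalParseval.

(** * Local integrability and Lebesgue differentiation *)

Section LocalIntegrability.
Variable R : realType.
Local Notation mu := (@lebesgue_measure R).
Implicit Types (f g : R -> R[i]).

Lemma clocally_integrableI f : cmeasurable f ->
  (forall M : R, cL1 (fun x => f x * cindic `[- M, M] x)) -> clocally_integrable f.
Proof.
move=> [rf jf] fM.
have loc (h : R -> R) : measurable_fun [set: R] h ->
    (forall x, `|h x| <= cmodulus (f x)) -> locally_integrable [set: R] h.
  move=> mh hf; split => //; first exact: openT.
  move=> K _ cK.
  have [M [_ KM]] := compact_bounded cK.
  pose N : R := M + 1.
  pose I : set R := `[- N, N]%classic.
  have KS : K `<=` I.
    move=> x Kx; rewrite /I /= in_itv/= -ler_norml.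
    by apply: KM => //; rewrite /N ltrDl.
  have mK : measurable K by exact: compact_measurable.
  apply: (@le_lt_trans _ _ (\int[mu]_(x in I) (`|h x|%R)%:E)%E).
    apply: ge0_subset_integral => //; first exact: measurable_itv.
    by apply/measurable_EFinP; apply: measurable_funTS; exact: measurableT_comp.
  have [mF /integrableP[_]] := fM N; apply: le_lt_trans.
  rewrite integral_mkcond; apply: ge0_le_integral => //.
  - by move=> x _; rewrite patchE; case: ifP.
  - apply/(measurable_restrictT _ _).1; first exact: measurable_itv.
    by apply: measurable_funTS; apply/measurable_EFinP; exact: measurableT_comp.
  - by apply: measurableT_comp => //; apply/measurable_EFinP; exact: measurable_cmodulus.
  - move=> x _; rewrite patchE; case: ifPn => xM; last exact: abse_ge0.
    rewrite /= cmodulusM cmodulus_cindic indicE xM mulr1 lee_fin (le_trans (hf x))//.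
    exact: ler_norm.
split; apply: loc => // x; [exact: Re_le_cmodulus|exact: Im_le_cmodulus].
Qed.

Lemma clocally_integrable_meas f : clocally_integrable f -> cmeasurable f.
Proof. by move=> [[rf _ _] [jf _ _]]. Qed.

Lemma clocally_integrable_ind f a b : clocally_integrable f ->
  cL1 (fun x => f x * cindic `[a, b] x).
Proof.
move=> lf; have mf := clocally_integrable_meas lf; case: lf => [[rf _ ri] [jf _ ji]].
have mi : cmeasurable (cindic `[a, b]) by exact: cmeasurable_ind.
have loc (h : R -> R) : measurable_fun [set: R] h ->
    (forall K, K `<=` [set: R] -> compact K -> (\int[mu]_(x in K) `|h x|%:E < +oo)%E) ->
    mu.-integrable [set: R] (EFin \o (fun x => h x * \1_`[a, b] x)).
  move=> mh hK; apply/integrableP; split.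
    by apply/measurable_EFinP; apply: measurable_funM => //; exact: measurable_indic.
  apply: le_lt_trans (hK `[a, b]%classic _ _) => //; last exact: segment_compact.
  rewrite [leRHS]integral_mkcond le_eqVlt; apply/orP; left; apply/eqP.
  apply: eq_integral => x _; rewrite patchE /= indicE.
  by case: (_ \in _); rewrite ?mulr1 ?mulr0 ?normr0.
apply: cL1I.
- rewrite (_ : _ \o _ = EFin \o (fun x => complex.Re (f x) * \1_`[a, b] x)).
    exact: loc.
  by apply/funext => x; rewrite /= cReM /= mulr0 subr0.
- rewrite (_ : _ \o _ = EFin \o (fun x => complex.Im (f x) * \1_`[a, b] x)).
    exact: loc.
  by apply/funext => x; rewrite /= cImM /= mulr0 add0r.
Qed.

Lemma square_integrable_loc f : square_integrable f -> clocally_integrable f.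
Proof.
move=> f2; apply: clocally_integrableI; first by case: f2.
by move=> M; apply: cL1M => //; exact: square_integrable_ind.
Qed.

Lemma bounded_loc f (C : R) : cmeasurable f ->
  {ae mu, forall x, cmodulus (f x) <= C} -> clocally_integrable f.
Proof.
move=> mf fC; apply: clocally_integrableI => // M.
have ii := @cL1_ind R (- M) M; have mi := cL1_meas ii.
split; first exact: cmeasM.
have mm : measurable_fun [set: R] (fun x => (cmodulus (f x * cindic `[- M, M] x))%:E).
  by apply/measurable_EFinP; apply: measurable_cmodulus; exact: cmeasM.
apply/integrableP; split => //.
have := (cL1Z (`|C|%:C) ii).2 => /integrableP[_]; apply: le_lt_trans.
apply: ae_ge0_le_integral => //.
- exact: measurableT_comp.
- apply: measurableT_comp => //; apply/measurable_EFinP; apply: measurable_cmodulus.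
  by have [] := cL1Z (`|C|%:C) ii.
- apply: aeS fC => x h _; rewrite /= lee_fin (ger0_norm (cmodulus_ge0 _)) (ger0_norm (cmodulus_ge0 _)) !cmodulusM.
  rewrite ler_wpM2r ?cmodulus_ge0// cmodulusR normr_id (le_trans h)//.
  exact: ler_norm.
Qed.

Lemma clocally_integrableB f g : clocally_integrable f -> clocally_integrable g ->
  clocally_integrable (fun x => f x - g x).
Proof.
move=> lf lg; have mf := clocally_integrable_meas lf.
have mg := clocally_integrable_meas lg.
apply: clocally_integrableI; first exact: cmeasB.
move=> M; under eq_fun do rewrite mulrBl.
by apply: cL1B; exact: clocally_integrable_ind.
Qed.

Lemma clocally_integrable_shift f h : clocally_integrable f ->
  clocally_integrable (fun x => f (x + h)).
Proof.
move=> lf; have mf := clocally_integrable_meas lf.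
apply: clocally_integrableI; first exact: cmeasurable_shift.
move=> M; have := cL1_shift h (clocally_integrable_ind (- M + h) (M + h) lf).
congr (cL1 _); apply/funext => x; congr (_ * _); rewrite /cindic !indicE.
congr ((_)%:R%:C); congr nat_of_bool.
by apply/idP/idP => /set_mem /=; rewrite in_itv/= => /andP[h1 h2]; apply/mem_set;
  rewrite /= in_itv/=; apply/andP; split; lra.
Qed.

End LocalIntegrability.

Section LebesgueBound.
Variable R : realType.
Local Notation mu := (@lebesgue_measure R).
Implicit Types (f g : R -> R[i]).

Let r_ (n : nat) : R := n.+1%:R^-1.
Let r_gt0 n : 0 < r_ n. Proof. exact: harmonic_gt0. Qed.

Let shrinking (x : R) : nicely_shrinking x (fun n => `[x - r_ n, x + r_ n]%classic).
Proof.
split; first by move=> n; exact: measurable_itv.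
exists (2, fun n => PosNum (mulr_gt0 (@ltr0Sn R 1) (r_gt0 n))); split => //=.
- by rewrite -(mulr0 (2 : R)); apply: cvgM; [exact: cvg_cst|exact: cvg_harmonic].
- move=> n y /=; rewrite in_itv/= /ball/= => /andP[h1 h2].
  by have := r_gt0 n; rewrite ltr_distlC => h; apply/andP; split; lra.
- move=> n; rewrite lebesgue_measure_ball; last by rewrite mulr_ge0// ltW.
  rewrite lebesgue_measure_itv/= lte_fin ltrD2l gtrN ?r_gt0// -EFinD -EFinM lee_fin.
  by have := r_gt0 n; lra.
Qed.

Let lebesgue_avg (h : R -> R) : locally_integrable [set: R] h ->
  {ae mu, forall x, (2 * r_ n)^-1 * Rintegral mu `[x - r_ n, x + r_ n] h
    @[n --> \oo] --> h x}.
Proof.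
move=> lh; apply: aeS (lebesgue_differentiation lh) => x /(nice_lebesgue_differentiation shrinking lh).
move=> /fine_cvg; apply: cvg_trans; apply: near_eq_cvg; apply: nearW => n /=.
rewrite lebesgue_measure_itv/= lte_fin ltrD2l gtrN ?r_gt0//.
have -> : ((x + r_ n)%:E - (x - r_ n)%:E = (2 * r_ n)%:E)%E.
  by rewrite -EFinD; congr EFin; ring.
have r2 : 0 < 2 * r_ n by rewrite mulr_gt0.
rewrite inver gt_eqF// /Rintegral.
have i2 : 0 < (2 * r_ n)^-1 by rewrite invr_gt0.
case: (\int[_]_(_ in _) _)%E => [s||] //=.
- by rewrite mulr0 gt0_muley.
- by rewrite mulr0 gt0_muleNy.
Qed.

(** By the Lebesgue differentiation theorem; [B] lets the bound on the averages depend on the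
    radius. *)
Lemma ae_le_of_averages f (C : R) (B : R -> R) : clocally_integrable f ->
  B n.+1%:R^-1 @[n --> \oo] --> C ->
  (forall x r, 0 < r -> cmodulus (cintegral `[x - r, x + r] f) <= 2 * r * B r) ->
  {ae mu, forall x, cmodulus (f x) <= C}.
Proof.
move=> [rf jf] BC fB.
apply: aeS (aeI (lebesgue_avg rf) (lebesgue_avg jf)) => x [rx jx].
pose z n := ((2 * r_ n)^-1)%:C * cintegral `[x - r_ n, x + r_ n] f.
have zB n : cmodulus (z n) <= B (r_ n).
  have r2 : 0 < 2 * r_ n by rewrite mulr_gt0.
  rewrite cmodulusM cmodulusR gtr0_norm ?invr_gt0// ler_pdivrMl//.
  exact: fB.
have zf : cmodulus (z n) @[n --> \oo] --> cmodulus (f x).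
  rewrite cmodulus_def (_ : (fun n => _) = (fun n => Num.sqrt
      (((2 * r_ n)^-1 * Rintegral mu `[x - r_ n, x + r_ n] (@complex.Re R \o f)) ^+ 2 +
       ((2 * r_ n)^-1 * Rintegral mu `[x - r_ n, x + r_ n] (@complex.Im R \o f)) ^+ 2)));
    last by apply/funext => n; rewrite cmodulus_def cReZ cImZ.
  apply: (continuous_cvg _ (@sqrt_continuous R _)).
  by apply: cvgD; rewrite expr2; apply: cvgM.
by apply: (ler_cvg_to zf BC); apply: nearW => n; exact: zB.
Qed.

End LebesgueBound.

(** * Plancherel transforms and Fourier inversion *)

Section Plancherel.
Variable R : realType.
Local Notation mu := (@lebesgue_measure R).
Local Notation nrm f := (cLnorm 2%:E f).
Local Notation sqrt2pi := (sqrt2pi R).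
Implicit Types (f g F : R -> R[i]).

Definition L2cvg (f_ : nat -> R -> R[i]) f : Prop :=
  forall e : R, 0 < e ->
    \forall n \near \oo, (nrm (fun x => f_ n x - f x)%R <= e%:E)%E.

Lemma nrm_fin f : square_integrable f -> nrm f = (fine (nrm f))%:E.
Proof.
by move=> [_ f2]; rewrite fineK// ge0_fin_numE// nrm_ge0.
Qed.

(** By the Cauchy-Schwarz inequality. *)
Lemma L2cvg_weak (f_ : nat -> R -> R[i]) f g :
  (forall n, square_integrable (f_ n)) -> square_integrable f ->
  square_integrable g -> L2cvg f_ f ->
  ccvg (fun n => Cint (fun x => f_ n x * g x)) (Cint (fun x => f x * g x)).
Proof.
move=> f_2 f2 g2 h; apply/cvgr0Pnorm_le => e e0.
pose G := fine (nrm g).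
have G0 : 0 <= G by rewrite fine_ge0// nrm_ge0.
have G1 : 0 < G + 1 by rewrite ltr_wpDl.
have := h (e / (G + 1)) (divr_gt0 e0 G1); apply: filterS => n hn.
rewrite ger0_norm ?cmodulus_ge0// -CintB; [|exact: cL1M|exact: cL1M].
have d2 := square_integrableB (f_2 n) f2.
have -> : Cint (fun x => f_ n x * g x - f x * g x) = Cint (fun x => (f_ n x - f x) * g x).
  by congr Cint; apply/funext => x; ring.
rewrite -lee_fin; apply: (le_trans (le_cmodulus_Cint (cL1M d2 g2))).
apply: (le_trans (cauchy_schwarz d2.1 g2.1)).
apply: (@le_trans _ _ ((e / (G + 1))%:E * nrm g)%E).
  by apply: lee_wpmul2r => //; exact: nrm_ge0.
rewrite (nrm_fin g2) -/G -EFinM lee_fin -mulrA ler_piMr ?(ltW e0)//.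
by rewrite mulrC ler_pdivrMr// mul1r lerDl.
Qed.

Lemma le_nrm_eps (x : \bar R) (y : \bar R) (c : R) : 0 < c ->
  (forall e : R, 0 < e -> (x <= y + (c * e)%:E)%E) -> (x <= y)%E.
Proof.
move=> c0 h; apply/lee_addgt0Pr => e e0.
by have := h (e / c) (divr_gt0 e0 c0); rewrite mulrCA divff ?mulr1// gt_eqF.
Qed.

Lemma cvge0_near (X : nat -> \bar R) : X @ \oo --> 0%E ->
  forall e : R, 0 < e -> \forall n \near \oo, (X n <= e%:E)%E.
Proof.
move=> /fine_cvgP[Xf X0] e e0.
have Xe := cvgr_lt _ X0 _ e0.
near=> n; have Xn : X n \is a fin_num by near: n.
by rewrite -(fineK Xn) lee_fin; apply: ltW; near: n; exact: Xe.
Unshelve. all: by end_near. Qed.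

(** Unlike [fourier_transform], whose approximations are truncations, this relation visibly
    passes to translates and differences. *)
Definition plancherel f F : Prop :=
  [/\ square_integrable f, square_integrable F &
    exists f_ : nat -> R -> R[i],
      [/\ forall n, cL1 (f_ n), forall n, square_integrable (f_ n),
        L2cvg f_ f & L2cvg (fun n => FT (f_ n)) F]].

Lemma plancherel_bessel f F : plancherel f F -> (nrm F <= sqrt2pi%:E * nrm f)%E.
Proof.
move=> [f2 F2 [f_ [fi f_2 ff FF]]].
have s0 := sqrt2pi_gt0 R.
apply: (@le_nrm_eps _ _ (sqrt2pi + 1)); first by rewrite ltr_wpDr.
move=> e e0; have [n [h1 h2]] : exists n, (nrm (fun x => f_ n x - f x)%R <= e%:E)%E /\
    (nrm (fun x => FT (f_ n) x - F x)%R <= e%:E)%E.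
  have := filterI (ff e e0) (FF e e0).
  by case=> N _ h; exists N; exact: (h N (leqnn N)).
have mF := F2.1; have mf := f2.1; have mFn := cmeasurable_FT (fi n).
have mfn := cL1_meas (fi n).
have hF : (nrm F <= nrm (FT (f_ n)) + e%:E)%E.
  apply: (@le_trans _ _ (nrm (FT (f_ n)) + nrm (fun x => FT (f_ n) x - F x)%R)%E).
    apply: le_trans (nrmB mFn (cmeasB mFn mF)); rewrite le_eqVlt; apply/orP; left; apply/eqP.
    by apply: eq_nrm => x; congr cmodulus; ring.
  by rewrite leeD2l.
have hf : (nrm (f_ n) <= nrm f + e%:E)%E.
  apply: (@le_trans _ _ (nrm f + nrm (fun x => f_ n x - f x)%R)%E).
    apply: le_trans (nrmD mf (cmeasB mfn mf)); rewrite le_eqVlt; apply/orP; left; apply/eqP.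
    by apply: eq_nrm => x; congr cmodulus; ring.
  by rewrite leeD2l.
apply: (le_trans hF).
have hb := bessel (fi n).
apply: (@le_trans _ _ (sqrt2pi%:E * (nrm f + e%:E) + e%:E)%E).
  by rewrite leeD2r//; apply: (le_trans hb); apply: lee_wpmul2l => //; rewrite lee_fin ltW.
have [N ->] : exists N, nrm f = N%:E by exists (fine (nrm f)); exact: nrm_fin.
rewrite -!EFinD lee_fin; lra.
Qed.

Lemma plancherel_diff h f F : plancherel f F ->
  plancherel (fun x => f (x + h) - f x) (fun xi => (expi (h * xi) - 1) * F xi).
Proof.
move=> [f2 F2 [f_ [fi f_2 ff FF]]].
have me : cmeasurable (fun xi : R => expi (h * xi) - 1).
  by apply: cmeasB; [apply: cmeasurable_expi; exact: measurable_funM|exact: cmeas_cst].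
have be (xi : R) : cmodulus (expi (h * xi) - 1) <= 2.
  rewrite (le_trans (cmodulusD _ _))// cmodulusN cmodulus_expi cmodulus1; lra.
split.
- by apply: square_integrableB => //; exact: square_integrable_shift.
- apply: (@square_integrable_le _ 2 _ F) => //; first by apply: cmeasM => //; case: F2.
  by apply: aeT => xi; rewrite cmodulusM ler_wpM2r// cmodulus_ge0.
exists (fun n x => f_ n (x + h) - f_ n x); split.
- by move=> n; apply: cL1B => //; exact: cL1_shift.
- by move=> n; apply: square_integrableB => //; exact: square_integrable_shift.
- move=> e e0; have e20 : 0 < e / 2 by rewrite divr_gt0.
  apply: filterS (ff _ e20) => n hn.
  have md : cmeasurable (fun x => f_ n x - f x) by apply: cmeasB; [case: (f_2 n)|case: f2].
  have -> : e%:E = ((e / 2)%:E + (e / 2)%:E)%E by rewrite -EFinD; congr EFin; field.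
  apply: le_trans (leeD hn hn); rewrite -{1}(nrm_shift h md).
  apply: le_trans (nrmB (cmeasurable_shift h md) md).
  rewrite le_eqVlt; apply/orP; left; apply/eqP.
  by apply: eq_nrm => x; congr cmodulus; ring.
- move=> e e0; have e20 : 0 < e / 2 by rewrite divr_gt0.
  apply: filterS (FF _ e20) => n hn.
  have mD : cmeasurable (fun xi => FT (f_ n) xi - F xi).
    by apply: cmeasB; [exact: cmeasurable_FT|case: F2].
  have -> : e%:E = (2%:E * (e / 2)%:E)%E by rewrite -EFinM; congr EFin; field.
  apply: le_trans (lee_wpmul2l _ hn) => //.
  have FTe xi : FT (fun x => f_ n (x + h) - f_ n x) xi = (expi (h * xi) - 1) * FT (f_ n) xi.
    by rewrite FTB ?FT_shift ?mulrBl ?mul1r//; exact: cL1_shift.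
  apply: le_nrm => //.
    apply: cmeasB; last by apply: cmeasM => //; case: F2.
    by apply: cmeasurable_FT; apply: cL1B => //; exact: cL1_shift.
  by apply: aeT => xi; rewrite FTe -mulrBr cmodulusM ler_wpM2r ?cmodulus_ge0.
Qed.

Lemma plancherel_parseval_ind f F a b : a <= b -> plancherel f F ->
  Cint (fun xi => F xi * conjc (FT (cindic `[a, b]) xi)) =
  (2 * pi)%:C * Cint (fun x => f x * cindic `[a, b] x).
Proof.
move=> ab [f2 F2 [f_ [fi f_2 ff FF]]].
have ii := @cL1_ind R a b; have i2 := @square_integrable_ind R a b.
have I2 := square_integrable_FT ii i2.
have I2' : square_integrable (fun xi => conjc (FT (cindic `[a, b]) xi)).
  split; first by apply: cmeasJ; case: I2.
  by rewrite (@eq_nrm _ _ (FT (cindic `[a, b]))); [case: I2|move=> x; rewrite cmodulusJ].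
have h1 := L2cvg_weak (fun n => square_integrable_FT (fi n) (f_2 n)) F2 I2' FF.
have h2 := L2cvg_weak f_2 f2 i2 ff.
apply: (ccvg_unique h1); rewrite /ccvg.
rewrite (_ : (fun n => _) = (fun n => (2 * pi) *
   cmodulus (Cint (fun x => f_ n x * cindic `[a, b] x) - Cint (fun x => f x * cindic `[a, b] x)))).
  by rewrite -[X in _ --> X](mulr0 (2 * pi)); apply: cvgM; [exact: cvg_cst|exact: h2].
apply/funext => n; rewrite parseval_ind// -mulrBr cmodulusM cmodulusR ger0_norm//.
by rewrite mulr_ge0// pi_ge0.
Qed.

(** Both sides have the same integral over every interval, by Parseval's identity against
    its indicator; Lebesgue's differentiation theorem concludes. *)
Lemma fourier_inversion f F : plancherel f F -> cL1 F ->
  {ae mu, forall x, (2 * pi)%:C * f x = FT F (- x)}.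
Proof.
move=> fF Fi; have [f2 F2 _] := fF.
have lf := square_integrable_loc f2; have mF := cmeasurable_FT Fi.
have mFo : cmeasurable (fun x => FT F (- x)) by exact: cmeasurable_opp.
have lG : clocally_integrable (fun x => (2 * pi)%:C * f x - FT F (- x)).
  apply: clocally_integrableB.
    apply: square_integrable_loc; apply: (@square_integrable_le _ (2 * pi) _ f) => //.
    - by rewrite mulr_ge0// pi_ge0.
    - by apply: cmeasM; [exact: cmeas_cst|case: f2].
    - by apply: aeT => x; rewrite cmodulusM cmodulusR ger0_norm// mulr_ge0// pi_ge0.
  apply: (@bounded_loc _ _ (L1norm F)) => //.
  by apply: aeT => x; exact: cmodulus_FT.
have G0 a b : a <= b -> cintegral `[a, b] (fun x => (2 * pi)%:C * f x - FT F (- x)) = 0.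
  move=> ab; have ii := @cL1_ind R a b; have i2 := @square_integrable_ind R a b.
  rewrite cintegral_cindic; under eq_fun do rewrite mulrBl -mulrA.
  have fi : cL1 (fun x => f x * cindic `[a, b] x) by exact: cL1M.
  have Fii : cL1 (fun x => FT F (- x) * cindic `[a, b] x).
    apply: (@cL1M_bounded _ _ _ (L1norm F)) => // x; exact: cmodulus_FT.
  rewrite CintB//; last exact: cL1Z.
  rewrite CintZ// -(plancherel_parseval_ind ab fF); apply/eqP; rewrite subr_eq0; apply/eqP.
  have conjE xi : conjc (FT (cindic `[a, b]) xi) = FT (cindic `[a, b]) (- xi).
    rewrite -[in LHS](opprK xi) -FT_conj//; congr (FT _ _); apply/funext => x.
    by rewrite /cindic conjc_real.
  rewrite (_ : (fun xi => _) = (fun xi => F xi * FT (cindic `[a, b]) (- xi))); last first.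
    by apply/funext => xi; rewrite conjE.
  have mI : cmeasurable (fun xi => F xi * FT (cindic `[a, b]) (- xi)).
    apply: cmeasM; first by case: F2.
    by apply: cmeasurable_opp; exact: cmeasurable_FT.
  rewrite -(Cint_opp mI).
  transitivity (Cint (fun xi => FT (cindic `[a, b]) xi * F (- xi))).
    by congr Cint; apply/funext => xi; rewrite opprK mulrC.
  rewrite multiplication_formula//; last exact: cL1_opp.
  by congr Cint; apply/funext => x; rewrite FT_opp// mulrC.
have h0 x r : 0 < r -> cmodulus (cintegral `[x - r, x + r]
    (fun x => (2 * pi)%:C * f x - FT F (- x))) <= 2 * r * 0.
  by move=> r0; rewrite G0 ?cmodulus0 ?mulr0//; lra.
have c0 : (fun n : nat => (0 : R)) @ \oo --> (0 : R) by exact: cvg_cst.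
have h1 := ae_le_of_averages (B := fun=> 0) lG c0 h0.
apply: aeS h1 => x h; apply/eqP; rewrite -subr_eq0; apply/eqP/cmodulus_eq0.
by apply/eqP; rewrite eq_le h cmodulus_ge0.
Qed.

Lemma L2cvg_truncation f : square_integrable f ->
  L2cvg (fun k x => f x * cindic `[- k%:R, k%:R] x) f.
Proof.
move=> f2; have mf := f2.1.
have mi k : cmeasurable (@cindic R `[- k%:R, k%:R]) by exact: cmeasurable_ind.
pose d (k : nat) x := f x * cindic `[- k%:R, k%:R] x - f x.
have md k : cmeasurable (d k) := cmeasB (cmeasM mf (mi k)) mf.
have dE k x : cmodulus (d k x) = cmodulus (f x) * (1 - \1_`[- k%:R, k%:R] x).
  rewrite /d /cindic indicE; case: (_ \in _).
    by rewrite mulr1 !subrr cmodulus0 mulr0.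
  by rewrite mulr0 sub0r cmodulusN subr0 mulr1.
suff h : sqint (d k) @[k --> \oo] --> 0%E.
  move=> e e0; have e20 : 0 < e ^+ 2 by rewrite exprn_gt0.
  apply: filterS (cvge0_near h e20) => k hk; apply/nrm_leP => //; exact: ltW.
have [] := @dominated_convergence _ _ R mu setT measurableT
  (fun k x => (cmodulus (d k x) ^+ 2)%:E) (cst 0%E) (fun x => (cmodulus (f x) ^+ 2)%:E)
  (fun k => measurable_sqmod (md k)) (measurable_cst _) _ (square_integrable_sq f2) _.
- apply: aeT => x _; apply: cvg_near_cst.
  near=> k; rewrite dE indicE mem_set ?subrr ?mulr0 ?expr0n//.
  rewrite /= in_itv/= -ler_norml.
  by near: k; exact: nbhs_infty_ger.
- apply: aeT => x k _; rewrite gee0_abs ?lee_fin ?sqr_ge0// ler_pXn2r// ?nnegrE ?cmodulus_ge0//.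
  rewrite dE ler_piMr ?cmodulus_ge0// indicE; case: (_ \in _); lra.
by move=> _ _; rewrite integral0_eq.
Unshelve. all: by end_near. Qed.

(** The truncations of [f] are integrable, and their Fourier integrals are the truncated
    transforms. *)
Lemma fourier_transform_plancherel f F : fourier_transform f F -> plancherel f F.
Proof.
move=> [f2 F2 fF]; split => //.
exists (fun k x => f x * cindic `[- k%:R, k%:R] x); split.
- by move=> k; apply: cL1M => //; exact: square_integrable_ind.
- move=> k; apply: (@square_integrable_le _ 1 _ f) => //.
    by apply: cmeasM; [case: f2|exact: cmeasurable_ind].
  apply: aeT => x; rewrite cmodulusM mul1r ler_piMr ?cmodulus_ge0// cmodulus_cindic.
  by rewrite indicE lern1 leq_b1.
- exact: L2cvg_truncation.
- have kc : (k%:R : R) @[k --> \oo] --> +oo%R by exact: cvgr_idn.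
  have := cvg_comp _ _ kc fF => /cvge0_near h e e0.
  apply: filterS (h e e0) => k; apply: le_trans; rewrite le_eqVlt; apply/orP; left; apply/eqP.
  apply: eq_nrm => xi; congr (cmodulus (_ - _)).
  rewrite /truncated_fourier cintegral_cindic; congr Cint; apply/funext => x.
  by rewrite /expi cosN sinN mulrAC.
Qed.

End Plancherel.

(** * Bump functions *)

Section TestFunctions.
Variable R : realType.
Implicit Types (f g phi : R -> R) (p : {poly R}).

Definition smooth f : Prop := forall n x, derivable (derive1n n f) x 1.

(** A coinduction principle: it suffices to exhibit one derivative inside the class. *)
Lemma smooth_ind (P : (R -> R) -> Prop) :
  (forall f, P f -> exists df, (forall x : R, is_derive x (1 : R) f (df x)) /\ P df) ->
  forall f, P f -> smooth f.
Proof.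
move=> Pd f Pf n; elim: n f Pf => [|n ih] f Pf x.
  by have [df [dfx _]] := Pd f Pf; exact: ex_derive.
have [df [dfx Pdf]] := Pd f Pf.
rewrite /derive1n iterSr (_ : f^`()%classic = df); first exact: ih.
by apply/funext => y; rewrite derive1E; apply: derive_val.
Qed.

Lemma smooth_is_derive f n x : smooth f ->
  is_derive x (1 : R) (derive1n n f) (derive1n n.+1 f x).
Proof.
by move=> sf; rewrite derive1nS; apply: DeriveDef; [exact: sf|rewrite derive1E].
Qed.

Lemma smooth_derive1n f n : smooth f -> smooth (derive1n n f).
Proof. by move=> sf m x; rewrite /derive1n -iterD; exact: sf. Qed.

Lemma smooth_continuous f : smooth f -> continuous f.
Proof.
move=> sf x; apply: differentiable_continuous; apply/derivable1_diffP.
exact: (sf 0%N).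
Qed.

Lemma poly_le_expR p : exists2 C : R, 0 <= C & forall z, 0 <= z -> `|p.[z]| <= C * expR z.
Proof.
have Xn n z : 0 <= z -> z ^+ n <= n`!%:R * expR z :> R.
  case: n => [|n] z0; first by rewrite expr0 fact0 mul1r -expR0 ler_expR.
  rewrite mulrC -ler_pdivrMr ?ltr0n ?fact_gt0//.
  by apply: le_trans (expR_ge1Dxn n z0); rewrite lerDr.
exists (\sum_(i < size p) `|p`_i| * i`!%:R).
  by apply: sumr_ge0 => i _; rewrite mulr_ge0.
move=> z z0; rewrite horner_coef (le_trans (ler_norm_sum _ _ _))// mulr_suml.
apply: ler_sum => i _; rewrite normrM -mulrA ler_wpM2l//.
by rewrite ger0_norm ?exprn_ge0// Xn.
Qed.

(** Differentiation maps the family p(1/y) exp(-1/y), extended by 0, to itself; hence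
    exp(-1/y) is smooth across the origin. *)
Definition flat p (y : R) : R := if 0 < y then p.[y^-1] * expR (- y^-1) else 0.

Definition dflat p : {poly R} := 'X ^+ 2 * (p - p^`()).

Lemma is_derive_flat p (y : R) : is_derive y (1 : R) (flat p) (flat (dflat p) y).
Proof.
have [y0|y0|y0] := ltgtP y 0.
- have e : \forall z \near y, cst 0 z = flat p z.
    near=> z; rewrite /flat ltNge; suff -> : z <= 0 by [].
    by apply: ltW; near: z; exact: lt_nbhsl.
  rewrite {2}/flat ltNge (ltW y0) /=.
  exact: (near_eq_is_derive e (is_derive_cst _ _ _)).
- have e : \forall z \near y, p.[z^-1] * expR (- z^-1) = flat p z.
    by near=> z; rewrite /flat; suff -> : 0 < z by []; near: z; exact: lt_nbhsr.
  apply: (near_eq_is_derive e); rewrite /flat y0.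
  have yn : y != 0 by rewrite gt_eqF.
  have dV : is_derive y (1 : R) (fun z => z^-1) (- y ^- 2).
    have := @is_deriveV R id y 1 1 yn (is_derive_id _ _).
    by rewrite /GRing.scale /= mulr1.
  have d1 : is_derive y (1 : R) (horner p \o (fun z => z^-1)) (p^`().[y^-1] * (- y ^- 2)).
    exact: is_derive1_comp.
  have d2 : is_derive y (1 : R) (expR \o (fun z => - z^-1)) (expR (- y^-1) * (y ^- 2)).
    have dN : is_derive y (1 : R) (fun z => - z^-1) (y ^- 2).
      by apply: is_derive_eq; rewrite opprK.
    exact: is_derive1_comp.
  apply: (@is_derive_eq _ _ _ _ _ _ _ _ (is_deriveM d1 d2)).
  rewrite /GRing.scale /= /dflat hornerM hornerXn hornerD hornerN.
  by field.
- rewrite y0 {2}/flat ltxx; have [C C0 hC] := poly_le_expR ('X ^+ 2 * p).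
  have lim0 : (fun h => h^-1 *: (flat p (h *: (1 : R) + 0) - flat p 0)) @ (0 : R)^' --> (0 : R).
    apply/cvgr0Pnorm_le => e e0.
    near=> h; rewrite /flat ltxx subr0 addr0 /GRing.scale /= mulr1.
    case: ifPn => [h0|_]; last by rewrite mulr0 normr0 ltW.
    have hn : h != 0 by rewrite gt_eqF.
    have hi : 0 <= h^-1 by rewrite invr_ge0 ltW.
    have := hC h^-1 hi; rewrite hornerM hornerXn normrM => k.
    have -> : `|h^-1 * (p.[h^-1] * expR (- h^-1))| =
        h * (`|h^-1 ^+ 2| * `|p.[h^-1]|) * expR (- h^-1).
      rewrite !normrM (ger0_norm hi) (ger0_norm (expR_ge0 _)).
      by set P := `|p.[_]|; set E := expR _; field.
    apply: (@le_trans _ _ (h * (C * expR h^-1) * expR (- h^-1))).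
      by rewrite ler_wpM2r ?expR_ge0// ler_wpM2l// ltW.
    rewrite -!mulrA -expRD subrr expR0 mulr1.
    rewrite (@le_trans _ _ (h * (C + 1)))//; first by rewrite ler_wpM2l ?(ltW h0)// lerDl.
    rewrite -ler_pdivlMr ?ltr_wpDl//; apply: (le_trans (ler_norm _)).
    near: h; apply: dnbhs0_le; by rewrite divr_gt0// ltr_wpDl.
  apply: DeriveDef; first by apply/cvg_ex; exists 0.
  exact: (cvg_lim _ lim0).
Unshelve. all: by end_near. Qed.

Lemma flat_ge0 y : 0 <= flat 1 y.
Proof. by rewrite /flat; case: ifP => // _; rewrite hornerC mul1r expR_ge0. Qed.

Lemma flat_le1 y : flat 1 y <= 1.
Proof.
rewrite /flat; case: ifP => // y0; rewrite hornerC mul1r -expR0 ler_expR.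
by rewrite oppr_le0 invr_ge0 ltW.
Qed.

(** Closed under differentiation by the chain and product rules, hence made of smooth
    functions. *)
Inductive flat_alg : (R -> R) -> Prop :=
| flat_gen p (c d : R) : flat_alg (fun x => flat p (c * x + d))
| flat_add f g : flat_alg f -> flat_alg g -> flat_alg (fun x => f x + g x)
| flat_mul f g : flat_alg f -> flat_alg g -> flat_alg (fun x => f x * g x).

Lemma flatZ p (k y : R) : flat (k *: p) y = k * flat p y.
Proof. by rewrite /flat; case: ifP; rewrite ?mulr0// hornerZ mulrA. Qed.

Lemma flat_alg_smooth f : flat_alg f -> smooth f.
Proof.
apply: smooth_ind => {}f; elim => {f} [p c d|f g fa [df [dfx dfa]] ga [dg [dgx dga]]|
    f g fa [df [dfx dfa]] ga [dg [dgx dga]]].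
- exists (fun x => flat (c *: dflat p) (c * x + d)); split; last exact: flat_gen.
  move=> x; have d1 : is_derive x (1 : R) (fun x => c * x + d) c.
    by apply: is_derive_eq; rewrite /GRing.scale /= mulr1 addr0.
  have := @is_derive1_comp R (flat p) (fun x => c * x + d) x _ _
    (is_derive_flat p (c * x + d)) d1.
  by rewrite flatZ mulrC.
- exists (fun x => df x + dg x); split; last exact: flat_add.
  by move=> x; apply: is_deriveD.
- exists (fun x => f x * dg x + g x * df x); split.
    by move=> x; apply: is_deriveM.
  by apply: flat_add; apply: flat_mul.
Qed.

(** A sequence of test functions increasing to the indicator of ]a, b[. *)
Definition bump_fun (a b : R) (n : nat) (x : R) : R :=
  flat 1 (n.+1%:R * (x - a)) * flat 1 (n.+1%:R * (b - x)).

Lemma bump_smooth a b n : smooth (bump_fun a b n).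
Proof.
apply: flat_alg_smooth; rewrite /bump_fun.
have -> : (fun x => flat 1 (n.+1%:R * (x - a)) * flat 1 (n.+1%:R * (b - x))) =
    (fun x => flat 1 (n.+1%:R * x + - (n.+1%:R * a)) *
              flat 1 (- n.+1%:R * x + n.+1%:R * b)).
  by apply/funext => x; congr (flat _ _ * flat _ _); ring.
by apply: flat_mul; exact: flat_gen.
Qed.

Lemma bump_ge0 a b n x : 0 <= bump_fun a b n x.
Proof. by rewrite mulr_ge0// flat_ge0. Qed.

Lemma bump_le1 a b n x : bump_fun a b n x <= 1.
Proof. by rewrite mulr_ile1 ?flat_ge0 ?flat_le1. Qed.

Lemma bump_out a b n x : ~~ (a < x < b) -> bump_fun a b n x = 0.
Proof.
rewrite negb_and -!leNgt => /orP[xa|bx]; rewrite /bump_fun.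
  by rewrite /flat ltNge mulr_ge0_le0 ?subr_le0// mul0r.
by rewrite [flat 1 (_ * (b - x))]/flat ltNge mulr_ge0_le0 ?subr_le0// mulr0.
Qed.

Lemma bump_cvg a b x : a < x < b -> bump_fun a b n x @[n --> \oo] --> (1 : R).
Proof.
have key (y : R) : 0 < y -> flat 1 (n.+1%:R * y) @[n --> \oo] --> (1 : R).
  move=> y0; rewrite (_ : (fun n => _) = (fun n => expR (- (n.+1%:R^-1 * y^-1)))); last first.
    apply/funext => n; rewrite /flat mulr_gt0// hornerC mul1r invfM//.
  rewrite -[X in _ --> X]expR0; apply: (continuous_cvg _ (@continuous_expR R 0)).
  rewrite -[X in _ --> X]oppr0; apply: cvgN; rewrite -[X in _ --> X](mul0r y^-1).
  by apply: cvgM; [exact: cvg_harmonic|exact: cvg_cst].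
move=> /andP[ax xb]; rewrite /bump_fun -[X in _ --> X]mulr1.
by apply: cvgM; apply: key; rewrite subr_gt0.
Qed.

Lemma bump_test a b n : test_function (bump_fun a b n).
Proof.
split; first exact: bump_smooth.
exists (Num.max `|a| `|b|) => x; rewrite gt_max => /andP[ax bx].
apply: bump_out; apply/negP => /andP[xa xb].
have [x0|x0] := leP 0 x.
  by move: bx; rewrite (ger0_norm x0) ltNge (le_trans (ltW xb))// ler_norm.
move: ax; rewrite (ltr0_norm x0) ltNge -normrN (le_trans _ (ler_norm _))// lerN2.
exact: ltW.
Qed.

End TestFunctions.

(** * Calculus of test functions *)

Section TestCalculus.
Variable R : realType.
Local Notation mu := (@lebesgue_measure R).
Implicit Types (f g : R -> R[i]) (phi : R -> R).

(** The codomain is general because real test functions and complex functions are both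
    differenced. *)
Definition fdiff {V : zmodType} (h : R) (f : R -> V) : R -> V := fun x => f (x + h) - f x.

Lemma derive1n_fdiff h phi n : smooth phi ->
  derive1n n (fdiff h phi) = fdiff h (derive1n n phi).
Proof.
move=> sphi; elim: n => // n ih.
apply/funext => x; rewrite derive1nS ih derive1E /fdiff.
have d1 : is_derive x (1 : R) (fun x => x + h) 1.
  by apply: is_derive_eq; rewrite addr0.
have d2 := @is_derive1_comp R (derive1n n phi) (fun x => x + h) x _ _
  (smooth_is_derive n (x + h) sphi) d1.
have d3 := smooth_is_derive n x sphi.
have [_ dv] := is_deriveB d2 d3.
by apply: (etrans dv); rewrite mulr1.
Qed.

Lemma smooth_fdiff h phi : smooth phi -> smooth (fdiff h phi).
Proof.
move=> sphi n x; rewrite derive1n_fdiff//.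
have d1 : is_derive x (1 : R) (fun x => x + h) 1.
  by apply: is_derive_eq; rewrite addr0.
have d2 := @is_derive1_comp R (derive1n n phi) (fun x => x + h) x _ _
  (smooth_is_derive n (x + h) sphi) d1.
have d3 := smooth_is_derive n x sphi.
by have := is_deriveB d2 d3 => -[].
Qed.

Lemma test_fdiff h phi : test_function phi -> test_function (fdiff h phi).
Proof.
move=> [sphi [M hM]]; split; first exact: smooth_fdiff.
exists (M + `|h|) => x Mx; rewrite /fdiff !hM ?subrr//.
  by rewrite (le_lt_trans _ Mx)// lerDl.
rewrite -(ltrD2r `|h|) (lt_le_trans Mx)//.
by rewrite -{1}(addrK h x) (le_trans (ler_normB _ _)).
Qed.

Lemma test_derive1n phi n : test_function phi -> test_function (derive1n n phi).
Proof.
move=> [sphi [M hM]]; split; first exact: smooth_derive1n.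
exists M; elim: n => // n ih x Mx.
rewrite derive1nS derive1E.
have e : \forall z \near x, cst 0 z = derive1n n phi z.
  near=> z; rewrite ih//; near: z.
  exact: (cvgr_gt _ (@norm_continuous _ _ x)).
by rewrite -(near_eq_derive _ e) derive_cst.
Unshelve. all: by end_near. Qed.

Lemma test_bounded phi : test_function phi -> exists2 B, 0 <= B & forall x, `|phi x| <= B.
Proof.
move=> [sphi [M hM]].
have MM : - `|M| <= `|M| by rewrite (@le_trans _ _ 0)// oppr_le0.
have cn : continuous (fun x => `|phi x|).
  move=> x; apply: (@continuous_comp _ _ _ phi (fun y : R => `|y|)); first exact: smooth_continuous.
  exact: norm_continuous.
have [c _ hc] := EVT_max MM (continuous_subspaceT cn).
exists `|phi c| => // x.
have [xM|xM] := leP `|x| `|M|; first by apply: hc; rewrite in_itv/= -ler_norml.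
by rewrite hM ?normr0//; apply: le_lt_trans xM; exact: ler_norm.
Qed.

Lemma test_measurable phi : test_function phi -> measurable_fun [set: R] phi.
Proof. by move=> [sphi _]; apply: continuous_measurable_fun; exact: smooth_continuous. Qed.

Lemma cL1_test f phi : clocally_integrable f -> test_function phi ->
  cL1 (fun x => f x * (phi x)%:C).
Proof.
move=> lf tphi; have [B B0 hB] := test_bounded tphi; have [sphi [M hM]] := tphi.
have H : cL1 (fun x => (phi x)%:C * (f x * cindic `[- M, M] x)).
  apply: (@cL1M_bounded _ _ _ B).
  - exact: clocally_integrable_ind.
  - by apply: cmeasR; exact: test_measurable.
  - by move=> x; rewrite cmodulusR.
move: H; congr (cL1 _); apply/funext => x; rewrite /cindic indicE.
have [xM|xM] := boolP (x \in _); first by rewrite mulr1 mulrC.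
rewrite hM ?mul0r ?mulr0//.
by rewrite ltNge; apply: contra xM => xM; apply/mem_set; rewrite /= in_itv/= -ler_norml.
Qed.

Lemma integrable_test phi : test_function phi -> mu.-integrable [set: R] (EFin \o phi).
Proof.
move=> tphi; have l1 : clocally_integrable (fun _ : R => (1 : R[i])).
  apply: (@bounded_loc _ _ 1); first exact: cmeas_cst.
  by apply: aeT => x; rewrite cmodulus1.
have := cL1_Re (cL1_test l1 tphi); congr (integrable _ _ _); apply/funext => x.
by rewrite /comp mul1r.
Qed.

Definition primitive phi (x : R) : R := Rintegral mu `]-oo, x] phi.

Lemma is_derive_primitive phi x : test_function phi ->
  is_derive x (1 : R) (primitive phi) (phi x).
Proof.
move=> tphi; have [sphi _] := tphi.
have := @continuous_FTC1 R phi (BInfty _ true) x (x + 1) _ _ _ _.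
move=> []//; first by rewrite ltrDl.
- by apply: integrableS (integrable_test tphi).
- by rewrite ltNyr.
- exact: smooth_continuous.
by move=> d1 d2; apply: DeriveDef => //; rewrite -derive1E.
Qed.

(** The moving integral of [phi] over ]x - h, x]: its derivative is a difference
   of [phi]. *)
Definition moving phi (h x : R) : R := primitive phi x - primitive phi (x - h).

Lemma moving_smooth phi h : test_function phi -> smooth (moving phi h).
Proof.
move=> tphi; have [sphi _] := tphi.
pose P (f : R -> R) := f = moving phi h \/ exists n, f = fun x => - fdiff (- h) (derive1n n phi) x.
apply: (@smooth_ind _ P); last by left.
move=> f [->|[n ->]].
  exists (fun x => - fdiff (- h) phi x); split; last by right; exists 0%N.
  move=> x; have d1 : is_derive x (1 : R) (fun x => x - h) 1.
    by apply: is_derive_eq; rewrite subr0.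
  have d2 := @is_derive1_comp R (primitive phi) (fun x => x - h) x _ _
    (is_derive_primitive (x - h) tphi) d1.
  have := is_deriveB (is_derive_primitive x tphi) d2.
  by rewrite mulr1 /fdiff opprB.
exists (fun x => - fdiff (- h) (derive1n n.+1 phi) x); split; last by right; exists n.+1.
move=> x; apply: is_deriveN.
rewrite -(derive1n_fdiff _ n.+1)// -(derive1n_fdiff _ n)//.
exact/smooth_is_derive/smooth_fdiff.
Qed.

Lemma derive1_moving phi h x : test_function phi ->
  (moving phi h)^`()%classic x = - fdiff (- h) phi x.
Proof.
move=> tphi; rewrite derive1E.
have d1 : is_derive x (1 : R) (fun x => x - h) 1.
  by apply: is_derive_eq; rewrite subr0.
have d2 := @is_derive1_comp R (primitive phi) (fun x => x - h) x _ _
  (is_derive_primitive (x - h) tphi) d1.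
have [_ dv] := is_deriveB (is_derive_primitive x tphi) d2.
by apply: (etrans dv); rewrite mulr1 /fdiff opprB.
Qed.

Lemma movingE phi h x : 0 <= h -> test_function phi ->
  moving phi h x = Rintegral mu `]x - h, x] phi.
Proof.
move=> h0 tphi; rewrite /moving /primitive Rintegral_itvB//.
- by apply: integrableS (integrable_test tphi).
- by rewrite bnd_simp gerBl.
Qed.

Section Bump.
Variables (a b h : R) (n : nat).
Hypotheses (ab : a <= b) (h0 : 0 <= h).
Let tb := bump_test a b n.

Lemma moving_bump_bound x : 0 <= moving (bump_fun a b n) h x <= b - a.
Proof.
rewrite movingE//; apply/andP; split.
  by apply: Rintegral_ge0 => y _; exact: bump_ge0.
rewrite Rintegral_mkcond.
apply: (@le_trans _ _ (Rintegral mu setT (fun y => \1_`[a, b] y))).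
  apply: le_Rintegral => //.
  - have h1 : mu.-integrable `]x - h, x] (EFin \o bump_fun a b n).
      by apply: integrableS (integrable_test tb).
    by have := (@integrable_mkcond _ _ R mu _ (EFin \o bump_fun a b n) (measurable_itv _)).1 h1; rewrite restrict_EFin.
  - exact: integrable_indic_itv.
  - move=> y _; rewrite patchE indicE; have [yab|yab] := boolP (y \in `[a, b]%classic).
      by case: ifP => _; [exact: (bump_le1 a b n y)|exact: ler01].
    rewrite -/(bump_fun a b n y) bump_out ?if_same//; apply: contra yab => /andP[ay yb].
    by apply/mem_set; rewrite /= in_itv/= !ltW.
rewrite /Rintegral integral_indic// setIT [X in fine X](lebesgue_measure_itv `[a, b]) /=.
by case: ifP => //= _; rewrite subr_ge0.
Qed.

Lemma moving_bump_out x : x \notin `[a, (b + h)] -> moving (bump_fun a b n) h x = 0.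
Proof.
move=> xn; rewrite movingE// /Rintegral integral0_eq// => y /=.
rewrite in_itv/= => /andP[xhy yx]; rewrite bump_out//; apply: contra xn => /andP[ay yb].
by rewrite in_itv/=; apply/andP; split; lra.
Qed.

Lemma moving_bump_test : test_function (moving (bump_fun a b n) h).
Proof.
split; first exact: moving_smooth.
exists (Num.max `|a| `|b + h|) => x; rewrite gt_max => /andP[ax bx].
apply: moving_bump_out; rewrite in_itv/=; apply/negP => /andP[xa xb].
have [x0|x0] := leP 0 x.
  by move: bx; rewrite (ger0_norm x0) ltNge (le_trans xb)// ler_norm.
by move: ax; rewrite (ltr0_norm x0) ltNge -normrN (le_trans _ (ler_norm _))// lerN2.
Qed.

End Bump.
End TestCalculus.

(** * Weak derivatives and finite differences *)

Section WeakDerivative.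
Variable R : realType.
Local Notation mu := (@lebesgue_measure R).
Implicit Types (f g : R -> R[i]) (phi : R -> R).

Lemma ccvg_le (z : nat -> R[i]) w (K : R) : ccvg z w ->
  (forall n, cmodulus (z n) <= K) -> cmodulus w <= K.
Proof.
move=> zw zK.
have h : K + cmodulus (z n - w) @[n --> \oo] --> K + 0.
  by apply: cvgD => //; exact: cvg_cst.
have c : (fun _ : nat => cmodulus w) @ \oo --> cmodulus w by exact: cvg_cst.
rewrite addr0 in h; apply: (ler_cvg_to c h); apply: nearW => n.
have -> : w = z n - (z n - w) by ring.
rewrite (le_trans (cmodulusD _ _))// cmodulusN.
have -> : z n - (z n - (z n - w)) = z n - w by ring.
by rewrite lerD2r.
Qed.

Lemma Cint_bump_cvg f a b : clocally_integrable f ->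
  ccvg (fun n => Cint (fun x => f x * (bump_fun a b n x)%:C)) (cintegral `[a, b] f).
Proof.
move=> lf; rewrite cintegral_cindic.
have fi := clocally_integrable_ind a b lf.
have E n x : cmodulus (f x * (bump_fun a b n x)%:C - f x * cindic `[a, b] x) =
    cmodulus (f x) * `|bump_fun a b n x - \1_`[a, b] x|.
  rewrite -mulrBr cmodulusM -cmodulusR; congr (_ * cmodulus _).
  by rewrite /cindic; apply: complexP => /=; ring.
apply: (@ccvg_dominated _ _ _ (fun x => cmodulus (f x * cindic `[a, b] x))).
- by move=> n; apply: cL1_test => //; exact: bump_test.
- exact: fi.
- by case: fi.
- move=> n x; rewrite E cmodulusM cmodulus_cindic ler_wpM2l ?cmodulus_ge0//.
  rewrite indicE; have [xab|xab] := boolP (x \in _).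
    have := bump_ge0 a b n x; have := bump_le1 a b n x => h1 h2.
    by rewrite ler_norml; apply/andP; split; rewrite /=; lra.
  rewrite bump_out ?subrr ?normr0//; apply: contra xab => /andP[ax xb].
  by apply/mem_set; rewrite /= in_itv/= !ltW.
- apply: aeS (aeI (ae_neq a) (ae_neq b)) => x [xa xb]; rewrite /ccvg.
  rewrite (_ : (fun n => _) = (fun n => cmodulus (f x) * `|bump_fun a b n x - \1_`[a, b] x|));
    last by apply/funext => n; exact: E.
  rewrite -[X in _ --> X](mulr0 (cmodulus (f x))); apply: cvgM; first exact: cvg_cst.
  rewrite indicE; have [xab|xab] := boolP (x \in _).
    have {}xab : a < x < b.
      move/set_mem : xab; rewrite /= in_itv/= => /andP[ax' bx'].
      by rewrite !lt_neqAle ax' bx' eq_sym xa xb.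
    apply/norm_cvg0P; rewrite -(subrr (1 : R)); apply: cvgB; last exact: cvg_cst.
    exact: bump_cvg.
  rewrite (_ : (fun n => _) = (fun n => 0)); first exact: cvg_cst.
  apply/funext => n; rewrite bump_out ?subrr ?normr0//; apply: contra xab => /andP[ax xb'].
  by apply/mem_set; rewrite /= in_itv/= !ltW.
Qed.

(** The integral over an interval is the limit of pairings with bumps, so bounds on such
    pairings bound the averages. *)
Lemma ae_le_of_bumps f (C : R) (B : R -> R) : clocally_integrable f ->
  B (2 * n.+1%:R^-1) @[n --> \oo] --> C ->
  (forall a b n, a < b -> cmodulus (Cint (fun x => f x * (bump_fun a b n x)%:C)) <=
     (b - a) * B (b - a)) ->
  {ae mu, forall x, cmodulus (f x) <= C}.
Proof.
move=> lf BC fB; apply: (ae_le_of_averages (B := fun r => B (2 * r)) lf BC) => x r r0.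
apply: (ccvg_le (Cint_bump_cvg (x - r) (x + r) lf)) => n.
have -> : 2 * r = x + r - (x - r) by ring.
by apply: fB; lra.
Qed.

Lemma le_Cint_test g phi (a b M C : R) : a <= b -> 0 <= C -> cmeasurable g ->
  {ae mu, forall x, cmodulus (g x) <= C} -> test_function phi ->
  (forall x, `|phi x| <= M * \1_`[a, b] x) ->
  cmodulus (Cint (fun x => g x * (phi x)%:C)) <= C * M * (b - a).
Proof.
move=> ab C0 mg gC tphi phiM; have lg := bounded_loc mg gC.
have gi := cL1_test lg tphi.
rewrite -lee_fin; apply: (le_trans (le_cmodulus_Cint gi)).
have M0 : 0 <= M.
  by have := le_trans (normr_ge0 _) (phiM a); rewrite indicE mem_set ?mulr1//= in_itv/= lexx.
apply: (@le_trans _ _ (\int[mu]_x ((C * M)%:E * (\1_`[a, b] x)%:E))%E).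
  apply: ae_ge0_le_integral => //.
  - by move=> x _; rewrite lee_fin cmodulus_ge0.
  - by apply/measurable_EFinP; apply: measurable_cmodulus; case: gi.
  - by move=> x _; rewrite -EFinM lee_fin !mulr_ge0.
  - by apply: measurable_funeM; apply/measurable_EFinP; exact: measurable_indic.
  - apply: aeS gC => x h _; rewrite -EFinM lee_fin cmodulusM cmodulusR -mulrA.
    by apply: ler_pM => //; exact: cmodulus_ge0.
rewrite ge0_integralZl//; last 2 first.
- by apply/measurable_EFinP; exact: measurable_indic.
- by rewrite lee_fin mulr_ge0.
rewrite integral_indic// setIT [X in (_ * X)%E](lebesgue_measure_itv `[a, b]) /= lte_fin.
case: ifP => [_|/negbT]; first by rewrite -EFinD -EFinM.
by rewrite -leNgt => ba; rewrite mule0 lee_fin !mulr_ge0// subr_ge0.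
Qed.

(** The relation between consecutive weak derivatives of one function. *)
Definition weak1 f g : Prop :=
  [/\ clocally_integrable f, clocally_integrable g &
    forall phi, test_function phi ->
      Cint (fun x => f x * (phi^`()%classic x)%:C) = - Cint (fun x => g x * (phi x)%:C)].

Lemma weak1_succ n f g g' : weak_derivative n f g -> weak_derivative n.+1 f g' -> weak1 g g'.
Proof.
move=> [lf lg fg] [_ lg' fg']; split => // phi tphi.
have := fg _ (test_derive1n 1 tphi); have := fg' _ tphi.
have -> : derive1n n (derive1n 1 phi) = derive1n n.+1 phi.
  by rewrite /derive1n -iterD addn1.
move=> -> /eqP; rewrite -!/(Cint _) exprS mulN1r mulNr -mulrN.
have s0 : (-1) ^+ n != 0 :> R[i] by rewrite expf_neq0// oppr_eq0 oner_neq0.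
by rewrite (inj_eq (mulfI s0)) => /eqP <-.
Qed.

Lemma Cint_fdiff_test f h phi : clocally_integrable f -> test_function phi ->
  Cint (fun x => fdiff h f x * (phi x)%:C) = Cint (fun x => f x * (fdiff (- h) phi x)%:C).
Proof.
move=> lf tphi.
have i1 : cL1 (fun x => f (x + h) * (phi x)%:C).
  by apply: cL1_test => //; exact: clocally_integrable_shift.
have i2 := cL1_test lf tphi.
have i3 : cL1 (fun x => f x * (phi (x - h))%:C).
  have := cL1_shift (- h) i1; congr (cL1 _); apply/funext => x.
  by rewrite subrK.
transitivity (Cint (fun x => f (x + h) * (phi x)%:C) - Cint (fun x => f x * (phi x)%:C)).
  rewrite -CintB//; congr Cint; apply/funext => x; rewrite /fdiff; ring.
rewrite -(Cint_shift (- h) (cL1_meas i1)) -CintB//.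
  congr Cint; apply/funext => x; rewrite subrK /fdiff -mulrBr; congr (_ * _).
  by apply: complexP; rewrite /= ?subr0.
by have := cL1_shift (- h) i1.
Qed.

Lemma clocally_integrable_fdiff f h : clocally_integrable f -> clocally_integrable (fdiff h f).
Proof. by move=> lf; apply: clocally_integrableB => //; exact: clocally_integrable_shift. Qed.

Lemma weak1_fdiff h f g : weak1 f g -> weak1 (fdiff h f) (fdiff h g).
Proof.
move=> [lf lg fg]; split; [exact: clocally_integrable_fdiff|exact: clocally_integrable_fdiff|].
move=> phi tphi.
have td : test_function (phi^`()%classic) by exact: (test_derive1n 1 tphi).
rewrite !Cint_fdiff_test// -fg; last exact: test_fdiff.
congr Cint; apply/funext => x; congr (_ * _%:C).
by have := derive1n_fdiff (- h) 1 tphi.1 => /(congr1 (fun F => F x)).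
Qed.

(** A difference of [f] paired with a bump is [g] paired with a moving integral of the bump,
    whose size is at most the length of the interval and whose support is longer by [h]. *)
Lemma weak1_bound f g (C h : R) : 0 < h -> 0 <= C -> weak1 f g ->
  {ae mu, forall x, cmodulus (g x) <= C} ->
  {ae mu, forall x, cmodulus (fdiff h f x) <= C * h}.
Proof.
move=> h0 C0 [lf lg fg] gC.
apply: (ae_le_of_bumps (B := fun d => C * (d + h))).
- exact: clocally_integrable_fdiff.
- apply: cvgM; first exact: cvg_cst.
  rewrite -[X in _ --> X]add0r; apply: cvgD; last exact: cvg_cst.
  by rewrite -[X in _ --> X](mulr0 (2 : R)); apply: cvgM; [exact: cvg_cst|exact: cvg_harmonic].
move=> a b n ab; have tb := bump_test a b n.
have ab' := ltW ab; have h0' := ltW h0.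
rewrite Cint_fdiff_test//.
have -> : (fun x => f x * (fdiff (- h) (bump_fun a b n) x)%:C) =
    (fun x => - (f x * ((moving (bump_fun a b n) h)^`()%classic x)%:C)).
  apply/funext => x; rewrite derive1_moving// -mulrN; congr (_ * _).
  by apply: complexP; rewrite /= ?opprK ?oppr0.
have tm := moving_bump_test a b n h0'.
rewrite CintN; last by apply: cL1_test => //; exact: (test_derive1n 1 tm).
rewrite fg// opprK.
have -> : (b - a) * (C * (b - a + h)) = C * (b - a) * (b + h - a) by ring.
apply: le_Cint_test => //; first by lra.
- exact: clocally_integrable_meas.
- move=> x; rewrite indicE; have [xab|xab] := boolP (x \in _).
    by have /andP[m0 m1] := moving_bump_bound n ab' h0' x; rewrite mulr1 ger0_norm.
  rewrite moving_bump_out ?normr0 ?mulr0//; apply: contra xab => xab.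
  by apply/mem_set.
Qed.

(** Differencing the whole sequence preserves the relation between consecutive members and
    shifts the bounds by one step. *)
Lemma iter_fdiff_bound (V : nat -> R -> R[i]) (C c h : R) k : 0 < h -> 0 <= C -> 0 <= c ->
  (forall j, weak1 (V j) (V j.+1)) ->
  (forall j, {ae mu, forall x, cmodulus (V j x) <= C * c ^+ j}) ->
  {ae mu, forall x, cmodulus (iter k (fdiff h) (V 0%N) x) <= C * (c * h) ^+ k}.
Proof.
move=> h0; elim: k V C => [|k ih] V C C0 c0 VV VC.
  by have := VC 0%N; rewrite !expr0.
rewrite iterSr exprS mulrA; apply: (ih (fun j => fdiff h (V j))) => //.
- by rewrite !mulr_ge0// ltW.
- by move=> j; exact: weak1_fdiff.
- move=> j; have := weak1_bound h0 _ (VV j) (VC j.+1).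
  have -> : C * c ^+ j.+1 * h = C * (c * h) * c ^+ j by rewrite exprS; ring.
  by apply; rewrite mulr_ge0// exprn_ge0.
Qed.

Lemma cLnormy_ae f (C : R) : (cLnorm +oo%E f <= C%:E)%E ->
  {ae mu, forall x, cmodulus (f x) <= C}.
Proof.
rewrite /cLnorm unlock; case: ifPn => [_ /ess_supP h|].
  by apply: aeS h => x /=; rewrite lee_fin ger0_norm ?cmodulus_ge0.
move=> /negP muT; exfalso; apply: muT.
apply: (@lt_le_trans _ _ (mu `[0, 1]%classic)).
  by rewrite lebesgue_measure_itv/= lte_fin ltr01 -EFinD lte_fin subr0.
by apply: le_measure => //; rewrite inE//; exact: measurable_itv.
Qed.

Lemma weak_derivative0 f : clocally_integrable f -> weak_derivative 0 f f.
Proof. by move=> lf; split => // phi _; rewrite expr0 mul1r. Qed.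

(** The only consequence of the bounds on the weak derivatives that the proof uses: for
    differences, unlike weak derivatives, the product rule is an identity. *)
Lemma fdiff_bound_of_weak (W : R -> R[i]) (c h : R) : 0 <= c -> 0 < h ->
  (forall j, exists Wj, weak_derivative j W Wj /\ (cLnorm +oo%E Wj <= (c ^+ j)%:E)%E) ->
  cmeasurable W /\
  forall k, {ae mu, forall x, cmodulus (iter k (fdiff h) W x) <= (c * h) ^+ k}.
Proof.
move=> c0 h0 /choice[Wj hW].
have lW : clocally_integrable W by have [[]] := hW 0%N.
split; first exact: clocally_integrable_meas.
pose V j := if j is i.+1 then Wj i.+1 else W.
have wV j : weak_derivative j W (V j).
  by case: j => [|j]; [exact: weak_derivative0|have [] := hW j.+1].
have bV j : {ae mu, forall x, cmodulus (V j x) <= 1 * c ^+ j}.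
  rewrite mul1r; case: j => [|j]; last by apply: cLnormy_ae; have [] := hW j.+1.
  have [[_ lW0 W0E] W0b] := hW 0%N; have {}W0b := cLnormy_ae W0b.
  rewrite expr0 in W0b *.
  apply: (ae_le_of_bumps (B := fun=> 1)) => //; first exact: cvg_cst.
  move=> a b n ab; have tb := bump_test a b n.
  have := W0E _ tb; rewrite expr0 mul1r -!/(Cint _) => ->.
  rewrite mulr1 -[leRHS]mul1r -[X in X * _](mulr1 1).
  apply: le_Cint_test => //; [exact: ltW|exact: clocally_integrable_meas|].
  move=> x; rewrite mul1r ger0_norm ?bump_ge0// indicE.
  have [xab|xab] := boolP (x \in _); first exact: bump_le1.
  rewrite bump_out//; apply: contra xab => /andP[ax xb].
  by apply/mem_set; rewrite /= in_itv/= !ltW.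
move=> k; have := @iter_fdiff_bound V 1 c h k h0 ler01 c0 _ bV.
rewrite mul1r; apply => j; exact: weak1_succ (wV j) (wV j.+1).
Qed.

End WeakDerivative.

(** * Leibniz' rule for finite differences *)

Section DiscreteLeibniz.
Variable R : realType.
Local Notation mu := (@lebesgue_measure R).
Local Notation nrm f := (cLnorm 2%:E f).
Implicit Types (f g V v : R -> R[i]) (c : R).

(** Leibniz' formula for a factor whose derivatives are bounded by powers of [c]. *)
Definition binom_conv c (b : nat -> R) (n : nat) : R :=
  \sum_(j < n.+1) 'C(n, j)%:R * c ^+ (n - j) * b j.

Lemma binom_convS c b n :
  binom_conv c b n.+1 = c * binom_conv c b n + binom_conv c (fun j => b j.+1) n.
Proof.
rewrite /binom_conv big_ord_recl /= bin0 mul1r subn0.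
have -> : \sum_(i < n.+1) 'C(n.+1, bump 0 i)%:R * c ^+ (n.+1 - bump 0 i) * b (bump 0 i) =
    \sum_(i < n.+1) 'C(n, i.+1)%:R * c ^+ (n - i) * b i.+1 +
    \sum_(i < n.+1) 'C(n, i)%:R * c ^+ (n - i) * b i.+1.
  rewrite -big_split /=; apply: eq_bigr => i _.
  by rewrite /bump /= add1n binS natrD subSS; ring.
rewrite addrA; congr (_ + _).
rewrite big_ord_recr /= bin_small// !mul0r addr0.
rewrite [in RHS]big_ord_recl /= bin0 mul1r subn0 mulrDr mulrA -exprS; congr (_ + _).
rewrite mulr_sumr; apply: eq_bigr => i _; rewrite /bump /= add1n.
by rewrite -(subnSK (ltn_ord i)) exprS; ring.
Qed.

Lemma binom_conv_ge0 c b n : 0 <= c -> (forall j, (j <= n)%N -> 0 <= b j) -> 0 <= binom_conv c b n.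
Proof.
move=> c0 b0; apply: sumr_ge0 => j _; rewrite !mulr_ge0 ?exprn_ge0//.
by apply: b0; rewrite -ltnS.
Qed.

Section Step.
Variable h : R.

Lemma iter_fdiffD n f g :
  iter n (fdiff h) (fun x => f x + g x) =
  (fun x => iter n (fdiff h) f x + iter n (fdiff h) g x).
Proof.
elim: n f g => // n ih f g; rewrite !iterSr -ih; congr (iter n _ _).
by apply/funext => x; rewrite /fdiff; ring.
Qed.

Lemma iter_fdiff_shift n f s :
  iter n (fdiff h) (fun x => f (x + s)) = (fun x => iter n (fdiff h) f (x + s)).
Proof.
elim: n => // n ih; rewrite !iterS ih; apply/funext => x; rewrite /fdiff.
by rewrite addrAC.
Qed.

Lemma cmeasurable_fdiff f : cmeasurable f -> cmeasurable (fdiff h f).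
Proof. by move=> mf; apply: cmeasB => //; exact: cmeasurable_shift. Qed.

Lemma cmeasurable_iter_fdiff n f : cmeasurable f -> cmeasurable (iter n (fdiff h) f).
Proof. by move=> mf; elim: n => // n ih; rewrite iterS; exact: cmeasurable_fdiff. Qed.

Lemma ae_eq_iter_fdiff n f g : {ae mu, forall x, f x = g x} ->
  {ae mu, forall x, iter n (fdiff h) f x = iter n (fdiff h) g x}.
Proof.
move=> fg; elim: n => // n ih; apply: aeS (aeI ih (ae_shift h ih)) => x [e1 e2].
by rewrite !iterS /fdiff e1 e2.
Qed.

(** Leibniz' rule for differences. The shift in V(x + h) is harmless, since almost everywhere
    bounds are invariant under translation. *)
Lemma nrm_iter_fdiffM V v (C c : R) (b : nat -> R) n : 0 <= C -> 0 <= c ->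
  cmeasurable V -> cmeasurable v ->
  (forall k, {ae mu, forall x, cmodulus (iter k (fdiff h) V x) <= C * c ^+ k}) ->
  (forall j, (j <= n)%N -> (nrm (iter j (fdiff h) v) <= (b j)%:E)%E) ->
  (nrm (iter n (fdiff h) (fun x => V x * v x)%R) <= (C * binom_conv c b n)%:E)%E.
Proof.
elim: n V v C b => [|n ih] V v C b C0 c0 mV mv VC vb.
  rewrite /binom_conv big_ord_recl big_ord0 addr0 bin0 subnn expr0 !mul1r EFinM.
  apply: (@le_trans _ _ (C%:E * nrm v)%E); last first.
    by apply: lee_wpmul2l; [rewrite lee_fin|exact: (vb 0%N)].
  apply: le_nrm => //; first exact: cmeasM.
  apply: aeS (VC 0%N) => x /=; rewrite expr0 mulr1 => h0.
  by rewrite cmodulusM ler_wpM2r// cmodulus_ge0.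
rewrite iterSr.
have -> : fdiff h (fun x => V x * v x) =
    (fun x => fdiff h V x * v x + V (x + h) * fdiff h v x).
  by apply/funext => x; rewrite /fdiff; ring.
rewrite iter_fdiffD.
have mdV := cmeasurable_fdiff mV; have mdv := cmeasurable_fdiff mv.
have msV := cmeasurable_shift h mV.
apply: (le_trans (nrmD (cmeasurable_iter_fdiff n (cmeasM mdV mv))
  (cmeasurable_iter_fdiff n (cmeasM msV mdv)))).
have -> : (C * binom_conv c b n.+1)%:E =
    ((C * c * binom_conv c b n)%:E + (C * binom_conv c (fun j => b j.+1) n)%:E)%E.
  by rewrite binom_convS -EFinD; congr EFin; ring.
apply: leeD.
- apply: ih => //; first exact: mulr_ge0.
    move=> k; apply: aeS (VC k.+1) => x; rewrite iterSr => /le_trans; apply.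
    by rewrite exprS mulrA.
  by move=> j jn; apply: vb; exact: leqW.
- apply: ih => //.
    move=> k; rewrite iter_fdiff_shift; exact: (ae_shift h (VC k)).
  by move=> j jn; have := vb j.+1 jn; rewrite iterSr.
Qed.

Lemma plancherel_iter_fdiff n f F : plancherel f F ->
  plancherel (iter n (fdiff h) f) (fun xi => (expi (h * xi) - 1) ^+ n * F xi).
Proof.
move=> fF; elim: n => [|n ih].
  by rewrite /= (_ : (fun xi => _) = F)//; apply/funext => xi; rewrite expr0 mul1r.
rewrite iterS; have := plancherel_diff h ih; congr (plancherel _ _).
by apply/funext => xi; rewrite exprS mulrA.
Qed.

Lemma iter_fdiff_FT F n x : cL1 F ->
  iter n (fdiff h) (fun x => FT F (- x)) x =
  FT (fun xi => (expi (h * xi) - 1) ^+ n * F xi) (- x).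
Proof.
move=> Fi.
have bi m : cL1 (fun xi => (expi (h * xi) - 1) ^+ m * F xi).
  apply: (@cL1M_bounded _ _ _ (2 ^+ m)) => //.
    apply: cmeasX; apply: cmeasB; last exact: cmeas_cst.
    by apply: cmeasurable_expi; exact: measurable_funM.
  move=> xi; rewrite cmodulusX lerXn2r ?nnegrE ?cmodulus_ge0//.
  by rewrite (le_trans (cmodulusD _ _))// cmodulusN cmodulus_expi cmodulus1; lra.
elim: n x => [|n ih] x.
  by rewrite /=; congr (FT _ _); apply/funext => xi; rewrite expr0 mul1r.
rewrite iterS {1}/fdiff !ih /FT -CintB; [|exact: cL1_FT|exact: cL1_FT].
congr Cint; apply/funext => xi.
have -> : - (xi * - (x + h)) = h * xi + - (xi * - x) by ring.
by rewrite expiD exprS; ring.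
Qed.

End Step.
End DiscreteLeibniz.

(** * Moments of the transform and finite differences *)

Section Recurrence.
Variable R : realType.
Local Notation mu := (@lebesgue_measure R).
Local Notation nrm f := (cLnorm 2%:E f).
Local Notation sqrt2pi := (sqrt2pi R).
Implicit Types (f g u W : R -> R[i]).

(** The weight is |xi|^n, to match the symbol of |D|; up to a factor sqrt (2 pi) the L2
    norm of [moment n uh] is that of the n-th derivative of u. *)
Definition moment (n : nat) f (xi : R) : R[i] := (`|xi| ^+ n)%:C * f xi.

Lemma cmeasurable_moment n f : cmeasurable f -> cmeasurable (moment n f).
Proof.
move=> mf; apply: cmeasM => //; apply: cmeasR; apply: measurable_funX.
by apply: measurableT_comp; [exact: normr_measurable|exact: measurable_id].
Qed.

Lemma cmodulus_moment n f xi : cmodulus (moment n f xi) = `|xi| ^+ n * cmodulus (f xi).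
Proof. by rewrite cmodulusM cmodulusR ger0_norm// exprn_ge0. Qed.

Lemma expi_quotient_cvg (xi : R) :
  cmodulus (expi (n.+1%:R^-1 * xi) - 1) * n.+1%:R @[n --> \oo] --> `|xi|.
Proof.
have ds : is_derive (0 : R) (1 : R) (fun h => 2 * sin (h * (xi / 2))) xi.
  by apply: is_derive_eq; rewrite /GRing.scale /= mul0r cos0; field.
have [ex dv] := ds.
have h1 : (h^-1 * (2 * sin (h * (xi / 2)))) @[h --> (0:R)^'] --> xi.
  rewrite -[X in _ --> X]dv /derive; have := ex; rewrite /derivable.
  set F := (fun h => _ *: _); rewrite (_ : (fun h => h^-1 * _) = F)//.
  apply/funext => h; rewrite /F /= mul0r sin0 mulr0 subr0 /GRing.scale /=.
  by rewrite addr0 mulr1.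
have h2 : (forall n : nat, n.+1%:R^-1 != 0 :> R) /\ (n.+1%:R^-1 : R) @[n --> \oo] --> (0 : R).
  by split; [move=> n; rewrite invr_neq0|exact: cvg_harmonic].
have h3 := cvg_norm ((cvgr_dnbhsP _ _ _).1 h1 _ h2).
rewrite (_ : (fun n => _) =
  fun n => `|n.+1%:R^-1^-1 * (2 * sin (n.+1%:R^-1 * (xi / 2)))|); first exact: h3.
apply/funext => n; rewrite cmodulus_expiB1_sin invrK normrM mulrC normr_nat; congr (_ * _).
by rewrite normrM (ger0_norm (_ : 0 <= 2))// mulrA.
Qed.

Lemma cvg_exprn (v : nat -> R) (l : R) n :
  v k @[k --> \oo] --> l -> v k ^+ n @[k --> \oo] --> l ^+ n.
Proof.
move=> vl; elim: n => [|n ih]; first exact: cvg_cst.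
by under eq_fun do rewrite exprS; rewrite exprS; exact: cvgM.
Qed.

Lemma binom_conv_scale (c h : R) (b : nat -> R) n :
  binom_conv (c * h) (fun j => h ^+ j * b j) n = h ^+ n * binom_conv c b n.
Proof.
rewrite /binom_conv mulr_sumr; apply: eq_bigr => j _.
have jn : (j <= n)%N by rewrite -ltnS.
have -> : h ^+ n = h ^+ (n - j) * h ^+ j by rewrite -exprD subnK.
by rewrite exprMn; ring.
Qed.

(** Leibniz' rule bounds the n-th differences of the product, hence Bessel's inequality bounds
    the transform multiplied by ((exp(i h xi) - 1) / h)^n, uniformly in [h]. Fatou's lemma as
    [h] tends to 0 bounds the moment. *)
Lemma nrm_moment_product W u gh (c : R) (b : nat -> R) n :
  0 <= c -> (forall j, (j <= n)%N -> 0 <= b j) ->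
  cmeasurable W -> cmeasurable u -> plancherel (fun x => W x * u x) gh ->
  (forall (h : R) k, 0 < h -> {ae mu, forall x, cmodulus (iter k (fdiff h) W x) <= (c * h) ^+ k}) ->
  (forall (h : R) j, 0 < h -> (j <= n)%N -> (nrm (iter j (fdiff h) u) <= (h ^+ j * b j)%:E)%E) ->
  (nrm (moment n gh) <= (sqrt2pi * binom_conv c b n)%:E)%E.
Proof.
move=> c0 b0 mW mu' pl Wh uh; have s0 := sqrt2pi_gt0 R.
have [_ [mg _] _] := pl.
have B0 := binom_conv_ge0 c0 b0.
apply/nrm_leP; first by rewrite mulr_ge0// ltW.
pose h k : R := k.+1%:R^-1.
have h0 k : 0 < h k by rewrite invr_gt0 ltr0n.
pose D k xi := (expi (h k * xi) - 1) ^+ n * gh xi.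
have mD k : cmeasurable (D k).
  apply: cmeasM => //; apply: cmeasX; apply: cmeasB; last exact: cmeas_cst.
  by apply: cmeasurable_expi; exact: measurable_funM.
pose F k xi := (k.+1%:R ^+ n)%:C * D k xi.
have mF k : cmeasurable (F k) by apply: cmeasM; [exact: cmeas_cst|exact: mD].
apply: (@sqint_fatou _ F) => // [xi|k].
  rewrite cmodulus_moment.
  rewrite (_ : (fun k => _) = (fun k =>
      (cmodulus (expi (k.+1%:R^-1 * xi) - 1) * k.+1%:R) ^+ n * cmodulus (gh xi))).
    apply: cvgM; last exact: cvg_cst.
    apply: cvg_exprn; exact: expi_quotient_cvg.
  apply/funext => k; rewrite !cmodulusM cmodulusX cmodulusR normrX normr_nat exprMn.
  by rewrite mulrA [_ ^+ n * _]mulrC.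
apply/nrm_leP; first by rewrite mulr_ge0// ltW.
have kn0 : 0 <= k.+1%:R ^+ n :> R by rewrite exprn_ge0.
apply: (@le_trans _ _ ((k.+1%:R ^+ n)%:E * nrm (D k))%E).
  apply: le_nrm => //; apply: aeT => xi.
  by rewrite cmodulusM cmodulusR ger0_norm.
have hb : (nrm (iter n (fdiff (h k)) (fun x => W x * u x)%R) <=
    (1 * binom_conv (c * h k) (fun j => h k ^+ j * b j) n)%:E)%E.
  apply: nrm_iter_fdiffM => //; first by rewrite mulr_ge0// ltW.
    by move=> j; apply: aeS (Wh _ j (h0 k)) => x; rewrite mul1r.
  by move=> j jn; exact: uh.
have := le_trans (plancherel_bessel (plancherel_iter_fdiff (h k) n pl))
  (lee_wpmul2l (_ : (0 <= sqrt2pi%:E)%E) hb).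
rewrite lee_fin ltW// => /(_ isT) hD.
apply: (le_trans (lee_wpmul2l _ hD)); first by rewrite lee_fin.
rewrite -!EFinM lee_fin mul1r binom_conv_scale.
rewrite mulrCA [in X in _ * X]mulrA -exprMn mulfV ?pnatr_eq0// expr1n mul1r.
exact: lexx.
Qed.

(** Fourier inversion turns a moment of the transform into a bound on differences, since
    the chord of an arc is shorter than the arc. *)
Lemma nrm_iter_fdiff_moment u uh (B h : R) j : 0 <= B -> 0 < h -> plancherel u uh -> cL1 uh ->
  (nrm (moment j uh) <= (sqrt2pi * B)%:E)%E ->
  (nrm (iter j (fdiff h) u) <= (h ^+ j * B)%:E)%E.
Proof.
move=> B0 h0 pl Fi mB; have s0 := sqrt2pi_gt0 R.
have [[mu' _] [muh _] _] := pl.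
have pi0 : 2 * pi != 0 :> R by rewrite mulf_neq0// gt_eqF// pi_gt0.
pose G xi := (expi (h * xi) - 1) ^+ j * uh xi.
have mG : cmeasurable G.
  apply: cmeasM => //; apply: cmeasX; apply: cmeasB; last exact: cmeas_cst.
  by apply: cmeasurable_expi; exact: measurable_funM.
have Gi : cL1 G.
  apply: (@cL1M_bounded _ _ _ (2 ^+ j)) => //.
    apply: cmeasX; apply: cmeasB; last exact: cmeas_cst.
    by apply: cmeasurable_expi; exact: measurable_funM.
  move=> xi; rewrite cmodulusX lerXn2r ?nnegrE ?cmodulus_ge0//.
  by rewrite (le_trans (cmodulusD _ _))// cmodulusN cmodulus_expi cmodulus1; lra.
have nG : (nrm G <= (h ^+ j)%:E * nrm (moment j uh))%E.
  apply: le_nrm; rewrite ?exprn_ge0 ?ltW//; first exact: cmeasurable_moment.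
  apply: aeT => xi; rewrite cmodulusM cmodulusX cmodulus_moment mulrA -exprMn.
  rewrite ler_wpM2r ?cmodulus_ge0// lerXn2r ?nnegrE ?cmodulus_ge0//.
    by rewrite mulr_ge0 ?normr_ge0// ltW.
  by rewrite (le_trans (cmodulus_expiB1 _))// normrM gtr0_norm.
have uE := ae_eq_iter_fdiff h j (fourier_inversion pl Fi).
have dZ n x : iter n (fdiff h) (fun x => (2 * pi)%:C * u x) x =
    (2 * pi)%:C * iter n (fdiff h) u x.
  by elim: n x => // n ih x; rewrite !iterS /fdiff !ih mulrBr.
have mGF : cmeasurable (fun x => FT G (- x)).
  by apply: cmeasurable_opp; exact: cmeasurable_FT.
apply: (@le_trans _ _ ((2 * pi)^-1%:E * nrm (fun x => FT G (- x)))%E).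
  apply: le_nrm => //; first by rewrite invr_ge0 mulr_ge0// pi_ge0.
    exact: cmeasurable_iter_fdiff.
  apply: aeS uE => x; rewrite iter_fdiff_FT// => <-.
  rewrite dZ cmodulusM cmodulusR ger0_norm ?mulr_ge0 ?pi_ge0//.
  by rewrite mulrA mulVf// mul1r.
rewrite nrm_opp; last exact: cmeasurable_FT.
have i0 : (0 <= (2 * pi)^-1%:E :> \bar R)%E by rewrite lee_fin invr_ge0 mulr_ge0// pi_ge0.
apply: (le_trans (lee_wpmul2l i0 (bessel Gi))).
have s0' : (0 <= sqrt2pi%:E)%E by rewrite lee_fin ltW.
apply: (le_trans (lee_wpmul2l i0 (lee_wpmul2l s0' nG))).
have hj : (0 <= (h ^+ j)%:E)%E by rewrite lee_fin exprn_ge0// ltW.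
apply: (le_trans (lee_wpmul2l i0 (lee_wpmul2l s0' (lee_wpmul2l hj mB)))).
rewrite -!EFinM lee_fin -sqr_sqrt2pi.
have sn : sqrt2pi != 0 by rewrite gt_eqF.
by rewrite le_eqVlt; apply/orP; left; apply/eqP; field.
Qed.

End Recurrence.

(** * Weak derivatives from moments *)

Section TransformOfDerivative.
Variable R : realType.
Local Notation mu := (@lebesgue_measure R).
Local Notation nrm f := (cLnorm 2%:E f).
Local Notation sqrt2pi := (sqrt2pi R).
Implicit Types (f g u F : R -> R[i]) (phi : R -> R).

Lemma Rintegral_derive_compact (G g : R -> R) (M : R) :
  (forall x : R, is_derive x (1 : R) G (g x)) -> continuous g ->
  (forall x, M < `|x| -> G x = 0 /\ g x = 0) -> Rintegral mu setT g = 0.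
Proof.
move=> dG cg GM; pose A : R := `|M| + 1.
have A0 : 0 < A by rewrite ltr_wpDl.
have MA : M < A by rewrite (le_lt_trans (ler_norm M))// ltrDl.
have cG : continuous G.
  by move=> y; apply: differentiable_continuous; apply/derivable1_diffP; apply: ex_derive.
have -> : Rintegral mu setT g = Rintegral mu `[- A, A] g.
  rewrite [RHS]Rintegral_mkcond; apply: eq_Rintegral => x _; rewrite patchE.
  case: ifPn => //; rewrite notin_setE /= in_itv/= => /negP; rewrite -ler_norml -ltNge.
  by move=> xA; case: (GM x (lt_trans MA xA)).
rewrite /Rintegral (continuous_FTC2 (F := G))//.
- by rewrite !(GM _ _).1 ?normrN ?ger0_norm ?(ltW A0)//= subrr.
- by rewrite gtrN.
- exact: continuous_subspaceT.
- split.
  + by move=> y _; apply: ex_derive.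
  + by apply: cvg_at_right_filter; exact: cG.
  + by apply: cvg_at_left_filter; exact: cG.
- by move=> x _; rewrite derive1E derive_val.
Qed.

Lemma cL1_testC phi : test_function phi -> cL1 (fun x => (phi x)%:C).
Proof.
move=> tphi; have := @cL1_test _ (fun=> 1) phi _ tphi.
rewrite (_ : (fun x => 1 * _) = (fun x => (phi x)%:C)); last first.
  by apply/funext => x; rewrite mul1r.
apply; apply: (@bounded_loc _ _ 1); first exact: cmeas_cst.
by apply: aeT => x; rewrite cmodulus1.
Qed.

(** The difference of the two integrands is the derivative of a function of compact support. *)
Lemma FT_derive1 phi xi : test_function phi ->
  FT (fun x => (phi^`()%classic x)%:C) xi = (0 +i* xi) * FT (fun x => (phi x)%:C) xi.
Proof.
move=> tphi; have [sphi _] := tphi.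
have td : test_function (phi^`()%classic) := test_derive1n 1 tphi.
have [sd [M1 hM1]] := td; have [_ [M0 hM0]] := tphi.
have dphi x : is_derive x (1 : R) phi (phi^`()%classic x) := smooth_is_derive 0 x sphi.
have cphi := smooth_continuous sphi; have cd := smooth_continuous sd.
have lin x : is_derive x (1 : R) (fun x => x * xi) xi.
  by apply: is_derive_eq; rewrite /GRing.scale /=; ring.
have dcos x : is_derive x (1 : R) (fun x => cos (x * xi)) (- sin (x * xi) * xi).
  by have := @is_derive1_comp R cos _ x _ _ (is_derive_cos _) (lin x); rewrite mulrC.
have dsin x : is_derive x (1 : R) (fun x => sin (x * xi)) (cos (x * xi) * xi).
  by have := @is_derive1_comp R sin _ x _ _ (is_derive_sin _) (lin x); rewrite mulrC.
have cts (G g : R -> R) : (forall x : R, is_derive x (1 : R) G (g x)) -> continuous G.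
  by move=> dG y; apply: differentiable_continuous; apply/derivable1_diffP; apply: ex_derive.
have cc := cts _ _ dcos; have cs := cts _ _ dsin.
have H (c c' : R -> R) : (forall x : R, is_derive x (1 : R) c (c' x)) -> continuous c' ->
    Rintegral mu setT (fun x => phi x * c' x + c x * phi^`()%classic x) = 0.
  move=> dc cc'; apply: (@Rintegral_derive_compact (fun x => phi x * c x) _ (Num.max M0 M1)).
  - move=> x; apply: cvgD; apply: cvgM; [exact: cphi|exact: cc'|exact: (cts _ _ dc)|exact: cd].
  - by move=> x; rewrite gt_max => /andP[m0 m1]; rewrite hM0// hM1//; split; ring.
apply/eqP; rewrite -subr_eq0; apply/eqP.
have i1 := cL1_FT xi (cL1_testC td); have i0 := cL1_FT xi (cL1_testC tphi).
rewrite /FT -CintZ; last exact: i0.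
rewrite -CintB; [|exact: i1|exact: cL1Z].
apply: complexP => /=.
- apply: etrans (H _ _ dcos _) => [|x]; last first.
    by apply: cvgM; [apply: cvgN; exact: cs|exact: cvg_cst].
  by apply: eq_Rintegral => x _; rewrite /= cosN sinN; ring.
- have dms x : is_derive x (1 : R) (fun x => - sin (x * xi)) (- (cos (x * xi) * xi)).
    exact: is_deriveN.
  apply: etrans (H _ _ dms _) => [|x]; last first.
    by apply: cvgN; apply: cvgM; [exact: cc|exact: cvg_cst].
  by apply: eq_Rintegral => x _; rewrite /= cosN sinN; ring.
Qed.

Lemma FT_derive1n phi n xi : test_function phi ->
  FT (fun x => (derive1n n phi x)%:C) xi = (0 +i* xi) ^+ n * FT (fun x => (phi x)%:C) xi.
Proof.
move=> tphi; elim: n => [|n ih]; first by rewrite expr0 mul1r.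
by rewrite derive1nS FT_derive1 ?ih ?exprS ?mulrA//; exact: test_derive1n.
Qed.

Lemma Cint_inverse_mul F g : cL1 F -> cL1 g ->
  Cint (fun x => FT F (- x) * g x) = Cint (fun xi => F xi * FT g (- xi)).
Proof.
move=> Fi gi; have gi' := cL1_opp gi.
rewrite -[LHS]Cint_opp; last first.
  by apply: cmeasM; [apply: cmeasurable_opp; exact: cmeasurable_FT|exact: (cL1_meas gi)].
rewrite (_ : (fun x => _) = (fun x => FT F x * g (- x))); last first.
  by apply/funext => x; rewrite opprK.
rewrite (multiplication_formula Fi gi'); congr Cint; apply/funext => xi.
by rewrite FT_opp.
Qed.

(** Cauchy-Schwarz with the square integrable weight 1 / (1 + |xi|), which the Poisson kernel
    dominates. *)
Lemma cL1_of_moment f : square_integrable f -> square_integrable (moment 1 f) -> cL1 f.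
Proof.
move=> f2 m2; pose s (xi : R) : R := (1 + `|xi|)^-1.
have s0 xi : 0 < s xi by rewrite invr_gt0 ltr_pwDl.
have ms : measurable_fun [set: R] s.
  apply: continuous_measurable_fun => x.
  apply: cvgV; first by rewrite gt_eqF// ltr_pwDl.
  by apply: cvgD; [exact: cvg_cst|exact: norm_continuous].
have mS : cmeasurable (fun xi => (s xi)%:C) by apply: cmeasR.
have S2 : square_integrable (fun xi => (s xi)%:C).
  split => //; apply/(square_integrableP mS).
  apply: (@le_lt_trans _ _ (\int[mu]_x (poisson 1 x)%:E)%E); last first.
    by rewrite integral_poisson// ltry.
  apply: ge0_le_integral => //=.
  - by move=> x _; rewrite lee_fin sqr_ge0.
  - exact: measurable_sqmod.
  - by apply/measurable_EFinP; apply: continuous_measurable_fun; exact: continuous_poisson.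
  move=> x _; rewrite lee_fin cmodulusR gtr0_norm// /s /poisson exprVn expr1n mulr1.
  rewrite -[leLHS]mul1r ler_pM ?invr_ge0 ?sqr_ge0//; first by lra.
  rewrite lef_pV2 ?posrE ?exprn_gt0 ?ltr_pwDl ?sqr_ge0//.
  have := normr_ge0 x; rewrite -[x ^+ 2]real_normK ?num_real//; move: `|x| => y; nra.
have := cL1M S2 (square_integrableD f2 m2); congr cL1; apply/funext => xi.
rewrite /moment expr1.
have -> : f xi + `|xi|%:C * f xi = (1 + `|xi|)%:C * f xi.
  by rewrite rmorphD mulrDl mul1r.
by rewrite mulrA -rmorphM /= mulVf ?mul1r// gt_eqF// ltr_pwDl.
Qed.

Lemma moment_moment m n f : moment m (moment n f) = moment (m + n) f.
Proof. by apply/funext => xi; rewrite /moment mulrA -rmorphM /= exprD. Qed.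

(** The inverse transform of (i xi)^n uh is the n-th derivative of u: by the multiplication
    formula, the factor (i xi)^n can be moved onto the test function. *)
Lemma weak_derivative_of_moments u uh n : plancherel u uh ->
  (forall j, square_integrable (moment j uh)) ->
  exists un, weak_derivative n u un /\
    (nrm un <= (sqrt2pi^-1)%:E * nrm (moment n uh))%E.
Proof.
move=> pl mom; have [u2 uh2 _] := pl; have muh := uh2.1.
have pi0 : 0 < 2 * pi :> R by rewrite mulr_gt0// pi_gt0.
have Mi j : cL1 (moment j uh).
  by apply: cL1_of_moment; rewrite ?moment_moment; exact: mom.
have m0 : moment 0 uh = uh by apply/funext => xi; rewrite /moment expr0 mul1r.
have Fi : cL1 uh by rewrite -m0.
pose G xi := (0 +i* xi) ^+ n * uh xi.
have Gm xi : cmodulus (G xi) = cmodulus (moment n uh xi).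
  rewrite cmodulus_moment cmodulusM cmodulusX; congr (_ ^+ _ * _).
  by rewrite cmodulus_def /= expr0n /= add0r sqrtr_sqr.
have mi : cmeasurable (fun xi : R => 0 +i* xi).
  by split; [exact: measurable_cst|exact: measurable_id].
have mG : cmeasurable G by apply: cmeasM => //; exact: cmeasX.
have Gi : cL1 G.
  split => //; have := (Mi n).2; congr (integrable _ _ _).
  by apply/funext => x /=; rewrite Gm.
pose c : R := (2 * pi)^-1.
pose un x := c%:C * FT G (- x).
have mFG : cmeasurable (fun x => FT G (- x)).
  by apply: cmeasurable_opp; exact: cmeasurable_FT.
have mun : cmeasurable un by apply: cmeasM => //; exact: cmeas_cst.
have bun : (nrm un <= (sqrt2pi^-1)%:E * nrm (moment n uh))%E.
  have c0 : 0 <= c by rewrite invr_ge0 ltW.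
  apply: (@le_trans _ _ (c%:E * nrm (fun x => FT G (- x)))%E).
    apply: le_nrm => //; apply: aeT => x; rewrite cmodulusM cmodulusR ger0_norm//.
  rewrite nrm_opp; last exact: cmeasurable_FT.
  apply: (le_trans (lee_wpmul2l (_ : (0 <= c%:E)%E) (bessel Gi))); first by rewrite lee_fin.
  rewrite muleA -EFinM (eq_nrm Gm).
  suff -> : c * sqrt2pi = sqrt2pi^-1 by [].
  have sn : sqrt2pi != 0 by rewrite gt_eqF// sqrt2pi_gt0.
  by rewrite /c -sqr_sqrt2pi; field.
have un2 : square_integrable un.
  split => //; apply: (le_lt_trans bun); rewrite (nrm_fin (mom n)) -EFinM; exact: ltry.
exists un; split => //; split.
- exact: square_integrable_loc.
- exact: square_integrable_loc.
move=> phi tphi; have tn := test_derive1n n tphi.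
have pin := cL1_testC tn; have pi_ := cL1_testC tphi.
have E1 : Cint (fun x => u x * (derive1n n phi x)%:C) =
    Cint (fun x => c%:C * (FT uh (- x) * (derive1n n phi x)%:C)).
  apply: ae_eq_Cint.
  - by apply: cmeasM; [exact: u2.1|exact: (cL1_meas pin)].
  - apply: cmeasM; first exact: cmeas_cst.
    apply: cmeasM; last exact: (cL1_meas pin).
    by apply: cmeasurable_opp; exact: cmeasurable_FT.
  apply: aeS (fourier_inversion pl Fi) => x <-.
  by rewrite !mulrA -rmorphM /= mulVf ?mul1r// gt_eqF.
have bFT F : cL1 F -> forall g, cL1 g -> cL1 (fun x => FT F (- x) * g x).
  move=> iF g ig; apply: (@cL1M_bounded _ _ _ (L1norm F)) => //.
    by apply: cmeasurable_opp; exact: cmeasurable_FT.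
  by move=> x; exact: cmodulus_FT.
rewrite -!/(Cint _) E1 CintZ; last exact: bFT.
have -> : (fun x => un x * (phi x)%:C) = (fun x => c%:C * (FT G (- x) * (phi x)%:C)).
  by apply/funext => x; rewrite /un mulrA.
rewrite CintZ; last exact: bFT.
rewrite !Cint_inverse_mul// mulrCA; congr (_ * _).
rewrite -CintZ; last first.
  have := bFT _ pi_ _ Gi; congr cL1; apply/funext => x; exact: mulrC.
congr Cint; apply/funext => xi; rewrite FT_derive1n// /G.
have -> : (0 +i* (- xi)) = -1 * (0 +i* xi) :> R[i] by apply: complexP => /=; ring.
by rewrite exprMn; ring.
Qed.

End TransformOfDerivative.

(** * The recurrence for the moments *)

Section MomentSequence.
Variable R : realType.
Local Notation mu := (@lebesgue_measure R).
Local Notation nrm f := (cLnorm 2%:E f).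
Local Notation sqrt2pi := (sqrt2pi R).
Implicit Types (f g u W : R -> R[i]).

(** The equation turns the n-th moment of the transform of W u into the (n+1)-st moment of uh,
    so each moment follows from the previous ones. *)
Lemma moment_sequence W u uh gh (c : R) : 0 <= c -> cmeasurable W ->
  (forall (h : R) k, 0 < h ->
     {ae mu, forall x, cmodulus (iter k (fdiff h) W x) <= (c * h) ^+ k}) ->
  nrm u = 1%E -> plancherel u uh -> plancherel (fun x => W x * u x) gh ->
  {ae mu, forall xi, `|xi|%:C * uh xi = gh xi} ->
  exists b : nat -> R, [/\ forall n, 0 <= b n, b 0%N <= 1,
    forall n, b n.+1 <= binom_conv c b n &
    forall n, nrm (moment n uh) = (sqrt2pi * b n)%:E].
Proof.
move=> c0 mW Wh u1 plu plg eqn; have s0 := sqrt2pi_gt0 R.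
have sn : sqrt2pi != 0 by rewrite gt_eqF.
have [[mu' _] [muh _] _] := plu; have [_ [mgh _] _] := plg.
have mm n := cmeasurable_moment n muh.
have m0 : moment 0 uh = uh by apply/funext => xi; rewrite /moment expr0 mul1r.
have shift n : (nrm (moment n.+1 uh) <= nrm (moment n gh))%E.
  apply: le_nrm1 => //; first exact: cmeasurable_moment.
  apply: aeS eqn => xi; rewrite !cmodulus_moment => <-.
  by rewrite cmodulusM cmodulusR normr_id mulrA -exprSr.
have le0 : (nrm (moment 0 uh) <= (sqrt2pi * 1)%:E)%E.
  by rewrite m0 EFinM -u1; exact: plancherel_bessel.
(* Integrability of uh, on which inversion rests, comes from this first moment; it can only
   use the norm of u itself. *)
have le1 : (nrm (moment 1 uh) <= (sqrt2pi * binom_conv c (fun=> 1%R) 0)%:E)%E.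
  apply: (le_trans (shift 0%N)); apply: (nrm_moment_product _ _ mW mu' plg) => //.
  by move=> h j h0; rewrite leqn0 => /eqP -> /=; rewrite u1 expr0 mul1r.
have Fi : cL1 uh.
  rewrite -m0; apply: cL1_of_moment; rewrite ?moment_moment; split=> //.
    exact: (le_lt_trans le0 (ltry _)).
  exact: (le_lt_trans le1 (ltry _)).
pose b n : R := fine (nrm (moment n uh)) / sqrt2pi.
have b0 n : 0 <= b n by rewrite divr_ge0 ?fine_ge0 ?nrm_ge0// ltW.
have bE n : (nrm (moment n uh) < +oo)%E -> nrm (moment n uh) = (sqrt2pi * b n)%:E.
  by move=> fi; rewrite /b mulrC divfK// -nrm_fin.
have step n : (forall j, (j <= n)%N -> (nrm (moment j uh) < +oo)%E) ->
    (nrm (moment n.+1 uh) <= (sqrt2pi * binom_conv c b n)%:E)%E.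
  move=> fi; apply: (le_trans (shift n)); apply: (nrm_moment_product _ _ mW mu' plg) => //.
  move=> h j h0 jn; apply: (nrm_iter_fdiff_moment _ _ plu) => //.
  by rewrite bE//; exact: fi.
have fin n : forall j, (j <= n)%N -> (nrm (moment j uh) < +oo)%E.
  elim: n => [|n ih] j; first by rewrite leqn0 => /eqP ->; exact: (le_lt_trans le0 (ltry _)).
  rewrite leq_eqVlt => /orP[/eqP ->|]; last exact: ih.
  exact: (le_lt_trans (step n ih) (ltry _)).
exists b; split => //.
- by rewrite -(ler_pM2l s0) -lee_fin -bE// (fin 0%N).
- by move=> n; rewrite -(ler_pM2l s0) -lee_fin -bE ?(fin n.+1)//; apply: step; exact: fin.
- by move=> n; exact/bE/(fin n).
Qed.

End MomentSequence.

(** * Growth of the recurrence *)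

Section FactorialBound.
Variable R : realType.
Implicit Types (c t x : R) (b : nat -> R).

Lemma exp_partial_sum x n : 0 <= x -> \sum_(i < n) x ^+ i / i`!%:R <= expR x.
Proof.
move=> x0; rewrite -(big_mkord xpredT (fun i => x ^+ i / i`!%:R)).
apply: (@nondecreasing_cvgn_le _ (series (exp_coeff x))); last exact: is_cvg_series_exp_coeff.
apply/nondecreasing_seqP => k; rewrite /series /= big_nat_recr//= lerDl.
exact: exp_coeff_ge0.
Qed.

Section Sequence.
Variables (c t : R) (b : nat -> R).
Hypotheses (c0 : 0 <= c) (t0 : 0 <= t) (b0 : forall n, 0 <= b n) (b01 : b 0%N <= 1).
Hypothesis bS : forall n, b n.+1 <= binom_conv c b n.

Let a n : R := b n * t ^+ n / n`!%:R.
Let D : R := t * expR (c * t).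

Let D0 : 0 <= D. Proof. by rewrite mulr_ge0// expR_ge0. Qed.

Let factn0 n : n`!%:R != 0 :> R. Proof. by rewrite pnatr_eq0 -lt0n fact_gt0. Qed.

Let a_succ n m : (forall j, (j <= n)%N -> a j <= m) -> a n.+1 <= D / n.+1%:R * m.
Proof.
move=> am.
have m0 : 0 <= m by apply: le_trans (am 0%N isT); rewrite divr_ge0 ?mulr_ge0 ?exprn_ge0.
have e : binom_conv c b n * t ^+ n / n`!%:R =
    \sum_(j < n.+1) (c * t) ^+ (n - j) / (n - j)`!%:R * a j.
  rewrite /binom_conv !mulr_suml; apply: eq_bigr => j _.
  have jn : (j <= n)%N by rewrite -ltnS.
  have -> : t ^+ n = t ^+ (n - j) * t ^+ j by rewrite -exprD subnK.
  rewrite -(bin_fact jn) !natrM exprMn /a.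
  have bn : 'C(n, j)%:R != 0 :> R by rewrite pnatr_eq0 -lt0n bin_gt0.
  by field; rewrite bn !factn0.
have h : binom_conv c b n * t ^+ n / n`!%:R <= expR (c * t) * m.
  rewrite e; apply: (@le_trans _ _ (\sum_(j < n.+1) (c * t) ^+ (n - j) / (n - j)`!%:R * m)).
    apply: ler_sum => j _; rewrite ler_wpM2l ?divr_ge0 ?exprn_ge0 ?mulr_ge0//.
    by apply: am; rewrite -ltnS.
  rewrite -mulr_suml ler_wpM2r// (reindex_inj rev_ord_inj) /=.
  apply: le_trans (exp_partial_sum n.+1 (mulr_ge0 c0 t0)).
  apply: ler_sum => j _; rewrite subSS subKn//.
  by rewrite -ltnS.
have -> : D / n.+1%:R * m = t / n.+1%:R * (expR (c * t) * m).
  by rewrite /D; ring.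
apply: le_trans (ler_wpM2l (_ : 0 <= t / n.+1%:R) h); last by rewrite divr_ge0.
have -> : t / n.+1%:R * (binom_conv c b n * t ^+ n / n`!%:R) =
    binom_conv c b n * t ^+ n.+1 / n.+1`!%:R.
  by rewrite factS natrM exprS; field; rewrite factn0 nat1r pnatr_eq0.
by rewrite ler_wpM2r ?invr_ge0// ler_wpM2r ?exprn_ge0// bS.
Qed.

Let a0 : a 0%N <= 1. Proof. by rewrite /a expr0 fact0 mulr1 divr1. Qed.

Let a_small n : n%:R <= D -> forall j, (j <= n)%N -> a j <= D ^+ n / n`!%:R.
Proof.
elim: n => [_ j|n ih nD j].
  by rewrite leqn0 => /eqP ->; rewrite expr0 fact0 divr1.
have nD' : n%:R <= D by rewrite (le_trans _ nD)// ler_nat.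
have e : D ^+ n.+1 / n.+1`!%:R = D / n.+1%:R * (D ^+ n / n`!%:R).
  by rewrite factS natrM exprS; field; rewrite factn0 nat1r pnatr_eq0.
rewrite e leq_eqVlt => /orP[/eqP ->|]; first by apply: a_succ; exact: ih.
rewrite ltnS => jn; apply: (le_trans (ih nD' j jn)).
by rewrite ler_peMl ?divr_ge0 ?exprn_ge0// ler_pdivlMr ?mul1r.
Qed.

(** As long as n stays below D the ratio D / n exceeds one and the bound grows like the
    exponential series; beyond D it no longer grows. *)
Lemma sequence_exp_bound n : b n * t ^+ n / n`!%:R <= expR (t * expR (c * t)).
Proof.
suff : forall j, (j <= n)%N -> a j <= expR D by exact.
elim: n => [|n ih] j.
  by rewrite leqn0 => /eqP ->; apply: (le_trans a0); rewrite -expR0 ler_expR.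
rewrite leq_eqVlt => /orP[/eqP ->|]; last by rewrite ltnS; exact: ih.
have [nD|/ltW Dn] := leP n.+1%:R D.
  apply: (le_trans (a_small nD (leqnn _))).
  by apply: le_trans (expR_ge1Dxn n D0); rewrite lerDr.
apply: (le_trans (a_succ ih)); rewrite ler_piMl ?expR_ge0//.
by rewrite ler_pdivrMr ?mul1r.
Qed.

End Sequence.

Lemma expR1_le4 : expR 1 <= 4 :> R.
Proof.
have h : 2^-1 <= expR (- 2^-1) :> R by apply: le_trans (expR_ge1Dx _); lra.
have h2 : expR 2^-1 <= 2 :> R.
  by rewrite expRN lef_pV2 ?posrE ?expR_gt0 in h.
have -> : 1 = 2^-1 + 2^-1 :> R by field.
rewrite expRD; have := expR_ge0 (2^-1 : R); nra.
Qed.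

(** The bound of [sequence_exp_bound] is optimized in t.
    With t = L / M and L = ln (n + e), the exponent of the previous bound is at most
    n (A - M) / A, because L exp (- theta L) <= 1 / theta; and exp ((A - M) / A) <= A / M. *)
Lemma factorial_bound c kappa b n : 0 < c -> 1 < kappa ->
  (forall n, 0 <= b n) -> b 0%N <= 1 -> (forall n, b n.+1 <= binom_conv c b n) ->
  b n <= (kappa * c + 40 * ((ln kappa)^-1 + 1)) ^+ n *
    (n`!%:R / (ln (n%:R + expR 1)) ^+ n).
Proof.
move=> c0 k1 b0 b01 bS.
have [->|n0] := posnP n; first by rewrite !expr0 fact0 mul1r divr1.
have k0 : 0 < kappa by exact: lt_trans k1.
have lk := ln_gt0 k1; set l := (ln kappa)^-1.
have l0 : 0 < l by rewrite invr_gt0.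
have lk1 : ln kappa <= kappa - 1.
  by have := @le_ln1Dx R (kappa - 1); rewrite addrCA subrr addr0; apply; lra.
have kl : (kappa - 1)^-1 <= l by rewrite lef_pV2 ?posrE ?subr_gt0.
(* M lies below A in both terms: k' > 1 makes exp (c t) at most (n + e)^(1 / k'), and the gap
   20 (l + 1) between the constant terms dominates 10 / th. *)
pose k' : R := (1 + kappa) / 2; pose M : R := k' * c + 20 * (l + 1).
set A := kappa * c + 40 * (l + 1).
have k'1 : 1 < k' by rewrite /k'; lra.
have M0 : 0 < M by rewrite /M addr_gt0 ?mulr_gt0 ?addr_gt0//; lra.
have MA : M <= A by rewrite /M /A /k'; nra.
have A0 : 0 < A by exact: lt_le_trans MA.
have A2 : A <= 2 * M by rewrite /M /A /k'; nra.
have e1 : 1 <= expR 1 :> R by rewrite -[leLHS]expR0 ler_expR.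
have e4 := expR1_le4.
have n1 : 1 <= n%:R :> R by rewrite ler1n.
set L := ln (n%:R + expR 1).
have ne0 : 0 < n%:R + expR 1 :> R by lra.
have LE : expR L = n%:R + expR 1 by rewrite lnK.
have L1 : 1 <= L by rewrite -ler_expR LE lerDr.
have L0 : 0 < L by lra.
pose t := L / M; have t0 : 0 <= t by rewrite divr_ge0 ?ltW.
have tp : 0 < t by rewrite divr_gt0.
pose th : R := (kappa - 1) / (kappa + 1).
have th0 : 0 < th by rewrite divr_gt0; lra.
have thE : k'^-1 = 1 - th.
  by rewrite /th /k'; field; apply/eqP; lra.
have ct : c * t <= L - th * L.
  rewrite -[X in X - _]mul1r -mulrBl -thE /t mulrCA mulrC ler_wpM2r ?(ltW L0)//.
  rewrite ler_pdivrMr// mulrC ler_pdivlMr; last by lra.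
  by rewrite /M mulrC lerDl; nra.
(* th L <= exp (th L) *)
have LL : L * expR (- (th * L)) <= th^-1.
  rewrite expRN ler_pdivrMr ?expR_gt0// mulrC -ler_pdivrMr ?invr_gt0// invrK mulrC.
  by apply: le_trans (expR_ge1Dx _); rewrite lerDr.
have thi : th^-1 <= 1 + 2 * l.
  have -> : th^-1 = 1 + 2 * (kappa - 1)^-1.
    by rewrite /th; field; apply/andP; split; apply/eqP; lra.
  lra.
have DM : t * expR (c * t) <= 5 * n%:R * (1 + 2 * l) / M.
  have h1 : t * expR (c * t) <= t * expR (L - th * L) by rewrite ler_wpM2l// ler_expR.
  apply: (le_trans h1).
  have -> : t * expR (L - th * L) = L * expR (- (th * L)) * (n%:R + expR 1) / M.
    by rewrite expRD LE /t; ring.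
  rewrite ler_wpM2r ?invr_ge0 ?(ltW M0)// [leRHS]mulrC.
  apply: ler_pM; rewrite ?mulr_ge0 ?expR_ge0 ?(ltW L0) ?(ltW ne0)//.
    exact: le_trans LL thi.
  lra.
pose s : R := (A - M) / A.
have Ds : t * expR (c * t) <= n%:R * s.
  apply: (le_trans DM); rewrite /s -[X in X <= _]mulrA -[X in X <= _]mulrA.
  rewrite mulrCA ler_wpM2l ?ler0n//.
  rewrite mulrA ler_pdivrMr// mulrAC ler_pdivlMr//.
  have h : 10 * (1 + 2 * l) <= A - M by rewrite /A /M /k'; nra.
  nra.
have es : expR s <= A / M.
  have : M / A <= expR (- s).
    apply: le_trans (expR_ge1Dx _); rewrite /s.
    by rewrite le_eqVlt; apply/orP; left; apply/eqP; field; rewrite gt_eqF.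
  rewrite expRN => h; rewrite -(invf_div M A) -[leLHS]invrK.
  by rewrite lef_pV2 ?posrE ?invr_gt0 ?expR_gt0 ?divr_gt0.
have key := sequence_exp_bound (ltW c0) t0 b0 b01 bS n.
have f0 : 0 < n`!%:R :> R by rewrite ltr0n fact_gt0.
rewrite ler_pdivrMr// -ler_pdivlMr ?exprn_gt0// in key.
apply: (le_trans key).
have h : expR (t * expR (c * t)) <= (A / M) ^+ n.
  apply: (@le_trans _ _ (expR (n%:R * s))); first by rewrite ler_expR.
  by rewrite expRM_natl lerXn2r ?nnegrE ?expR_ge0 ?divr_ge0 ?(ltW A0) ?(ltW M0).
have -> : A ^+ n * (n`!%:R / L ^+ n) = (A / M) ^+ n * n`!%:R / t ^+ n.
  rewrite /t !expr_div_n; field.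
  by rewrite !expf_neq0 ?gt_eqF.
rewrite ler_wpM2r ?invr_ge0 ?exprn_ge0// ler_wpM2r//; exact: ltW.
Qed.

End FactorialBound.

(** * Factorial bounds for the derivatives of solutions *)

Theorem mainTheorem5 (R : realType) :
  exists K : R, 0 < K /\
  forall (C0 : R) (W u : R -> R[i]),
    0 < C0 ->
    (forall j : nat, exists Wj : R -> R[i],
        weak_derivative j W Wj /\ (cLnorm +oo%E Wj <= (C0 ^+ j)%:E)%E) ->
    square_integrable u ->
    cLnorm 2%:E u = 1%E ->
    absD u (fun x => W x * u x) ->
    forall kappa : R, 1 < kappa ->
    forall n : nat, exists un : R -> R[i],
      weak_derivative n u un /\
      (cLnorm 2%:E un <=
        ((kappa * C0 + K * ((ln kappa)^-1 + 1)) ^+ n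
          * (n`!%:R / (ln (n%:R + expR 1)) ^+ n))%:E)%E.
Proof.
exists 40; split; first exact: ltr0n.
move=> C0 W u C00 Wd u2 u1 [uh [gh [Fu Fg eqn]]] kappa k1 n.
have plu := fourier_transform_plancherel Fu.
have plg := fourier_transform_plancherel Fg.
have mW : cmeasurable W by case: (fdiff_bound_of_weak (ltW C00) ltr01 Wd).
have Wh (h : R) k : 0 < h ->
    {ae lebesgue_measure, forall x, cmodulus (iter k (fdiff h) W x) <= (C0 * h) ^+ k}.
  by move=> h0; case: (fdiff_bound_of_weak (ltW C00) h0 Wd) => _; exact.
have [b [b0 b01 bS bE]] := moment_sequence (ltW C00) mW Wh u1 plu plg eqn.
have muh : cmeasurable uh by case: plu => _ [].
have mom j : square_integrable (moment j uh).
  by split; [exact: cmeasurable_moment|rewrite bE ltry].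
have [un [wun bun]] := weak_derivative_of_moments n plu mom.
exists un; split => //; apply: (le_trans bun); rewrite bE -EFinM lee_fin mulrA mulVf ?mul1r.
  exact: factorial_bound.
by rewrite gt_eqF// sqrt2pi_gt0.
Qed.
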